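(* Let $K$ be a field, let $A$ be a 2-Calabi-Yau $K$-algebra, let $S$ be a finite-dimensional rigid simple left $A$-module, and let $I_S=\mathrm{Ann}_A(S)=\{a\in A\mid aS=0\}$. Then $I_S$ is a tilting ideal in $A$, it has finite codimension in $A$, and there is an isomorphism $\mathrm{End}_A(I_S)\cong A^{op}$ (endomorphisms of $I_S$ as a left $A$-module) under which $a\in A$ corresponds to the homothety of right multiplication by $a$.
   Context: A simple $A$-module $S$ is rigid if $\mathrm{Ext}^1_A(S,S)=0$. Tilting: $\mathrm{add}\,M$ is the class of modules isomorphic to a direct summand of a finite direct sum of copies of $M$. A module $T$ is a tilting module if (1) there is an exact sequence $0\to P_1\to P_0\to T\to0$ with $P_0,P_1\in\mathrm{add}\,A$; (2) $\mathrm{Ext}^i_A(T,T)=0$ for all $i>0$; (3) there is an exact sequence $0\to A\to T_0\to T_1\to0$ with $T_0,T_1\in\mathrm{add}\,T$. An ideal $I$ of $A$ is a tilting ideal if it is a tilting module both as a left and as a right $A$-module. Calabi-Yau: regard $A\otimes_KA$ as an $A$-bimodule via the outer actions; for an $A$-bimodule $M$, $\mathrm{Hom}_{AA}(M,A\otimes_KA)$ is an $A$-bimodule via the inner actions. $A$ is homologically smooth if it has a finite projective resolution by finitely generated projective $A$-bimodules, and is $d$-Calabi-Yau if moreover $\mathbf{R}\mathrm{Hom}_{AA}(A,A\otimes_KA)\cong A[-d]$ in the derived category of $A$-bimodules. *)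

(* Defs.v *)
From HB Require Import structures.
From mathcomp Require Import all_boot all_order all_algebra.
From mathcomp Require Import generic_quotient boolp.

Set Implicit Arguments.
Unset Strict Implicit.
Unset Printing Implicit Defensive.

Import GRing.Theory.
Local Open Scope ring_scope.
Local Open Scope quotient_scope.

#[local] Obligation Tactic := idtac.

(* Modules over a ring R are left modules; right R-modules are modules over   *)
(* the converse ring R^c.                                                     *)

Definition surj (U V : Type) (f : U -> V) : Prop := forall y, exists x, f x = y.

Definition exact_at (U V W : zmodType) (f : U -> V) (g : V -> W) : Prop :=
  forall y, g y = 0 <-> exists x, f x = y.

Section Modules.
Variable R : nzRingType.
Implicit Types M N P T : lmodType R.

Definition short_exact M N P (f : {linear M -> N}) (g : {linear N -> P}) :
  Prop := [/\ injective f, exact_at f g & surj g].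

Definition simple_module M : Prop :=
  (exists x : M, x != 0) /\
  forall U : {pred M}, submod_closed U ->
    (forall x, x \in U -> x = 0) \/ (forall x, x \in U).

Definition projective_module P : Prop :=
  forall M N (g : {linear M -> N}) (f : {linear P -> N}), surj g ->
    exists h : {linear P -> M}, forall x, g (h x) = f x.

Record projective_resolution M := ProjectiveResolution {
  pr_term :> nat -> lmodType R;
  pr_diff : forall n, {linear pr_term n.+1 -> pr_term n};
  pr_aug : {linear pr_term 0%N -> M};
  pr_proj : forall n, projective_module (pr_term n);
  pr_aug_surj : surj pr_aug;
  pr_exact0 : exact_at (pr_diff 0%N) pr_aug;
  pr_exactS : forall n, exact_at (pr_diff n.+1) (pr_diff n)
}.

(* Cocycles and coboundaries of degree n in the cochain complex Hom(P, N).    *)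
Definition cocycle M N (P : projective_resolution M) n
    (f : {linear P n -> N}) : Prop := forall x, f (pr_diff P n x) = 0.

Definition coboundary M N (P : projective_resolution M) n :
    {linear P n -> N} -> Prop :=
  match n with
  | 0%N => fun f => forall x, f x = 0
  | m.+1 => fun f => exists g : {linear P m -> N},
                       forall x, f x = g (pr_diff P m x)
  end.

(* Ext^n(M, N) = 0; Ext^n(M, N) is H^n(Hom(P, N)) for a projective resolution *)
(* P of M, and does not depend on the choice of P.                            *)
Definition Ext_vanishes n M N : Prop :=
  exists P : projective_resolution M,
    forall f : {linear P n -> N}, cocycle f -> coboundary f.

Definition rigid M : Prop := Ext_vanishes 1 M M.

(* N is in add M: a complement N' makes N (+) N' a finite power of M.         *)
Definition in_add M N : Prop :=
  exists (n : nat) (N' : lmodType R)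
    (f : {linear (N * N')%type -> {ffun 'I_n -> M}}), bijective f.

Definition tilting_module T : Prop :=
  [/\ exists (P1 P0 : lmodType R) (f : {linear P1 -> P0}) (g : {linear P0 -> T}),
        [/\ in_add R^o P1, in_add R^o P0 & short_exact f g],
      forall i : nat, (0 < i)%N -> Ext_vanishes i T T
    & exists (T0 T1 : lmodType R)
        (f : {linear R^o -> T0}) (g : {linear T0 -> T1}),
        [/\ in_add T T0, in_add T T1 & short_exact f g]].

End Modules.

Record ideal (R : nzRingType) := Ideal {
  ideal_mem :> {pred R};
  ideal0 : 0 \in ideal_mem;
  idealD : forall x y, x \in ideal_mem -> y \in ideal_mem ->
    x + y \in ideal_mem;
  idealMl : forall a x, x \in ideal_mem -> a * x \in ideal_mem;
  idealMr : forall a x, x \in ideal_mem -> x * a \in ideal_mem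
}.

Section IdealModules.
Variables (R : nzRingType) (I : ideal R).

Definition left_ideal_mem : {pred R^o} := ideal_mem I.
Definition right_ideal_mem : {pred (R^c)^o} := ideal_mem I.

Lemma left_ideal_closed : submod_closed left_ideal_mem.
Proof.
by split=> [|a x y xI yI]; [apply: (ideal0 I) | apply: (idealD (idealMl _ xI))].
Qed.

Lemma right_ideal_closed : submod_closed right_ideal_mem.
Proof.
by split=> [|a x y xI yI]; [apply: (ideal0 I) | apply: (idealD (idealMr _ xI))].
Qed.

HB.instance Definition _ :=
  GRing.isSubmodClosed.Build R R^o left_ideal_mem left_ideal_closed.
HB.instance Definition _ :=
  GRing.isSubmodClosed.Build R^c (R^c)^o right_ideal_mem right_ideal_closed.

Record left_ideal :=
  LeftIdeal { left_ideal_val : R^o; _ : left_ideal_val \in left_ideal_mem }.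
Record right_ideal :=
  RightIdeal { right_ideal_val : (R^c)^o; _ : right_ideal_val \in right_ideal_mem }.

HB.instance Definition _ := [isSub for left_ideal_val].
HB.instance Definition _ := [Choice of left_ideal by <:].
HB.instance Definition _ := [SubChoice_isSubLmodule of left_ideal by <:].
HB.instance Definition _ := [isSub for right_ideal_val].
HB.instance Definition _ := [Choice of right_ideal by <:].
HB.instance Definition _ := [SubChoice_isSubLmodule of right_ideal by <:].

Definition tilting_ideal : Prop :=
  tilting_module left_ideal /\ tilting_module right_ideal.

End IdealModules.

Section Annihilator.
Variables (R : nzRingType) (M : lmodType R).

Definition ann_mem : {pred R} := fun a => `[< forall x : M, a *: x = 0 >].

Lemma ann_memP a : reflect (forall x : M, a *: x = 0) (a \in ann_mem).
Proof. exact: asboolP. Qed.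

Lemma ann0 : 0 \in ann_mem.
Proof. by apply/ann_memP => x; rewrite scale0r. Qed.

Lemma annD a b : a \in ann_mem -> b \in ann_mem -> a + b \in ann_mem.
Proof.
move=> /ann_memP ha /ann_memP hb; apply/ann_memP => x.
by rewrite scalerDl ha hb addr0.
Qed.

Lemma annMl a b : b \in ann_mem -> a * b \in ann_mem.
Proof.
by move=> /ann_memP hb; apply/ann_memP => x; rewrite -scalerA hb scaler0.
Qed.

Lemma annMr a b : b \in ann_mem -> b * a \in ann_mem.
Proof. by move=> /ann_memP hb; apply/ann_memP => x; rewrite -scalerA hb. Qed.

Definition annihilator : ideal R := Ideal ann0 annD annMl annMr.

End Annihilator.

Section FiniteDimension.
Variables (K : fieldType) (A : algType K).

(* K acts on an A-module through k%:A. *)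
Definition finite_dimensional (M : lmodType A) : Prop :=
  exists (n : nat) (e : 'I_n -> M), forall x, exists c : 'I_n -> K,
    x = \sum_(i < n) (c i)%:A *: e i.

Definition finite_codimension (I : ideal A) : Prop :=
  exists (n : nat) (e : 'I_n -> A), forall x, exists c : 'I_n -> K,
    x - \sum_(i < n) c i *: e i \in I.

End FiniteDimension.

Lemma linear_ext (R : pzRingType) (U V : lmodType R) (f g : {linear U -> V}) :
  f =1 g -> f = g.
Proof.
case: f g => [f [[+] [+]]] [g [[+] [+]]] /=.
move=> h1 h2 h3 h4 /funext efg; move: efg h1 h2 h3 h4 => /= -> h1 h2 h3 h4.
by rewrite (Prop_irrelevance h1 h3) (Prop_irrelevance h2 h4).
Qed.

Section Endomorphisms.
Variables (K : fieldType) (A : algType K) (M : lmodType A).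

Record endo := Endo { endo_linear :> {linear M -> M} }.
HB.instance Definition _ := gen_eqMixin endo.
HB.instance Definition _ := gen_choiceMixin endo.

Implicit Types f g h : endo.

Definition endo_zero : endo := Endo \0.
Definition endo_one : endo := Endo idfun.
Definition endo_opp f : endo := Endo (\- f).
Definition endo_add f g : endo := Endo (f \+ g).
Definition endo_mul f g : endo := Endo (f \o g).

Lemma central_scale (k : K) (a : A) (x : M) :
  k%:A *: (a *: x) = a *: (k%:A *: x).
Proof. by rewrite !scalerA -scalerAl -scalerAr mul1r mulr1. Qed.

Section Scale.
Variables (k : K) (f : endo).
Definition endo_scale_fun (x : M) : M := k%:A *: f x.
Lemma endo_scale_linear : linear endo_scale_fun.
Proof.
move=> a x y; rewrite /endo_scale_fun linearP scalerDr.
by rewrite central_scale.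
Qed.
HB.instance Definition _ := GRing.isLinear.Build A M M *:%R endo_scale_fun
  endo_scale_linear.
Definition endo_scale : endo := Endo endo_scale_fun.
End Scale.

Lemma endo_ext f g : (forall x, f x = g x) -> f = g.
Proof. by case: f g => [f] [g] /= efg; congr Endo; apply: linear_ext. Qed.

Lemma endo_addA : associative endo_add.
Proof. by move=> f g h; apply: endo_ext => x; apply: addrA. Qed.
Lemma endo_addC : commutative endo_add.
Proof. by move=> f g; apply: endo_ext => x; apply: addrC. Qed.
Lemma endo_add0 : left_id endo_zero endo_add.
Proof. by move=> f; apply: endo_ext => x; apply: add0r. Qed.
Lemma endo_addN : left_inverse endo_zero endo_opp endo_add.
Proof. by move=> f; apply: endo_ext => x; apply: addNr. Qed.

HB.instance Definition _ :=
  GRing.isZmodule.Build endo endo_addA endo_addC endo_add0 endo_addN.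

Lemma endo_mulA : associative endo_mul.
Proof. by move=> f g h; apply: endo_ext. Qed.
Lemma endo_mul1 : left_id endo_one endo_mul.
Proof. by move=> f; apply: endo_ext. Qed.
Lemma endo_1mul : right_id endo_one endo_mul.
Proof. by move=> f; apply: endo_ext. Qed.
Lemma endo_mulDl : left_distributive endo_mul +%R.
Proof. by move=> f g h; apply: endo_ext. Qed.
Lemma endo_mulDr : right_distributive endo_mul +%R.
Proof. by move=> f g h; apply: endo_ext => x; apply: linearD. Qed.

HB.instance Definition _ := GRing.Zmodule_isPzRing.Build endo
  endo_mulA endo_mul1 endo_1mul endo_mulDl endo_mulDr.

Lemma endo_scaleA (k l : K) f :
  endo_scale k (endo_scale l f) = endo_scale (k * l) f.
Proof.
apply: endo_ext => x.
change (k%:A *: (l%:A *: f x) = (k * l)%:A *: f x).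
by rewrite scalerA -scalerAl mul1r scalerA.
Qed.
Lemma endo_scale1 : left_id 1 endo_scale.
Proof.
move=> f; apply: endo_ext => x; change (1%:A *: f x = f x).
by rewrite scale1r scale1r.
Qed.
Lemma endo_scaleDr : right_distributive endo_scale +%R.
Proof. by move=> k f g; apply: endo_ext => x; apply: scalerDr. Qed.
Lemma endo_scaleDl f : {morph endo_scale^~ f : k l / k + l}.
Proof.
move=> k l; apply: endo_ext => x.
change ((k + l)%:A *: f x = k%:A *: f x + l%:A *: f x).
by rewrite !scalerDl.
Qed.

HB.instance Definition _ := GRing.Zmodule_isLmodule.Build K endo
  endo_scaleA endo_scale1 endo_scaleDr endo_scaleDl.

End Endomorphisms.

Section Bimodules.
Variables (K : fieldType) (A : algType K).

(* A-bimodules on which K acts centrally. *)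
Record bimod := Bimod {
  bimod_sort :> lmodType A;
  ract : bimod_sort -> A -> bimod_sort;
  ractDl : forall x y a, ract (x + y) a = ract x a + ract y a;
  ractDr : forall x a b, ract x (a + b) = ract x a + ract x b;
  ract1 : forall x, ract x 1 = x;
  ractA : forall x a b, ract (ract x a) b = ract x (a * b);
  ract_lact : forall a x b, ract (a *: x) b = a *: ract x b;
  ract_scalar : forall (k : K) x, ract x k%:A = k%:A *: x
}.

Record bimod_hom (M N : bimod) := BimodHom {
  bimod_hom_linear :> {linear M -> N};
  bimod_homR : forall x a,
    bimod_hom_linear (ract x a) = ract (bimod_hom_linear x) a
}.

Lemma bimod_hom_ext (M N : bimod) (f g : bimod_hom M N) : f =1 g -> f = g.
Proof.
case: f g => [f hf] [g hg] /= /linear_ext efg.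
by subst g; rewrite (Prop_irrelevance hf hg).
Qed.

HB.instance Definition _ M N := gen_eqMixin (bimod_hom M N).
HB.instance Definition _ M N := gen_choiceMixin (bimod_hom M N).

Lemma ract0 (M : bimod) (a : A) : ract (0 : M) a = 0.
Proof. by apply: (addrI (ract (0 : M) a)); rewrite -ractDl !addr0. Qed.

Lemma ractN (M : bimod) (x : M) (a : A) : ract (- x) a = - ract x a.
Proof.
by apply: (addrI (ract x a)); rewrite -ractDl !subrr ract0.
Qed.

Section HomOperations.
Variables M N : bimod.
Implicit Types f g h : bimod_hom M N.

Lemma bimod_hom_zeroR (x : M) a :
  (\0 : {linear M -> N}) (ract x a) = ract ((\0 : {linear M -> N}) x) a.
Proof. by rewrite /= ract0. Qed.
Definition bimod_hom_zero := BimodHom bimod_hom_zeroR.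

Lemma bimod_hom_addR f g (x : M) a :
  (f \+ g : {linear M -> N}) (ract x a) = ract ((f \+ g) x) a.
Proof. by rewrite /= ractDl !bimod_homR. Qed.
Definition bimod_hom_add f g := BimodHom (bimod_hom_addR f g).

Lemma bimod_hom_oppR f (x : M) a :
  (\- f : {linear M -> N}) (ract x a) = ract ((\- f) x) a.
Proof. by rewrite /= ractN !bimod_homR. Qed.
Definition bimod_hom_opp f := BimodHom (bimod_hom_oppR f).

Lemma bimod_hom_addA : associative bimod_hom_add.
Proof. by move=> f g h; apply: bimod_hom_ext => x; apply: addrA. Qed.
Lemma bimod_hom_addC : commutative bimod_hom_add.
Proof. by move=> f g; apply: bimod_hom_ext => x; apply: addrC. Qed.
Lemma bimod_hom_add0 : left_id bimod_hom_zero bimod_hom_add.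
Proof. by move=> f; apply: bimod_hom_ext => x; apply: add0r. Qed.
Lemma bimod_hom_addN : left_inverse bimod_hom_zero bimod_hom_opp bimod_hom_add.
Proof. by move=> f; apply: bimod_hom_ext => x; apply: addNr. Qed.

HB.instance Definition _ := GRing.isZmodule.Build (bimod_hom M N)
  bimod_hom_addA bimod_hom_addC bimod_hom_add0 bimod_hom_addN.

End HomOperations.

Lemma bimod_hom_compR (M N P : bimod) (g : bimod_hom N P) (f : bimod_hom M N)
  (x : M) a :
  (g \o f : {linear M -> P}) (ract x a) = ract ((g \o f) x) a.
Proof. by rewrite /= !bimod_homR. Qed.
Definition bimod_hom_comp M N P (g : bimod_hom N P) (f : bimod_hom M N) :=
  BimodHom (bimod_hom_compR g f).

Definition regular_ract (x : A^o) (a : A) : A^o := (x : A) * a.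

Program Definition regular_bimod : bimod :=
  @Bimod A^o regular_ract _ _ _ _ _ _.
Next Obligation. by move=> x y a; apply: mulrDl. Qed.
Next Obligation. by move=> x a b; apply: mulrDr. Qed.
Next Obligation. by move=> x; apply: mulr1. Qed.
Next Obligation. by move=> x a b; rewrite /regular_ract mulrA. Qed.
Next Obligation. by move=> a x b; rewrite /regular_ract [RHS]mulrA. Qed.
Next Obligation.
move=> k x; rewrite /regular_ract -scalerAr mulr1.
by change (k *: (x : A) = k%:A * (x : A)); rewrite mulr_algl.
Qed.

Program Definition zero_bimod : bimod :=
  @Bimod 'rV[A]_0 (fun x _ => x) _ _ _ _ _ _.
Next Obligation. by []. Qed.
Next Obligation. by move=> x a b; rewrite [LHS]thinmx0 [RHS]thinmx0. Qed.
Next Obligation. by []. Qed.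
Next Obligation. by []. Qed.
Next Obligation. by []. Qed.
Next Obligation. by move=> k x; rewrite [LHS]thinmx0 [RHS]thinmx0. Qed.

Definition bimod_projective (P : bimod) : Prop :=
  forall (M N : bimod) (g : bimod_hom M N) (f : bimod_hom P N), surj g ->
    exists h : bimod_hom P M, forall x, g (h x) = f x.

Definition bimod_finitely_generated (M : bimod) : Prop :=
  exists (n : nat) (e : 'I_n -> M), forall x, exists s : seq (A * 'I_n * A),
    x = \sum_(t <- s) t.1.1 *: ract (e t.1.2) t.2.

End Bimodules.

Arguments regular_bimod {K} A.
Arguments zero_bimod {K} A.

(* A (x)_K A is the quotient of the formal finite sums of pairs (a, b),       *)
(* standing for pure tensors, that identifies two sums when no K-bilinear map *)
(* on A x A separates them.                                                   *)
Section Tensor.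
Variables (K : fieldType) (A : algType K).

Definition bilinear_sum (V : lmodType K) (b : {bilinear A -> A -> V})
  (s : seq (A * A)) : V := \sum_(p <- s) b p.1 p.2.

Definition tensor_rel (s t : seq (A * A)) : bool :=
  `[< forall (V : lmodType K) (b : {bilinear A -> A -> V}),
        bilinear_sum b s = bilinear_sum b t >].

Lemma tensor_relP s t : reflect
  (forall (V : lmodType K) (b : {bilinear A -> A -> V}),
     bilinear_sum b s = bilinear_sum b t) (tensor_rel s t).
Proof. exact: asboolP. Qed.

Lemma tensor_rel_refl : reflexive tensor_rel.
Proof. by move=> s; apply/tensor_relP. Qed.
Lemma tensor_rel_sym : symmetric tensor_rel.
Proof.
by move=> s t; apply/tensor_relP/tensor_relP => h V b; rewrite h.
Qed.
Lemma tensor_rel_trans : transitive tensor_rel.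
Proof.
move=> t s u /tensor_relP h1 /tensor_relP h2; apply/tensor_relP => V b.
by rewrite h1.
Qed.

Canonical tensor_equiv :=
  EquivRel tensor_rel tensor_rel_refl tensor_rel_sym tensor_rel_trans.

Definition tensor := {eq_quot tensor_equiv}.
HB.instance Definition _ := Choice.on tensor.
HB.instance Definition _ := EqQuotient.on tensor.

Implicit Types (x y z : tensor) (f g : {linear A -> A}).

Definition tensor_of (s : seq (A * A)) : tensor := \pi_(tensor) s.

Definition pure_tensor (a b : A) : tensor := tensor_of [:: (a, b)].

Definition tensor_eval (V : lmodType K) (b : {bilinear A -> A -> V}) x : V :=
  bilinear_sum b (repr x).

Lemma tensor_eval_of (V : lmodType K) (b : {bilinear A -> A -> V}) s :
  tensor_eval b (tensor_of s) = bilinear_sum b s.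
Proof.
rewrite /tensor_eval /tensor_of; case: piP => t /eqmodP /tensor_relP /(_ V b).
by move=> ->.
Qed.

Lemma tensor_ext x y :
  (forall (V : lmodType K) (b : {bilinear A -> A -> V}),
     tensor_eval b x = tensor_eval b y) -> x = y.
Proof.
move=> h; rewrite -[x]reprK -[y]reprK; apply/eqmodP/tensor_relP; exact: h.
Qed.

Definition tensor_zero : tensor := tensor_of [::].
Definition tensor_add x y : tensor := tensor_of (repr x ++ repr y).
Definition tensor_map (f g : {linear A -> A}) x : tensor :=
  tensor_of [seq (f p.1, g p.2) | p <- repr x].
Definition tensor_opp : tensor -> tensor := tensor_map (\- idfun) idfun.

Section BilinearComp.
Variables (V : lmodType K) (b : {bilinear A -> A -> V}) (f g : {linear A -> A}).
Definition bilinear_comp (u v : A) : V := b (f u) (g v).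
Lemma bilinear_comp_bilinear : bilinear_for *:%R *:%R bilinear_comp.
Proof.
split=> [v k u u'|u k v v'] /=; rewrite /bilinear_comp /applyr.
  by rewrite linearP linearDl linearZl_LR.
by rewrite linearP linearDr linearZr.
Qed.
HB.instance Definition _ := bilinear_isBilinear.Build K A A V *:%R *:%R
  bilinear_comp bilinear_comp_bilinear.
End BilinearComp.

Lemma tensor_eval0 (V : lmodType K) (b : {bilinear A -> A -> V}) :
  tensor_eval b tensor_zero = 0.
Proof. by rewrite tensor_eval_of /bilinear_sum big_nil. Qed.

Lemma tensor_evalD (V : lmodType K) (b : {bilinear A -> A -> V}) x y :
  tensor_eval b (tensor_add x y) = tensor_eval b x + tensor_eval b y.
Proof. by rewrite tensor_eval_of /bilinear_sum big_cat. Qed.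

Lemma tensor_eval_map (V : lmodType K) (b : {bilinear A -> A -> V}) f g x :
  tensor_eval b (tensor_map f g x) = tensor_eval (bilinear_comp b f g) x.
Proof. by rewrite tensor_eval_of /bilinear_sum big_map. Qed.

Lemma tensor_evalN (V : lmodType K) (b : {bilinear A -> A -> V}) x :
  tensor_eval b (tensor_opp x) = - tensor_eval b x.
Proof.
rewrite tensor_eval_map /tensor_eval /bilinear_sum -sumrN.
by apply: eq_bigr => p _; rewrite /= /bilinear_comp /= linearNl.
Qed.

Lemma tensor_addA : associative tensor_add.
Proof.
by move=> x y z; apply: tensor_ext => V b; rewrite !tensor_evalD addrA.
Qed.
Lemma tensor_addC : commutative tensor_add.
Proof.
by move=> x y; apply: tensor_ext => V b; rewrite !tensor_evalD addrC.
Qed.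
Lemma tensor_add0 : left_id tensor_zero tensor_add.
Proof.
by move=> x; apply: tensor_ext => V b; rewrite tensor_evalD tensor_eval0 add0r.
Qed.
Lemma tensor_addN : left_inverse tensor_zero tensor_opp tensor_add.
Proof.
move=> x; apply: tensor_ext => V b.
by rewrite tensor_evalD tensor_evalN tensor_eval0 addNr.
Qed.

HB.instance Definition _ :=
  GRing.isZmodule.Build tensor tensor_addA tensor_addC tensor_add0 tensor_addN.

Lemma tensor_mapD f g : {morph tensor_map f g : x y / x + y}.
Proof.
move=> x y; apply: tensor_ext => V b.
by rewrite [RHS]tensor_evalD !tensor_eval_map tensor_evalD.
Qed.

Lemma tensor_map_comp f g (f' g' : {linear A -> A}) x :
  tensor_map f g (tensor_map f' g' x) = tensor_map (f \o f') (g \o g') x.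
Proof. by apply: tensor_ext => V b; rewrite !tensor_eval_map. Qed.

Lemma tensor_map_id f g x : (forall u, f u = u) -> (forall u, g u = u) -> tensor_map f g x = x.
Proof.
move=> hf hg; apply: tensor_ext => V b; rewrite tensor_eval_map.
by apply: eq_bigr => p _; rewrite /= /bilinear_comp hf hg.
Qed.

Lemma eq_tensor_map f g (f' g' : {linear A -> A}) x :
  f =1 f' -> g =1 g' -> tensor_map f g x = tensor_map f' g' x.
Proof.
move=> hf hg; apply: tensor_ext => V b; rewrite !tensor_eval_map.
by apply: eq_bigr => p _; rewrite /= /bilinear_comp hf hg.
Qed.

Lemma tensor_map_addl f (f1 f2 : {linear A -> A}) g x : (forall u, f u = f1 u + f2 u) ->
  tensor_map f g x = tensor_map f1 g x + tensor_map f2 g x.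
Proof.
move=> hf; apply: tensor_ext => V b.
rewrite [RHS]tensor_evalD !tensor_eval_map /tensor_eval /bilinear_sum.
by rewrite -big_split; apply: eq_bigr => p _; rewrite /= /bilinear_comp hf linearDl.
Qed.

Lemma tensor_map_addr f g (g1 g2 : {linear A -> A}) x : (forall u, g u = g1 u + g2 u) ->
  tensor_map f g x = tensor_map f g1 x + tensor_map f g2 x.
Proof.
move=> hg; apply: tensor_ext => V b.
rewrite [RHS]tensor_evalD !tensor_eval_map /tensor_eval /bilinear_sum.
by rewrite -big_split; apply: eq_bigr => p _; rewrite /= /bilinear_comp hg linearDr.
Qed.

Lemma tensor_map_scal (k : K) f g (f' g' : {linear A -> A}) x : (forall u, f u = k *: f' u) ->
  (forall u, g' u = k *: g u) -> tensor_map f g x = tensor_map f' g' x.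
Proof.
move=> hf hg; apply: tensor_ext => V b; rewrite !tensor_eval_map.
apply: eq_bigr => p _; rewrite /= /bilinear_comp hf hg.
by rewrite linearZl_LR linearZr.
Qed.

Definition lmul (a : A) : {linear A -> A} := a \*o idfun.
Definition rmul (a : A) : {linear A -> A} := a \o* idfun.

(* Outer action: a (u (x) v) b = au (x) vb. *)
Definition outer_lact (a : A) x := tensor_map (lmul a) idfun x.
Definition outer_ract x (b : A) := tensor_map idfun (rmul b) x.

(* Inner action: a (u (x) v) b = ub (x) av. *)
Definition inner_lact (a : A) x := tensor_map idfun (lmul a) x.
Definition inner_ract x (b : A) := tensor_map (rmul b) idfun x.

Lemma outer_lactE a u v :
  outer_lact a (pure_tensor u v) = pure_tensor (a * u) v.
Proof.
apply: tensor_ext => V b; rewrite tensor_eval_map !tensor_eval_of.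
by rewrite /bilinear_sum !big_seq1.
Qed.
Lemma outer_ractE u v a :
  outer_ract (pure_tensor u v) a = pure_tensor u (v * a).
Proof.
apply: tensor_ext => V b; rewrite tensor_eval_map !tensor_eval_of.
by rewrite /bilinear_sum !big_seq1.
Qed.
Lemma inner_lactE a u v :
  inner_lact a (pure_tensor u v) = pure_tensor u (a * v).
Proof.
apply: tensor_ext => V b; rewrite tensor_eval_map !tensor_eval_of.
by rewrite /bilinear_sum !big_seq1.
Qed.
Lemma inner_ractE u v a :
  inner_ract (pure_tensor u v) a = pure_tensor (u * a) v.
Proof.
apply: tensor_ext => V b; rewrite tensor_eval_map !tensor_eval_of.
by rewrite /bilinear_sum !big_seq1.
Qed.

Lemma outer_lactA a b x : outer_lact a (outer_lact b x) = outer_lact (a * b) x.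
Proof.
by rewrite /outer_lact tensor_map_comp; apply: eq_tensor_map => u //=; rewrite mulrA.
Qed.
Lemma outer_lact1 : left_id 1 outer_lact.
Proof. by move=> x; apply: tensor_map_id => u //=; rewrite mul1r. Qed.
Lemma outer_lactDr : right_distributive outer_lact +%R.
Proof. by move=> a x y; apply: tensor_mapD. Qed.
Lemma outer_lactDl x : {morph outer_lact^~ x : a b / a + b}.
Proof. by move=> a b; apply: tensor_map_addl => u /=; rewrite mulrDl. Qed.

HB.instance Definition _ := GRing.Zmodule_isLmodule.Build A tensor
  outer_lactA outer_lact1 outer_lactDr outer_lactDl.

Program Definition tensor_bimod : bimod A :=
  @Bimod _ _ tensor outer_ract _ _ _ _ _ _.
Next Obligation. by move=> x y a; apply: tensor_mapD. Qed.
Next Obligation. by move=> x a b; apply: tensor_map_addr => u /=; rewrite mulrDr. Qed.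
Next Obligation. by move=> x; apply: tensor_map_id => u //=; rewrite mulr1. Qed.
Next Obligation.
by move=> x a b; rewrite /outer_ract tensor_map_comp; apply: eq_tensor_map => u //=;
  rewrite mulrA.
Qed.
Next Obligation.
by move=> a x b; rewrite [LHS]tensor_map_comp [RHS]tensor_map_comp; apply: eq_tensor_map.
Qed.
Next Obligation.
move=> k x; apply/esym; apply: (@tensor_map_scal k) => u /=.
  by rewrite mulr_algl.
by rewrite mulr_algr.
Qed.

End Tensor.

Arguments tensor_bimod {K} A.

(* Hom_{AA}(M, A (x) A): homomorphisms for the outer actions, made into a     *)
(* bimodule by the inner actions.                                             *)
Section HomTensor.
Variables (K : fieldType) (A : algType K) (M : bimod A).

Definition dual := bimod_hom M (tensor_bimod A).
HB.instance Definition _ := GRing.Zmodule.on dual.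

Section InnerLeft.
Variables (a : A) (f : dual).
Definition dual_lact_fun (x : M) : tensor_bimod A := inner_lact a (f x).
Lemma dual_lact_linear : linear dual_lact_fun.
Proof.
move=> c x y; rewrite /dual_lact_fun linearP [LHS]tensor_mapD; congr (_ + _).
by rewrite [LHS]tensor_map_comp [RHS]tensor_map_comp; apply: eq_tensor_map.
Qed.
HB.instance Definition _ := GRing.isLinear.Build A M (tensor_bimod A) *:%R
  dual_lact_fun dual_lact_linear.
Lemma dual_lactR (x : M) c :
  (dual_lact_fun : {linear _ -> _}) (ract x c) = ract (dual_lact_fun x) c.
Proof.
rewrite /= /dual_lact_fun bimod_homR [LHS]tensor_map_comp [RHS]tensor_map_comp.
by apply: eq_tensor_map => u //=; rewrite mulrA.
Qed.
Definition dual_lact : dual := BimodHom dual_lactR.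
End InnerLeft.

Section InnerRight.
Variables (f : dual) (a : A).
Definition dual_ract_fun (x : M) : tensor_bimod A := inner_ract (f x) a.
Lemma dual_ract_linear : linear dual_ract_fun.
Proof.
move=> c x y; rewrite /dual_ract_fun linearP [LHS]tensor_mapD; congr (_ + _).
rewrite [LHS]tensor_map_comp [RHS]tensor_map_comp.
by apply: eq_tensor_map => u //=; rewrite mulrA.
Qed.
HB.instance Definition _ := GRing.isLinear.Build A M (tensor_bimod A) *:%R
  dual_ract_fun dual_ract_linear.
Lemma dual_ractR (x : M) c :
  (dual_ract_fun : {linear _ -> _}) (ract x c) = ract (dual_ract_fun x) c.
Proof.
rewrite /= /dual_ract_fun bimod_homR [LHS]tensor_map_comp [RHS]tensor_map_comp.
by apply: eq_tensor_map.
Qed.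
Definition dual_ract : dual := BimodHom dual_ractR.
End InnerRight.

Lemma dual_lactA a b f : dual_lact a (dual_lact b f) = dual_lact (a * b) f.
Proof.
apply: bimod_hom_ext => x; rewrite [LHS]tensor_map_comp.
by apply: eq_tensor_map => u //=; rewrite mulrA.
Qed.
Lemma dual_lact1 : left_id 1 dual_lact.
Proof.
move=> f; apply: bimod_hom_ext => x.
by apply: tensor_map_id => u //=; rewrite mul1r.
Qed.
Lemma dual_lactDr : right_distributive dual_lact +%R.
Proof. by move=> a f g; apply: bimod_hom_ext => x; apply: tensor_mapD. Qed.
Lemma dual_lactDl f : {morph dual_lact^~ f : a b / a + b}.
Proof.
move=> a b; apply: bimod_hom_ext => x.
by apply: tensor_map_addr => u /=; rewrite mulrDl.
Qed.

HB.instance Definition _ := GRing.Zmodule_isLmodule.Build A dual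
  dual_lactA dual_lact1 dual_lactDr dual_lactDl.

Program Definition dual_bimod : bimod A :=
  @Bimod _ _ dual dual_ract _ _ _ _ _ _.
Next Obligation.
by move=> f g a; apply: bimod_hom_ext => x; apply: tensor_mapD.
Qed.
Next Obligation.
move=> f a b; apply: bimod_hom_ext => x.
by apply: tensor_map_addl => u /=; rewrite mulrDr.
Qed.
Next Obligation.
move=> f; apply: bimod_hom_ext => x.
by apply: tensor_map_id => u //=; rewrite mulr1.
Qed.
Next Obligation.
move=> f a b; apply: bimod_hom_ext => x; rewrite [LHS]tensor_map_comp.
by apply: eq_tensor_map => u //=; rewrite mulrA.
Qed.
Next Obligation.
move=> a f b; apply: bimod_hom_ext => x.
by rewrite [LHS]tensor_map_comp [RHS]tensor_map_comp; apply: eq_tensor_map.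
Qed.
Next Obligation.
move=> k f; apply: bimod_hom_ext => x; apply: (@tensor_map_scal _ _ k) => u /=.
  by rewrite mulr_algr.
by rewrite mulr_algl.
Qed.

End HomTensor.

Section DualMap.
Variables (K : fieldType) (A : algType K) (M N : bimod A) (d : bimod_hom M N).

Definition dual_map_fun (f : dual_bimod N) : dual_bimod M := bimod_hom_comp f d.
Lemma dual_map_linear : linear dual_map_fun.
Proof. by move=> a f g; apply: bimod_hom_ext. Qed.
HB.instance Definition _ := GRing.isLinear.Build A (dual_bimod N)
  (dual_bimod M) *:%R dual_map_fun dual_map_linear.
Lemma dual_mapR (f : dual_bimod N) a :
  (dual_map_fun : {linear _ -> _}) (ract f a) = ract (dual_map_fun f) a.
Proof. exact: bimod_hom_ext. Qed.
Definition dual_map : bimod_hom (dual_bimod N) (dual_bimod M) :=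
  BimodHom dual_mapR.

End DualMap.

Section CalabiYau.
Variables (K : fieldType) (A : algType K).

Record bimod_complex := BimodComplex {
  cpx_term :> int -> bimod A;
  cpx_diff : forall i, bimod_hom (cpx_term i) (cpx_term (1 + i));
  cpx_diff2 : forall i x, cpx_diff (1 + i) (cpx_diff i x) = 0
}.

Record cochain_map (X Y : bimod_complex) := CochainMap {
  cochain_map_fun :> forall i, bimod_hom (X i) (Y i);
  cochain_mapE : forall i x,
    cochain_map_fun (1 + i) (cpx_diff X i x) = cpx_diff Y i (cochain_map_fun i x)
}.

(* f is injective and surjective on H^(1 + i), where 1 + i runs through all   *)
(* integers.                                                                  *)
Definition quasi_iso (X Y : bimod_complex) (f : cochain_map X Y) : Prop :=
  forall i : int,
    (forall x : X (1 + i), cpx_diff X (1 + i) x = 0 ->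
       (exists y, f (1 + i) x = cpx_diff Y i y) ->
       exists x', x = cpx_diff X i x') /\
    (forall y : Y (1 + i), cpx_diff Y (1 + i) y = 0 ->
       exists x : X (1 + i), cpx_diff X (1 + i) x = 0 /\
         exists y', y = f (1 + i) x + cpx_diff Y i y').

(* Isomorphisms in the derived category are the roofs X <- Z -> Y in which    *)
(* both maps are quasi-isomorphisms.                                          *)
Definition derived_iso (X Y : bimod_complex) : Prop :=
  exists (Z : bimod_complex) (f : cochain_map Z X) (g : cochain_map Z Y),
    quasi_iso f /\ quasi_iso g.

(* M[-d], i.e. M placed in degree d. *)
Definition shift_term (M : bimod A) (d : nat) (i : int) : bimod A :=
  if i == d%:Z then M else zero_bimod A.
Definition shift_complex (M : bimod A) (d : nat) : bimod_complex :=
  @BimodComplex (shift_term M d) (fun i => bimod_hom_zero _ _)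
    (fun i x => erefl).

Record bimod_resolution (M : bimod A) := BimodResolution {
  br_term :> nat -> bimod A;
  br_diff : forall n, bimod_hom (br_term n.+1) (br_term n);
  br_aug : bimod_hom (br_term 0%N) M;
  br_aug_surj : surj br_aug;
  br_exact0 : exact_at (br_diff 0%N) br_aug;
  br_exactS : forall n, exact_at (br_diff n.+1) (br_diff n)
}.

Definition finite_fg_projective (M : bimod A) (P : bimod_resolution M) : Prop :=
  (forall n, bimod_projective (P n) /\ bimod_finitely_generated (P n)) /\
  exists N : nat, forall n, (N <= n)%N -> forall x : P n, x = 0.

(* Hom_{AA}(P, A (x) A), with Hom_{AA}(P n, A (x) A) in degree n. The usual   *)
(* signs of the differential are dropped, which gives an isomorphic complex.  *)
Section DualComplex.
Variables (M : bimod A) (P : bimod_resolution M).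

Definition dual_term (i : int) : bimod A :=
  match i with Posz n => dual_bimod (P n) | Negz _ => zero_bimod A end.

Definition dual_diff (i : int) : bimod_hom (dual_term i) (dual_term (1 + i)) :=
  match i return bimod_hom (dual_term i) (dual_term (1 + i)) with
  | Posz n => dual_map (br_diff P n)
  | Negz _ => bimod_hom_zero _ _
  end.

Lemma dual_diff2 i x : dual_diff (1 + i) (dual_diff i x) = 0.
Proof.
case: i x => [n|n] x; last by rewrite [dual_diff _ x]/= linear0.
apply: bimod_hom_ext => u /=.
have [_ exP] := @br_exactS M P n (br_diff P n.+1 u).
by rewrite exP ?linear0 //; exists u.
Qed.

Definition dual_complex : bimod_complex := BimodComplex dual_diff2.
End DualComplex.

(* The existence of P says that A is homologically smooth, and dual_complex P *)
(* computes RHom_{AA}(A, A (x) A).                                            *)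
Definition calabi_yau (d : nat) : Prop :=
  exists P : bimod_resolution (regular_bimod A),
    finite_fg_projective P /\
    derived_iso (dual_complex P) (shift_complex (regular_bimod A) d).

End CalabiYau.

Arguments calabi_yau {K} A d.

(* Main.v *)
Require Import Defs.
From HB Require Import structures.
From mathcomp Require Import all_boot all_order all_algebra.
From mathcomp Require Import boolp.
From mathcomp Require generic_quotient classical_sets.

(* Write B = A/I with I = Ann(S). If P is a projective bimodule resolution of *)
(* A, then P/PI is a resolution of B by finitely generated projective left    *)
(* modules, and Hom_A(P/PI, A) is D(B) tensored over A with the complex       *)
(* Hom_{AA}(P, A (x) A). The latter is quasi-isomorphic to A[-2] and splits   *)
(* as a complex of left modules, so Ext^n(B, A) vanishes for n <> 2, and      *)
(* Ext^2(B, A) = D(B) is killed by I. Thus P/PI can be truncated to length 2, *)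
(* I has a resolution 0 -> Z -> Q -> I -> 0 with Z and Q finitely generated   *)
(* projective, and every left linear map from I to A is a right homothety.    *)
(* Rigidity of S gives I = I^2, so Hom_A(I, B) = 0; a map from Z to I extends *)
(* to a map from Q to A because Ext^2(B, A) I = 0, and this extension takes   *)
(* its values in I because Hom_A(I, B) = 0. Hence Ext^1(I, I) = 0.            *)
(* The Calabi-Yau property and the equality I = I^2 are left-right symmetric, *)
(* so all this holds on both sides, and Hom(-, I) turns the resolution of I   *)
(* on one side into the coresolution 0 -> A -> T0 -> T1 -> 0 on the other.    *)

Set Implicit Arguments.
Unset Strict Implicit.
Unset Printing Implicit Defensive.

Import GRing.Theory.
Local Open Scope ring_scope.

(** * Finitely generated projective modules *)

(** Two independent facts about [I = Ann(S)] carry the proof. The first comes from rigidity. A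
    finite spanning set of [S] gives a finite chain of left ideals from [A] down to [I] whose
    quotients are 0 or [S]. Since Ext^1(S, S) = 0, a map [I -> S] extends up this chain to [A], so
    it is [x => x v] and vanishes on [I] ([ann_hom0]). As [I] is finitely generated, a nonzero
    [I / I^2] would map onto [S]; hence [I = I^2] ([ann_idempotent]).

    The second comes from the Calabi-Yau property. The dual complex has cohomology [A], in degree 2
    only, so it splits over left [A] ([left_contraction]), and cocycles of the maps [P / P I -> A]
    are combinations of cocycles of the dual complex with coefficients in the dual of [A / I]
    ([cochain_split]). This gives the groups Ext^n(A/I, A) recorded in [reduced_complex]. Degrees 0
    and 1 make right multiplication an isomorphism from [A] onto the endomorphisms of [I]
    ([rc_faithful], [rc_hom]); degrees 3 and above give [I] projective dimension at most one
    ([rc_resolution]).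

    Both facts together give Ext^1(I, I) = 0 ([Ext1_ideal_self]). They also hold on the right
    ([cy2_data_flip], [right_ideal_idempotent]), and [tilting_coresolution] turns the resolution of
    [I] on one side into the coresolution of [A] on the other. *)

Lemma linear_of_fun (R : nzRingType) (M N : lmodType R) (f : M -> N) :
  linear f -> exists g : {linear M -> N}, g =1 f.
Proof.
move=> lf; pose m := GRing.isLinear.Build R M N *:%R f lf.
by exists (HB.pack_for {linear M -> N} f m).
Qed.

Lemma linear_comb (R : nzRingType) (M N : lmodType R) (f : {linear M -> N}) a x y :
  f (a *: x + y) = a *: f x + f y.
Proof. exact: linearP. Qed.

(** Linear maps are introduced by their graphs: totality and uniqueness take the place of inverting
    an injection or of checking independence of representatives, and the equivalence can be used in
    both directions. *)
Lemma linear_of_rel (R : nzRingType) (M N : lmodType R) (G : M -> N -> Prop) :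
  (forall x, exists y, G x y) ->
  (forall x y y', G x y -> G x y' -> y = y') ->
  (forall a x y x' y', G x y -> G x' y' -> G (a *: x + x') (a *: y + y')) ->
  exists f : {linear M -> N}, forall x y, G x y <-> f x = y.
Proof.
move=> Gtot Gfun Glin; have [f fG] := choice Gtot.
have [g gf] : exists g : {linear M -> N}, g =1 f.
  by apply: linear_of_fun => a x y; apply: Gfun (fG _) _; apply: Glin.
exists g => x y; rewrite gf; split=> [Gxy|<- //].
exact: Gfun (fG x) Gxy.
Qed.

(** * Submodules cut out by propositions *)

Definition is_submod (R : nzRingType) (M : lmodType R) (U : M -> Prop) : Prop :=
  U 0 /\ forall a x y, U x -> U y -> U (a *: x + y).

Section Submodule.
Variables (R : nzRingType) (M : lmodType R) (U : M -> Prop).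
Hypothesis U_sub : is_submod U.

Lemma is_submod0 : U 0. Proof. by case: U_sub. Qed.
Lemma is_submodZ a x : U x -> U (a *: x).
Proof. by case: U_sub => U0 Ul Ux; rewrite -[_ *: x]addr0; apply: Ul. Qed.
Lemma is_submodD x y : U x -> U y -> U (x + y).
Proof. by case: U_sub => U0 Ul Ux Uy; rewrite -[x]scale1r; apply: Ul. Qed.
Lemma is_submodN x : U x -> U (- x).
Proof. by rewrite -scaleN1r; apply: is_submodZ. Qed.
Lemma is_submodB x y : U x -> U y -> U (x - y).
Proof. by move=> Ux Uy; apply/is_submodD/is_submodN. Qed.
Definition submod_pred : {pred M} := fun x => `[< U x >].
Lemma submod_pred_closed : submod_closed submod_pred.
Proof.
case: U_sub => U0 Ul; split; first exact/asboolP.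
by move=> a x y /asboolP Ux /asboolP Uy; apply/asboolP/Ul.
Qed.
End Submodule.

Section SubmoduleType.
Variables (R : nzRingType) (M : lmodType R) (U : M -> Prop).
Variable U_sub : is_submod U.

Definition submodule_mem (_ : is_submod U) : {pred M} := submod_pred U.
HB.instance Definition _ := GRing.isSubmodClosed.Build R M
  (submodule_mem U_sub) (submod_pred_closed U_sub).
Record submodule :=
  Submodule { submodule_val : M; _ : submodule_val \in submodule_mem U_sub }.
HB.instance Definition _ := [isSub for submodule_val].
HB.instance Definition _ := [Choice of submodule by <:].
HB.instance Definition _ := [SubChoice_isSubLmodule of submodule by <:].
End SubmoduleType.

Lemma submodule_exists (R : nzRingType) (M : lmodType R) (U : M -> Prop) :
  is_submod U -> exists (N : lmodType R) (j : {linear N -> M}),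
    injective j /\ forall x, U x <-> exists y, j y = x.
Proof.
move=> hU; exists (submodule hU), (val : {linear submodule hU -> M}).
split=> [|x]; first exact: val_inj.
split=> [Ux|[y <-]]; last by have /asboolP := valP y.
have Ux' : x \in submodule_mem hU by apply/asboolP.
by exists (Submodule Ux').
Qed.

Lemma is_submod_ker (R : nzRingType) (M N : lmodType R) (f : {linear M -> N}) :
  is_submod (fun x => f x = 0).
Proof.
split=> [|a x y fx fy]; first exact: linear0.
by rewrite linearP fx fy scaler0 addr0.
Qed.

Lemma is_submod_im (R : nzRingType) (M N : lmodType R) (f : {linear M -> N}) :
  is_submod (fun y => exists x, f x = y).
Proof.
split=> [|a _ _ [x <-] [y <-]]; first by exists 0; apply: linear0.
by exists (a *: x + y); apply: linearP.
Qed.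

Lemma inj_surj_bij (X Y : Type) (f : X -> Y) : injective f -> surj f -> bijective f.
Proof.
move=> f_inj /choice [g fg]; exists g => // x.
by apply: f_inj; rewrite fg.
Qed.

Lemma ker0_inj (R : nzRingType) (M N : lmodType R) (f : {linear M -> N}) :
  (forall x, f x = 0 -> x = 0) -> injective f.
Proof.
move=> f0 x y fxy; apply/eqP; rewrite -subr_eq0; apply/eqP/f0.
by rewrite linearB fxy subrr.
Qed.

(** The complement is the kernel of [g], which together with the image of [f] fills the power of
    [T]. *)
Lemma in_add_retract (R : nzRingType) (T N : lmodType R) n
    (f : {linear N -> {ffun 'I_n -> T}}) (g : {linear {ffun 'I_n -> T} -> N}) :
  cancel f g -> in_add T N.
Proof.
move=> fK; have [N' [j [j_inj jP]]] := submodule_exists (is_submod_ker g).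
have [h hE] : exists h : {linear (N * N')%type -> {ffun 'I_n -> T}},
    h =1 (fun p => f p.1 + j p.2).
  by apply: linear_of_fun => a x y; rewrite !linearP scalerDr addrACA.
exists n, N', h; apply: inj_surj_bij.
  apply: ker0_inj => -[x y]; rewrite hE /= => fx.
  have x0 : x = 0.
    have /(congr1 g) := fx; rewrite linearD fK linear0.
    by have -> : g (j y) = 0; [apply/jP; exists y | rewrite addr0].
  by move: fx; rewrite x0 linear0 add0r -[0](linear0 j) => /j_inj ->.
move=> v; have /jP [y jy] : g (v - f (g v)) = 0 by rewrite linearB fK subrr.
by exists (g v, y); rewrite hE jy addrC subrK.
Qed.

(** A finite dual basis, which encodes finite generation and projectivity at once. *)
Definition fgp (R : nzRingType) (M : lmodType R) : Prop :=
  exists s : seq (M * {linear M -> R^o}),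
    forall x, x = \sum_(p <- s) p.2 x *: p.1.

Section Fgp.
Variable R : nzRingType.
Implicit Types L M N P T : lmodType R.

Lemma fgp_in_add M : fgp M -> in_add R^o M.
Proof.
case=> s sP; pose p0 : M * {linear M -> R^o} := (0, (\0 : {linear M -> R^o})).
have [f fE] : exists f : {linear M -> {ffun 'I_(size s) -> R^o}},
    f =1 (fun x => [ffun i : 'I_(size s) => (nth p0 s i).2 x]).
  by apply: linear_of_fun => a x y; apply/ffunP => i; rewrite !ffunE linearP.
have [g gE] : exists g : {linear {ffun 'I_(size s) -> R^o} -> M},
    g =1 (fun v => \sum_(i < size s) v i *: (nth p0 s i).1).
  apply: linear_of_fun => a u v; rewrite scaler_sumr -big_split /=.
  by apply: eq_bigr => i _; rewrite !ffunE scalerDl scalerA.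
apply: (in_add_retract (f := f) (g := g)) => x.
rewrite gE fE [RHS]sP (big_nth p0) big_mkord.
by apply: eq_bigr => i _; rewrite ffunE.
Qed.

(** Only the images of the finitely many generators are lifted, so it is enough that [g] covers the
    image of [f]. *)
Lemma fgp_lift P M N (g : {linear M -> N}) (f : {linear P -> N}) : fgp P ->
  (forall x, exists y, g y = f x) ->
  exists h : {linear P -> M}, forall x, g (h x) = f x.
Proof.
case=> s sP /choice [l lP].
have [h hE] : exists h : {linear P -> M},
    h =1 (fun x => \sum_(p <- s) p.2 x *: l p.1).
  apply: linear_of_fun => a x y; rewrite scaler_sumr -big_split /=.
  by apply: eq_bigr => p _; rewrite linearP scalerDl scalerA.
exists h => x; rewrite hE linear_sum [in RHS](sP x) linear_sum.
by apply: eq_bigr => p _; rewrite !linearZ lP.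
Qed.

Lemma fgp_projective P : fgp P -> projective_module P.
Proof.
by move=> fP M N g f g_surj; apply: fgp_lift => // x; apply: g_surj.
Qed.

Lemma fgp_prod M N : fgp M -> fgp N -> fgp (M * N)%type.
Proof.
case=> s sP [t tP].
have proj1 (f : {linear M -> R^o}) :
  exists h : {linear (M * N)%type -> R^o}, forall z, h z = f z.1.
  by apply: linear_of_fun => a x y; rewrite linearP.
have proj2 (f : {linear N -> R^o}) :
  exists h : {linear (M * N)%type -> R^o}, forall z, h z = f z.2.
  by apply: linear_of_fun => a x y; rewrite linearP.
have [[F FE] [G GE]] := (choice proj1, choice proj2).
exists ([seq ((p.1, 0), F p.2) | p <- s] ++ [seq ((0, p.1), G p.2) | p <- t]).
have sum1 (J : Type) (r : seq J) (H : J -> (M * N)%type) :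
  (\sum_(i <- r) H i).1 = \sum_(i <- r) (H i).1 by apply: (big_morph fst).
have sum2 (J : Type) (r : seq J) (H : J -> (M * N)%type) :
  (\sum_(i <- r) H i).2 = \sum_(i <- r) (H i).2 by apply: (big_morph snd).
case=> x y; rewrite big_cat !big_map /= [LHS]surjective_pairing [RHS]surjective_pairing.
congr (_, _) => /=; rewrite ?sum1 ?sum2 /=.
  rewrite [X in _ + X]big1 ?addr0; last by move=> p _; apply: scaler0.
  by rewrite [LHS]sP; apply: eq_bigr => p _; rewrite FE.
rewrite [X in X + _]big1 ?add0r; last by move=> p _; apply: scaler0.
by rewrite [LHS]tP; apply: eq_bigr => p _; rewrite GE.
Qed.

Lemma fgp_retract L M (e : {linear L -> M}) (r : {linear M -> L}) :
  cancel e r -> fgp M -> fgp L.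
Proof.
move=> eK [s sP].
have comp (f : {linear M -> R^o}) :
    exists k : {linear L -> R^o}, forall y, k y = f (e y).
  by apply: linear_of_fun => a x y; rewrite !linear_comb.
have [F FE] := choice comp.
exists [seq (r p.1, F p.2) | p <- s] => y; rewrite big_map -{1}(eK y) {1}(sP (e y)).
by rewrite linear_sum; apply: eq_bigr => p _; rewrite linearZ FE.
Qed.

Lemma fgp_regular : fgp R^o.
Proof.
exists [:: (1, (idfun : {linear R^o -> R^o}))] => x.
by rewrite big_seq1 /= /GRing.scale /= mulr1.
Qed.

(** The surjection [g] has a section [h], and [x - h (g x)] retracts [M] onto the kernel. *)
Lemma fgp_ker L M N (j : {linear L -> M}) (g : {linear M -> N}) :
  fgp M -> fgp N -> injective j -> exact_at j g -> surj g -> fgp L.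
Proof.
move=> fM fN j_inj jg g_surj.
have [h hP] := fgp_projective fN (idfun : {linear N -> N}) g_surj.
have [r rP] : exists r : {linear M -> L}, forall x y, j y = x - h (g x) <-> r x = y.
  apply: linear_of_rel => [x|x y y' <- /j_inj //|a x y x' y' jy jy'].
    by apply/jg; rewrite linearB hP subrr.
  by rewrite linear_comb jy jy' (linear_comb g) (linear_comb h) opprD addrACA -scalerBr.
apply: (fgp_retract (e := j) (r := r)) fM => y.
apply/rP; have -> : g (j y) = 0 by apply/jg; exists y.
by rewrite linear0 subr0.
Qed.

Lemma fgp_zero M : (forall x : M, x = 0) -> fgp M.
Proof. by move=> M0; exists [::] => x; rewrite big_nil. Qed.

Section PdOne.
Variables (Z P : lmodType R).

Definition zero_module : lmodType R := {ffun 'I_0 -> R^o}.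
Lemma zero_moduleP (x : zero_module) : x = 0.
Proof. by apply/ffunP => -[]. Qed.

Definition pd1_term (n : nat) : lmodType R :=
  match n with 0 => P | 1 => Z | _ => zero_module end.
Definition pd1_diff (i : {linear Z -> P}) (n : nat) :
    {linear pd1_term n.+1 -> pd1_term n} :=
  match n with 0 => i | m.+1 => \0 end.

(** The sequence is itself a projective resolution, of length one: degree 1 is the extension
    hypothesis and all later terms are zero. *)
Lemma pd1_Ext_vanishes T N (i : {linear Z -> P}) (g : {linear P -> T}) n :
  fgp Z -> fgp P -> short_exact i g ->
  (forall f : {linear Z -> N}, exists h : {linear P -> N}, forall z, f z = h (i z)) ->
  (0 < n)%N -> Ext_vanishes n T N.
Proof.
move=> fZ fP [i_inj ig g_surj] ext n_gt0.
have projn m : projective_module (pd1_term m).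
  case: m => [|[|m]]; try exact: fgp_projective.
  exact/fgp_projective/fgp_zero/zero_moduleP.
have exS m : exact_at (pd1_diff i m.+1) (pd1_diff i m).
  case: m => [|m] y /=; last first.
    by split=> // _; exists 0; rewrite [RHS]zero_moduleP.
  split=> [iy|[x <-]]; last exact: linear0.
  by exists 0; apply: i_inj; rewrite iy linear0.
exists (@ProjectiveResolution R T pd1_term (pd1_diff i) g projn g_surj ig exS).
case: n n_gt0 => [//|[|n]] _ f _ /=; first exact: ext.
by exists \0 => x; rewrite (zero_moduleP x) linear0.
Qed.
End PdOne.

End Fgp.

(** * Tilting coresolutions *)

Lemma linear_sum_of (R : nzRingType) (M N : lmodType R) (J : Type) (s : seq J)
    (F : J -> {linear M -> N}) :
  exists f : {linear M -> N}, forall x, f x = \sum_(k <- s) F k x.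
Proof.
apply: linear_of_fun => a x y; rewrite scaler_sumr -big_split /=.
by apply: eq_bigr => k _; rewrite linearP.
Qed.

Section IdempotentIdeal.
Variables (R : nzRingType) (T Z P : lmodType R) (j : {linear T -> R^o}).
Variables (i : {linear Z -> P}) (g : {linear P -> T}).
Hypotheses (j_inj : injective j) (Z_fgp : fgp Z) (ig : short_exact i g).
Hypothesis T_right : forall t (a : R), exists t', j t' = (j t : R) * a.
Hypothesis T_idem : forall t,
  exists s : seq (T * T), t = \sum_(p <- s) j p.1 *: p.2.
Hypothesis Ext2_kill : forall (f : {linear Z -> R^o}) t,
  exists h : {linear P -> R^o}, forall z, h (i z) = (f z : R) * j t.

(* As [R / T] is killed by [T = T^2], no nonzero map [T -> R / T] exists: a map
   [P -> R] with values in [T] on [Z] has all its values in [T].              *)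
Lemma idempotent_ideal_extend (f : {linear Z -> T}) :
  exists h : {linear P -> T}, forall z, f z = h (i z).
Proof.
have [i_inj ig0 g_surj] := ig; have [s sP] := Z_fgp.
(* Over a dual basis of [Z], [f] is a sum of maps [z => p.2 z *: f p.1]; each of them extends to [P]
   by [Ext2_kill], since [j (f p.1)] lies in the ideal. *)
have /choice [F FP] : forall p : Z * {linear Z -> R^o},
    exists h : {linear P -> R^o}, forall z, h (i z) = (p.2 z : R) * j (f p.1).
  by move=> p; apply: Ext2_kill.
have [H HE] := linear_sum_of s F.
have Hi z : H (i z) = j (f z).
  rewrite HE [in RHS](sP z) !linear_sum; apply: eq_bigr => p _.
  by rewrite FP !linearZ.
have HT x : exists t, H x = j t.
  have [l lP] := choice g_surj; have [u gx] := T_idem (g x).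
  have /ig0 [z iz] : g (x - \sum_(p <- u) j p.1 *: l p.2) = 0.
    rewrite linearB linear_sum [X in X - _]gx; apply/eqP; rewrite subr_eq0.
    by apply/eqP/eq_bigr => p _; rewrite linearZ lP.
  have [r rP] := choice (fun p : T * T => T_right p.1 (H (l p.2))).
  exists (f z + \sum_(p <- u) r p).
  rewrite -[x in LHS](subrK (\sum_(p <- u) j p.1 *: l p.2)) -iz linearD Hi.
  rewrite [RHS]linearD !linear_sum; congr (_ + _); apply: eq_bigr => p _.
  by rewrite linearZ rP.
have [h hP] : exists h : {linear P -> T}, forall x t, H x = j t <-> h x = t.
  apply: linear_of_rel => // [x t t' -> /j_inj //|a x t x' t' ht ht'].
  by rewrite !linearP ht ht'.
by exists h => z; apply/esym/hP.
Qed.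

End IdempotentIdeal.

(** * Hom modules into a group with commuting actions of two rings *)

Section HomModule.
Variables (R R' : nzRingType) (T : lmodType R) (T' : lmodType R').
Variables (u : T -> T') (u' : T' -> T).
Hypotheses (uK : cancel u u') (u'K : cancel u' u).
Hypothesis uD : {morph u : x y / x + y}.
Hypothesis uC : forall a c t, u' (c *: u (a *: t)) = a *: u' (c *: u t).

Lemma inv_additive : {morph u' : x y / x + y}.
Proof. by move=> x y; apply: (can_inj uK); rewrite uD !u'K. Qed.

Lemma additive0 : u 0 = 0. Proof. by apply: (addrI (u 0)); rewrite -uD !addr0. Qed.
Lemma inv0 : u' 0 = 0. Proof. by rewrite -additive0 uK. Qed.

Lemma act_linear c : linear (fun t => u' (c *: u t)).
Proof. by move=> a x y /=; rewrite uD scalerDr inv_additive uC. Qed.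

(* [Hom(M, T)] as a module over [R'], realized inside a power of [T'] through
   the values at finitely many generators of [M].                             *)
Lemma hom_module (M : lmodType R) : fgp M ->
  exists (H : lmodType R') (Phi : H -> {linear M -> T}),
    [/\ in_add T' H, forall f : {linear M -> T}, exists h, Phi h =1 f,
        forall h h', Phi h =1 Phi h' -> h = h'
      & forall c h h' x, Phi (c *: h + h') x = u' (c *: u (Phi h x)) + Phi h' x].
Proof.
case=> s sP; pose n := size s; pose p0 : M * {linear M -> R^o} := (0, (\0 : {linear M -> R^o})).
pose r (k : 'I_n) := (nth p0 s k).1; pose rho (k : 'I_n) := (nth p0 s k).2.
have rP x : x = \sum_(k < n) rho k x *: r k.
  by rewrite {1}(sP x) (big_nth p0) big_mkord.
pose U (v : {ffun 'I_n -> T'}) :=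
  exists f : {linear M -> T}, forall k, v k = u (f (r k)).
have U_sub : is_submod U.
  split=> [|c v w [f fP] [h hP]].
    by exists (\0 : {linear M -> T}) => k; rewrite ffunE additive0.
  have [k kE] : exists k : {linear M -> T},
    k =1 (fun x => u' (c *: u (f x)) + h x).
    apply: linear_of_fun => a x y.
    by rewrite !linearP uD scalerDr inv_additive uC scalerDr addrACA.
  by exists k => l; rewrite !ffunE kE uD u'K fP hP.
have [H [e [e_inj eP]]] := submodule_exists U_sub.
have ex h : U (e h) by apply/eP; exists h.
have [Phi PhiE] := choice ex.
have Phi_val h (f : {linear M -> T}) :
    (forall k, e h k = u (f (r k))) -> Phi h =1 f.
  move=> hf x; rewrite (rP x) !linear_sum; apply: eq_bigr => k _.
  by rewrite !linearZ; congr (_ *: _); apply: (can_inj uK); rewrite -hf PhiE.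
exists H, Phi; split=> [|f|h h' hh|c h h' x].
(* The retraction [q] takes [v] to the map [x => \sum_l rho l x *: u' (v l)]; when [v] lists the
   values of a map at the generators, this is that map. *)
- have [q qE] : exists q : {linear {ffun 'I_n -> T'} -> H}, forall (v : {ffun 'I_n -> T'}) h,
      (forall k, e h k = u (\sum_l rho l (r k) *: u' (v l))) <-> q v = h.
    apply: linear_of_rel => [v|v h h' hv hv'|c v h v' h' hv hv'].
    + have [f fE] : exists f : {linear M -> T},
          f =1 (fun x => \sum_l rho l x *: u' (v l)).
        apply: linear_of_fun => a x y; rewrite scaler_sumr -big_split /=.
        by apply: eq_bigr => l _; rewrite linearP scalerDl scalerA.
      have /eP [h hE] : U [ffun k => u (f (r k))].
        by exists f => k; rewrite ffunE.
      by exists h => k; rewrite hE ffunE fE.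
    + by apply: e_inj; apply/ffunP => k; rewrite hv hv'.
    + move=> k; rewrite linearP !ffunE hv hv' -[_ *: u _]u'K -uD; congr u.
      have [ac acE] := linear_of_fun (act_linear c).
      rewrite -acE linear_sum -big_split; apply: eq_bigr => l _ /=.
      by rewrite !ffunE inv_additive scalerDr linearZ /= acE u'K.
  apply: (in_add_retract (f := e) (g := q)) => h; apply/qE => k.
  rewrite PhiE {1}(rP (r k)) linear_sum; congr u; apply: eq_bigr => l _.
  by rewrite linearZ PhiE uK.
- have /eP [h hE] : U [ffun k => u (f (r k))] by exists f => k; rewrite ffunE.
  by exists h; apply: Phi_val => k; rewrite hE ffunE.
- by apply: e_inj; apply/ffunP => k; rewrite !PhiE hh.
- have [k kE] : exists k : {linear M -> T},
      k =1 (fun x => u' (c *: u (Phi h x)) + Phi h' x).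
    apply: linear_of_fun => a y z.
    by rewrite !linearP uD scalerDr inv_additive uC scalerDr addrACA.
  by rewrite -kE; apply: Phi_val => l; rewrite linearP !ffunE !PhiE kE uD u'K.
Qed.

Variables (Z P : lmodType R) (i : {linear Z -> P}) (g : {linear P -> T}).
Hypotheses (Z_fgp : fgp Z) (P_fgp : fgp P) (ig : short_exact i g).
Hypothesis Ext1 : forall f : {linear Z -> T},
  exists h : {linear P -> T}, forall z, f z = h (i z).
Hypothesis endo_act : forall f : {linear T -> T},
  exists c, forall t, f t = u' (c *: u t).
Hypothesis faithful : forall c, (forall t, u' (c *: u t) = 0) -> c = 0.

(* [Hom(-, T)] turns [0 -> Z -> P -> T -> 0] into a coresolution of [R'].     *)
Lemma tilting_coresolution :
  exists (T0 T1 : lmodType R') (f : {linear R'^o -> T0}) (h : {linear T0 -> T1}),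
    [/\ in_add T' T0, in_add T' T1 & short_exact f h].
Proof.
have [i_inj ig0 g_surj] := ig.
have [T0 [Phi [addT0 Phi_surj Phi_inj PhiP]]] := hom_module P_fgp.
have [T1 [Psi [addT1 Psi_surj Psi_inj PsiP]]] := hom_module Z_fgp.
(* [f c] is [g] followed by the action of [c]; the map [h] below is restriction along [i]. *)
have [f fP] : exists f : {linear R'^o -> T0}, forall c h,
    (forall x, Phi h x = u' (c *: u (g x))) <-> f c = h.
  apply: linear_of_rel => [c|c h h' hc hc'|a c h c' h' hc hc'].
  - have [k kE] := linear_of_fun (act_linear c).
    have [h hE] := Phi_surj [the {linear P -> T} of k \o g].
    by exists h => x; rewrite hE /= kE.
  - by apply: Phi_inj => x; rewrite hc hc'.
  - by move=> x; rewrite PhiP hc hc' u'K scalerDl scalerA inv_additive.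
have fE c x : Phi (f c) x = u' (c *: u (g x)) by apply: (proj2 (fP c _) erefl x).
have [h hP] : exists h : {linear T0 -> T1}, forall k l,
    (forall z, Psi l z = Phi k (i z)) <-> h k = l.
  apply: linear_of_rel => [k|k l l' hl hl'|a k l k' l' hl hl'].
  - have [l lE] := Psi_surj [the {linear Z -> T} of Phi k \o i].
    by exists l => z; rewrite lE.
  - by apply: Psi_inj => x; rewrite hl hl'.
  - by move=> z; rewrite PsiP PhiP hl hl'.
have hE k z : Psi (h k) z = Phi k (i z) by apply: (proj2 (hP k _) erefl z).
have Phi0 x : Phi 0 x = 0.
  by rewrite -(linear0 f) fE scale0r inv0.
have Psi0 x : Psi 0 x = 0 by rewrite -(linear0 h) hE Phi0.
exists T0, T1, f, h; split=> //; split.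
- apply: ker0_inj => c fc; apply: faithful => t.
  by have [x <-] := g_surj t; rewrite -fE fc Phi0.
- move=> k; split=> [hk|[c <-]]; last first.
    apply: Psi_inj => z; rewrite hE fE Psi0.
    have -> : g (i z) = 0 by apply/ig0; exists z.
    by rewrite additive0 scaler0 inv0.
  (* A map [P -> T] vanishing on [Z] factors through [g] as an endomorphism of [T], which is the
     action of some [c]. *)
  have k0 z : Phi k (i z) = 0 by rewrite -hE hk Psi0.
  have [l lP] : exists l : {linear T -> T}, forall t y,
      (exists2 x, g x = t & Phi k x = y) <-> l t = y.
    apply: linear_of_rel => [t|t y y' [x <- <-] [x' xx' <-]|a t y t' y'].
    + by have [x gx] := g_surj t; exists (Phi k x), x.
    + have /ig0 [z iz] : g (x - x') = 0 by rewrite linearB xx' subrr.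
      by apply/eqP; rewrite -subr_eq0 -linearB -iz k0.
    + by move=> [x <- <-] [x' <- <-]; exists (a *: x + x'); rewrite linearP.
  have [c cP] := endo_act l; exists c; apply/fP => x.
  by rewrite -cP; apply/esym/lP; exists x.
- move=> l; have [k kP] := Ext1 (Psi l); have [m mE] := Phi_surj k.
  by exists m; apply/hP => z; rewrite mE.
Qed.

End HomModule.

(** * Rigid simple modules *)

(** The sequence is compared with a projective resolution of [S]: the augmentation lifts to [a] into
    [Y], which induces [b] into [X]. The cocycle [g \o b] is the coboundary of some [k], and
    [a q + i x => k q + g x] is the extension. *)
Lemma Ext1_extend (R : nzRingType) (X Y S N : lmodType R)
    (i : {linear X -> Y}) (p : {linear Y -> S}) (g : {linear X -> N}) :
  Ext_vanishes 1 S N -> short_exact i p ->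
  exists h : {linear Y -> N}, forall x, g x = h (i x).
Proof.
case=> P extP [i_inj ip p_surj].
have [a aP] := pr_proj (pr_aug P) p_surj.
have augd q : pr_aug P (pr_diff P 0 q) = 0 by apply/(@pr_exact0 _ _ P); exists q.
have [b bP] : exists b : {linear P 1 -> X}, forall q x,
    i x = a (pr_diff P 0 q) <-> b q = x.
  apply: linear_of_rel => [q|q x x' <- /i_inj //|c q x q' x' hx hx'].
    by apply/ip; rewrite aP augd.
  by rewrite !linearP hx hx'.
have bE q : i (b q) = a (pr_diff P 0 q) by apply/bP.
have gb_cocycle : cocycle [the {linear P 1 -> N} of g \o b].
  move=> q /=; suff -> : b (pr_diff P 1 q) = 0 by apply: linear0.
  apply: i_inj; rewrite bE; have -> : pr_diff P 0 (pr_diff P 1 q) = 0.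
    by apply/(@pr_exactS _ _ P); exists q.
  by rewrite !linear0.
have [k kP] := extP _ gb_cocycle.
have [h hP] : exists h : {linear Y -> N}, forall y z,
    (exists q x, y = a q + i x /\ z = k q + g x) <-> h y = z.
  apply: linear_of_rel => [y|y z z' [q [x [-> ->]]]|].
  - have [q qP] := pr_aug_surj P (p y).
    have /ip [x xP] : p (y - a q) = 0 by rewrite linearB aP qP subrr.
    by exists (k q + g x), q, x; rewrite xP addrC subrK.
  - case=> [q' [x' [e ->]]].
    have ei : a (q - q') = i (x' - x).
      rewrite !linearB /=; apply/eqP; rewrite subr_eq addrAC eq_sym subr_eq.
      by rewrite addrC e.
    have /(@pr_exact0 _ _ P) [w wP] : pr_aug P (q - q') = 0.
      by rewrite -aP ei; apply/ip; exists (x' - x).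
    have xw : x' - x = b w by apply: i_inj; rewrite bE wP ei.
    have := kP w; rewrite /= wP -xw !linearB /= => /eqP.
    rewrite subr_eq addrAC eq_sym subr_eq => /eqP kq.
    by rewrite kq addrC.
  - move=> c _ _ _ _ [q [x [-> ->]]] [q' [x' [-> ->]]].
    exists (c *: q + q'), (c *: x + x').
    by rewrite !linearP !scalerDr ![_ + (a q' + _)]addrACA ![_ + (k q' + _)]addrACA.
exists h => x; apply/esym/hP; exists 0, x.
by rewrite !linear0 !add0r.
Qed.

Section SimpleModule.
Variables (R : nzRingType) (S : lmodType R).
Hypothesis S_simple : simple_module S.

Lemma simple_submod (U : S -> Prop) : is_submod U ->
  (forall x, U x -> x = 0) \/ (forall x, U x).
Proof.
move=> hU; have [_ /(_ _ (submod_pred_closed hU))] := S_simple.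
case=> h; [left=> x Ux | right=> x]; last exact/asboolP/h.
exact/h/asboolP.
Qed.

Definition kills (s : seq S) (a : R^o) : Prop := forall e, e \in s -> a *: e = 0.

Lemma kills_submod s : is_submod (kills s).
Proof.
split=> [e _|a x y hx hy e es]; first exact: scale0r.
by rewrite scalerDl -scalerA hx // hy // scaler0 addr0.
Qed.

Lemma kills_cons e s a : kills (e :: s) a <-> a *: e = 0 /\ kills s a.
Proof.
split=> [h|[h1 h2] f].
  by split=> [|f fs]; apply: h; rewrite inE ?eqxx // fs orbT.
by rewrite inE => /orP [/eqP ->|/h2].
Qed.

Hypothesis S_rigid : rigid S.

(* Each step of the chain of left ideals [kills s] has quotient 0 or [S], so  *)
(* rigidity extends maps into [S] up the chain, to all of [R].                *)
Lemma kills_hom s (N : lmodType R) (j : {linear N -> R^o}) (g : {linear N -> S}) :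
  injective j -> (forall a, kills s a <-> exists x, j x = a) ->
  exists v, forall x, g x = (j x : R) *: v.
Proof.
elim: s N j g => [|e s IHs] N j g j_inj jP.
  have [x1 x1P] : exists x, j x = 1 by apply/jP.
  exists (g x1) => x; rewrite -linearZ; congr (g _); apply: j_inj.
  by rewrite linearZ /= x1P /= /GRing.scale /= mulr1.
have [N' [j' [j'_inj j'P]]] := submodule_exists (kills_submod s).
have [i iP] : exists i : {linear N -> N'}, forall x y, j' y = j x <-> i x = y.
  apply: linear_of_rel => [x|x y y' <- /j'_inj //|a x y x' y' h h'].
    by apply/j'P; apply: (proj2 (proj1 (kills_cons e s _) _)); apply/jP; exists x.
  by rewrite !linearP h h'.
have iE x : j' (i x) = j x by apply/iP.
have [p pE] : exists p : {linear N' -> S}, forall y, p y = (j' y : R) *: e.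
  apply: linear_of_fun => a x y; rewrite linearP scalerDl.
  by rewrite -scalerA.
have [g' g'E] : exists g' : {linear N' -> S}, forall x, g x = g' (i x).
  have [p0|p_all] := simple_submod (is_submod_im p).
    have [g' g'P] : exists g' : {linear N' -> S}, forall y z,
        (exists2 x, j x = j' y & g x = z) <-> g' y = z.
      apply: linear_of_rel => [y|y z z' [x jx <-] [x' jx' <-]|a y z y' z'].
      - have /jP [x xP] : kills (e :: s) (j' y).
          apply/kills_cons; split; last by apply/j'P; exists y.
          by rewrite -pE; apply: p0; exists y.
        by exists (g x), x.
      - by congr (g _); apply: j_inj; rewrite jx jx'.
      - by move=> [x jx <-] [x' jx' <-]; exists (a *: x + x'); rewrite !linearP ?jx ?jx'.
    by exists g' => x; apply/esym/g'P; exists x.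
  apply: (Ext1_extend g S_rigid (p := p)); split=> //.
    by move=> x y /(congr1 j'); rewrite !iE => /j_inj.
  move=> y; rewrite pE; split=> [je|[x <-]].
    have /jP [x xP] : kills (e :: s) (j' y).
      by apply/kills_cons; split=> //; apply/j'P; exists y.
    by exists x; apply/iP.
  rewrite iE; apply: (proj1 (proj1 (kills_cons e s _) _)).
  by apply/jP; exists x.
have [v vP] := IHs _ _ g' j'_inj j'P.
by exists v => x; rewrite g'E vP iE.
Qed.

Variables (T : lmodType R) (j : {linear T -> R^o}) (es : seq S).
Hypothesis j_inj : injective j.
Hypothesis jP : forall a : R, (forall x : S, a *: x = 0) <-> exists t, j t = a.
Hypothesis esP : forall a, kills es a -> forall x : S, (a : R) *: x = 0.

(** By [kills_hom] the map is [x => x v] for some [v] in [S], and the ideal annihilates [S]. *)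
Lemma ann_hom0 (g : {linear T -> S}) t : g t = 0.
Proof.
have [v ->] : exists v, forall x, g x = (j x : R) *: v.
  apply: (@kills_hom es) => // a; rewrite -jP; split; first exact: esP.
  by move=> h e _; apply: h.
by apply: (proj2 (jP _)); exists t.
Qed.

Definition square (t : T) : Prop :=
  exists s : seq (T * T), t = \sum_(p <- s) j p.1 *: p.2.

Lemma square_submod : is_submod square.
Proof.
split=> [|a x y [s ->] [u ->]]; first by exists [::]; rewrite big_nil.
exists ([seq (a *: p.1, p.2) | p <- s] ++ u).
rewrite big_cat big_map scaler_sumr /=; congr (_ + _).
by apply: eq_bigr => p _; rewrite linearZ /= scalerA.
Qed.

(** This discards one generator [x]. Its coefficients are pushed down the chain [kills s] until they
    lie in the ideal, where their products with [x] are in the square; a step that failed would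
    produce a nonzero map from the ideal to [S]. *)
Lemma square_step (N : T -> Prop) x : is_submod N ->
  (forall t, square t -> N t) ->
  (forall t, exists n a, N n /\ t = n + a *: x) -> forall t, N t.
Proof.
move=> N_sub sqN Nx.
suff step s t : exists n a, [/\ N n, kills s a & t = n + a *: x].
  move=> t; have [n [a [Nn /esP/jP [u ua] ->]]] := step es t.
  apply: is_submodD => //; apply: sqN; exists [:: (u, x)].
  by rewrite big_seq1 /= ua.
elim: s t => [|e s IHs] t.
  by have [n [a [Nn ->]]] := Nx t; exists n, a.
pose N2 t := exists n a, [/\ N n, kills (e :: s) a & t = n + a *: x].
have N2_sub : is_submod N2.
  split=> [|c _ _ [n [a [Nn ka ->]]] [m [b [Nm kb ->]]]].
    exists 0, 0; rewrite scale0r addr0; split=> //; first exact: is_submod0.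
    exact: is_submod0 (kills_submod _).
  exists (c *: n + m), (c * a + b); split; first by case: N_sub => _; apply.
    by case: (kills_submod (e :: s)) => _; apply.
  by rewrite scalerDl scalerDr scalerA addrACA.
(* By simplicity [L] is 0 or [S]. If it is [S], some [b] in [kills s] has [b *: e = a *: e] and
   [b *: x] in [N2], and [a - b] also kills [e]. *)
pose L (y : S) := exists a : R, [/\ kills s a, y = a *: e & N2 (a *: x)].
have L_sub : is_submod L.
  split=> [|c _ _ [a [ka -> Na]] [b [kb -> Nb]]].
    exists 0; rewrite !scale0r; split=> //; last exact: is_submod0.
    exact: is_submod0 (kills_submod _).
  exists (c * a + b); rewrite !scalerDl -!scalerA; split=> //.
    by case: (kills_submod s) => _; apply.
  by case: N2_sub => _; apply.
have N2N n : N n -> N2 n.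
  move=> Nn; exists n, 0; rewrite scale0r addr0; split=> //.
  exact: is_submod0 (kills_submod _).
have [n [a [Nn ka ->]]] := IHs t.
apply: (is_submodD N2_sub); first exact: N2N.
have [L0|Lall] := simple_submod L_sub; last first.
  have [b [kb ab Nb]] := Lall (a *: e).
  rewrite -(subrK b a) scalerDl; apply: (is_submodD N2_sub) => //.
  exists 0, (a - b); rewrite add0r; split=> //; first exact: is_submod0.
  apply/kills_cons; rewrite scalerBl ab subrr; split=> //.
  exact: (is_submodB (kills_submod s)).
(* Now [L] is 0, so [n + a *: x => a *: e] is well defined; it vanishes by [ann_hom0], and [a]
   already kills [e]. *)
have [h hP] : exists h : {linear T -> S}, forall t y,
    (exists n a, [/\ N n, kills s a, t = n + a *: x & y = (a : R) *: e]) <-> h t = y.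
  apply: linear_of_rel => [u|_ _ y [m [b [Nm kb -> ->]]] [m' [b' [Nm' kb' eqt ->]]]|].
  - by have [m [b [Nm kb ->]]] := IHs u; exists (b *: e), m, b.
  - apply/eqP; rewrite -subr_eq0 -scalerBl; apply/eqP/L0.
    exists (b - b'); split=> //; first exact: (is_submodB (kills_submod s)).
    apply: N2N; rewrite scalerBl.
    have -> : b *: x - b' *: x = m' - m.
      by apply/eqP; rewrite subr_eq addrAC eq_sym subr_eq -eqt addrC.
    exact: is_submodB.
  - move=> c _ _ _ _ [m [b [Nm kb -> ->]]] [m' [b' [Nm' kb' -> ->]]].
    exists (c *: m + m'), (c * b + b'); split; first by case: N_sub => _; apply.
    - by case: (kills_submod s) => _; apply.
    - by rewrite scalerDl scalerDr scalerA addrACA.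
    - by rewrite scalerDl scalerA.
exists 0, a; rewrite add0r; split=> //; first exact: is_submod0.
apply/kills_cons; split=> //; rewrite -[RHS](ann_hom0 h (a *: x)).
by apply/esym/hP; exists 0, a; rewrite add0r; split=> //; apply: is_submod0.
Qed.

(** Generators are discarded one at a time by [square_step] until only the square is left. *)
Lemma ann_idempotent (J : Type) (F : J -> T) (ks : seq J) :
  (forall t, exists c : J -> R, t = \sum_(k <- ks) c k *: F k) ->
  forall t, square t.
Proof.
pose gen (ls : seq J) t := exists n (c : J -> R),
  square n /\ t = n + \sum_(k <- ls) c k *: F k.
have gen_sub ls : is_submod (gen ls).
  split=> [|a _ _ [n [c [sn ->]]] [m [d [sm ->]]]].
    exists 0, (fun=> 0); split; first exact: is_submod0 square_submod.
    by rewrite big1 ?addr0 // => k _; rewrite scale0r.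
  exists (a *: n + m), (fun k => a * c k + d k).
  split; first by case: square_submod => _; apply.
  rewrite scalerDr addrACA scaler_sumr -big_split /=; congr (_ + _).
  by apply: eq_bigr => k _; rewrite scalerDl scalerA.
have genP ls : (forall t, gen ls t) -> forall t, square t.
  elim: ls => [|k ls IHls] gk.
    by move=> t; have [n [c [sn ->]]] := gk t; rewrite big_nil addr0.
  apply: IHls; apply: (@square_step _ (F k)) => // [t st|t].
    exists t, (fun=> 0); split=> //.
    by rewrite big1 ?addr0 // => l _; rewrite scale0r.
  have [n [c [sn ->]]] := gk t.
  exists (n + \sum_(l <- ls) c l *: F l), (c k); split; first by exists n, c.
  by rewrite big_cons addrCA addrC.
move=> ksP; apply: (genP ks) => t; have [c ct] := ksP t.
exists 0, c; rewrite add0r; split=> //; exact: is_submod0 square_submod.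
Qed.

End SimpleModule.

(** * Vector spaces *)

Section VectorSpaces.
Variable K : fieldType.

(* Zorn's lemma on partial lifts, presented by their graphs. *)
Lemma vector_space_lift (U V W : lmodType K)
    (f : {linear U -> W}) (g : {linear V -> W}) :
  (forall u, exists v, g v = f u) ->
  exists h : {linear U -> V}, forall u, g (h u) = f u.
Proof.
move=> fg.
pose lift (G : (U * V)%type -> Prop) := [/\ forall a p q, G p -> G q -> G (a *: p + q),
  forall p, G p -> g p.2 = f p.1 & forall v, G (0, v) -> v = 0].
have [F Ftot|G [[Glin Glift Gfun] Gmax]] := @classical_sets.Zorn_bigcup _ lift.
  move=> Fch; split=> [a p q [X FX Xp] [Y FY Yq]|p [X FX Xp]|v [X FX Xv]].
  - have [XY|YX] := Fch _ _ FX FY.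
      by exists Y => //; case: (Ftot _ FY) => l _ _; apply: l => //; apply: XY.
    by exists X => //; case: (Ftot _ FX) => l _ _; apply: l => //; apply: YX.
  - by case: (Ftot _ FX) => _ + _; apply.
  - by case: (Ftot _ FX) => _ _; apply.
(* The empty graph satisfies [lift], so the origin is adjoined to the maximal one. *)
pose G0 p := G p \/ p = 0.
have G0lin a p q : G0 p -> G0 q -> G0 (a *: p + q).
  move=> Gp [Gq|->]; last first.
    rewrite addr0; case: Gp => [Gp|->]; last by right; apply: scaler0.
    left; rewrite -[_ *: p]addr0 -[0](addNr p) -scaleN1r; apply: (Glin _ _ _ Gp).
    exact: Glin.
  by left; case: Gp => [Gp|->]; [apply: Glin | rewrite scaler0 add0r].
have G0fun v : G0 (0, v) -> v = 0 by case=> [/Gfun //|[]].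
have G0lift p : G0 p -> g p.2 = f p.1 by case=> [/Glift //|->]; rewrite !linear0.
have G0tot u : exists v, G0 (u, v).
  apply: contrapT => Nu; have [v gv] := fg u.
  (* Adjoining the line through [(u, v)] contradicts maximality: a point over 0 with [c] nonzero
     would put [u] in the domain of [G0]. *)
  pose H p := exists q c, G0 q /\ p = q + c *: (u, v).
  apply: (Gmax H).
    split; last first.
      move=> HG; apply: Nu; exists v; left; apply: HG.
      by exists 0, 1; split; [right | rewrite add0r scale1r].
    by move=> p Gp; exists p, 0; split; [left | rewrite scale0r addr0].
  split.
  - move=> a _ _ [p [c [Gp ->]]] [q [d [Gq ->]]].
    exists (a *: p + q), (a * c + d); split; first exact: G0lin.
    by rewrite scalerDr scalerDl scalerA addrACA.
  - by move=> _ [q [c [Gq ->]]] /=; rewrite !linearD !linearZ gv (G0lift _ Gq).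
  - move=> w [[x y] [c [Gq [ex ->]]]].
    have [c0|c_neq0] := eqVneq c 0.
      by apply: G0fun; move: ex; rewrite c0 !scale0r !addr0 => ->.
    case: Nu; exists (- c^-1 *: y).
    have -> : u = - c^-1 *: x.
      have -> : x = - (c *: u) by apply/eqP; rewrite -addr_eq0 -ex.
      by rewrite scaleNr scalerN opprK scalerA mulVf ?scale1r.
    by have := G0lin (- c^-1) _ _ Gq (or_intror erefl); rewrite addr0.
have [h hP] : exists h : {linear U -> V}, forall u v, G0 (u, v) <-> h u = v.
  apply: linear_of_rel => // [u v v' Gv Gv'|a u v u' v' Gv Gv'].
    apply/eqP; rewrite -subr_eq0; apply/eqP/G0fun.
    have := G0lin (-1) _ _ Gv' Gv; rewrite scaleN1r.
    by congr (G0 (_, _)); rewrite /= 1?addrC ?subrr // addrC.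
  exact: (G0lin a _ _ Gv Gv').
by exists h => u; apply: (G0lift (u, h u)); apply/hP.
Qed.

Implicit Types V W : lmodType K.

Definition cofinite V (U : V -> Prop) : Prop :=
  exists (m : nat) (b : nat -> V), forall x, exists c : nat -> K,
    U (x - \sum_(i < m) c i *: b i).

Lemma cofinite_ker V (U : V -> Prop) (f : {linear V -> K^o}) :
  is_submod U -> cofinite U -> cofinite (fun x => U x /\ f x = 0).
Proof.
move=> U_sub [m [b bP]].
have [f0|] := pselect (forall u, U u -> f u = 0).
  by exists m, b => x; have [c Uc] := bP x; exists c; split=> //; apply: f0.
move=> /existsNP [w /not_implyP [Uw /eqP fw]].
exists m.+1, (fun i => if i is j.+1 then b j else w) => x.
have [c Uc] := bP x; set y := x - _ in Uc.
exists (fun i => if i is j.+1 then c j else f y / f w).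
rewrite big_ord_recl /= addrC opprD -addrA [- _ + x]addrC -/y.
split; last by rewrite addrC linearB linearZ /= -[_ *: _]/(_ * _) divfK ?subrr.
by rewrite addrC; apply: is_submodB => //; apply: is_submodZ.
Qed.

Lemma cofinite_kers V (U : V -> Prop) (f : nat -> {linear V -> K^o}) n :
  is_submod U -> cofinite U ->
  cofinite (fun x => U x /\ forall i, (i < n)%N -> f i x = 0).
Proof.
move=> U_sub cU; elim: n => [|n IHn].
  by case: cU => m [b bP]; exists m, b => x; have [c Uc] := bP x; exists c.
have sub : is_submod (fun x => U x /\ forall i, (i < n)%N -> f i x = 0).
  split=> [|a x y [Ux fx] [Uy fy]].
    by split=> [|i _]; [apply: is_submod0 | apply: linear0].
  split=> [|i lt_in]; first by case: U_sub => _; apply.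
  by rewrite linearP fx ?fy // scaler0 addr0.
have [m [b bP]] := cofinite_ker (f n) sub IHn.
exists m, b => x; have [c [[Uc fc] fnc]] := bP x; exists c; split=> // i.
by rewrite ltnS leq_eqVlt => /orP [/eqP ->|/fc].
Qed.

(** Coordinates modulo [U]; for [U = I] they stand for [A / I] and its dual. The induction enlarges
    [U] by the line of [b 0]; if this vector is not in [U], its coefficient is one more
    functional. *)
Lemma cofinite_dual V (U : V -> Prop) : is_submod U -> cofinite U ->
  exists (m : nat) (b : nat -> V) (xi : nat -> {linear V -> K^o}),
    (forall l u, U u -> xi l u = 0) /\
    forall x, U (x - \sum_(i < m) xi i x *: b i).
Proof.
move=> + [m]; elim: m U => [|m IHm] U U_sub [b bP].
  exists 0%N, b, (fun=> (\0 : {linear V -> K^o})); split=> // x.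
  by have [c] := bP x; rewrite !big_ord0.
pose U' x := exists k, U (x - k *: b 0%N).
have U'_sub : is_submod U'.
  split=> [|a x y [k Uk] [l Ul]].
    by exists 0; rewrite scale0r subrr; apply: is_submod0.
  exists (a * k + l); rewrite scalerDl -scalerA opprD addrACA -scalerBr.
  by case: U_sub => _; apply.
have [|n [d [xi [xi0 xiP]]]] := IHm _ U'_sub.
  exists (fun i => b i.+1) => x; have [c Uc] := bP x.
  exists (fun i => c i.+1), (c 0%N).
  by move: Uc; rewrite big_ord_recl /= opprD [- _ - _]addrC addrA.
have [Ub0|NUb0] := pselect (U (b 0%N)).
  have U'U x : U' x -> U x.
    case=> k Uk; rewrite -(subrK (k *: b 0%N) x); apply: is_submodD => //.
    exact: is_submodZ.
  exists n, d, xi; split=> [l u Uu|x]; last exact: U'U.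
  by apply: xi0; exists 0; rewrite scale0r subr0.
have xk x : exists k, U (x - \sum_(i < n) xi i x *: d i - k *: b 0%N) by apply: xiP.
have [e eP] : exists e : {linear V -> K^o}, forall x k,
    U (x - \sum_(i < n) xi i x *: d i - k *: b 0%N) <-> e x = k.
  apply: linear_of_rel => // [x k k' Uk Uk'|a x k y l Uk Ul].
    apply/eqP; apply: contrapT => /negP neq; apply: NUb0.
    rewrite -[b _]scale1r -(@mulVf _ (k - k')) ?subr_eq0 // -scalerA.
    apply: is_submodZ => //.
    have -> : (k - k') *: b 0%N = (x - \sum_(i < n) xi i x *: d i - k' *: b 0%N) -
        (x - \sum_(i < n) xi i x *: d i - k *: b 0%N).
      by rewrite scalerBl opprB [RHS]addrC addrA subrK.
    exact: is_submodB.
  have -> : \sum_(i < n) xi i (a *: x + y) *: d i =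
      a *: (\sum_(i < n) xi i x *: d i) + \sum_(i < n) xi i y *: d i.
    rewrite scaler_sumr -big_split; apply: eq_bigr => i _ /=.
    by rewrite linearP scalerDl scalerA.
  rewrite scalerDl -scalerA !opprD [a *: x + y + _]addrACA (addrACA (a *: x - _)) -!scalerBr.
  by case: U_sub => _; apply.
exists n.+1, (fun i => if i is j.+1 then d j else b 0%N),
  (fun i => if i is j.+1 then xi j else e).
split=> [[|l] u Uu|x]; last first.
- by rewrite big_ord_recl /= opprD addrCA addrC; apply/eP.
- by apply: xi0; exists 0; rewrite scale0r subr0.
apply/eP; rewrite scale0r subr0 big1 ?subr0 // => i _.
by rewrite xi0 ?scale0r //; exists 0; rewrite scale0r subr0.
Qed.

End VectorSpaces.

(** * Tensor products and bimodules *)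

Section RestrictScalars.
Variables (K : fieldType) (A : algType K) (M : lmodType A).

Definition kmod : Type := M.
HB.instance Definition _ := GRing.Zmodule.on kmod.
Definition kscale (k : K) (x : kmod) : kmod := k%:A *: (x : M).
Lemma kscaleA k l x : kscale k (kscale l x) = kscale (k * l) x.
Proof. by rewrite /kscale scalerA -scalerAl mul1r scalerA. Qed.
Lemma kscale1 : left_id 1 kscale.
Proof. by move=> x; rewrite /kscale scale1r scale1r. Qed.
Lemma kscaleDr : right_distributive kscale +%R.
Proof. by move=> k x y; apply: scalerDr. Qed.
Lemma kscaleDl x : {morph kscale^~ x : k l / k + l}.
Proof. by move=> k l; rewrite /kscale !scalerDl. Qed.
HB.instance Definition _ := GRing.Zmodule_isLmodule.Build K kmod
  kscaleA kscale1 kscaleDr kscaleDl.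
End RestrictScalars.

Section TensorLift.
Variables (K : fieldType) (A : algType K).

Lemma tensor_of_sum (s : seq (A * A)) :
  tensor_of s = \sum_(p <- s) pure_tensor p.1 p.2.
Proof.
elim: s => [|p s IHs]; first by rewrite big_nil.
rewrite big_cons -IHs; apply: tensor_ext => V b.
by rewrite [RHS]tensor_evalD !tensor_eval_of /bilinear_sum big_cons big_seq1.
Qed.

Lemma tensor_sum (x : tensor A) : x = \sum_(p <- repr x) pure_tensor p.1 p.2.
Proof. by rewrite -tensor_of_sum /tensor_of generic_quotient.reprK. Qed.

Lemma tensor_ind (Q : tensor A -> Prop) :
  Q 0 -> (forall x y, Q x -> Q y -> Q (x + y)) ->
  (forall u v, Q (pure_tensor u v)) -> forall x, Q x.
Proof. by move=> Q0 QD Qp x; rewrite (tensor_sum x); apply: big_ind. Qed.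

Section Lift.
Variable V : lmodType K.

Definition bilinear_fun (b : A -> A -> V) : Prop :=
  (forall v, linear (b^~ v)) /\ (forall u, linear (b u)).

Definition tlift (b : A -> A -> V) (x : tensor A) : V :=
  \sum_(p <- repr x) b p.1 p.2.

Variable b : A -> A -> V.
Hypothesis b_bilinear : bilinear_fun b.

Lemma bilinear_of_fun : exists B : {bilinear A -> A -> V}, forall u v, B u v = b u v.
Proof.
case: b_bilinear => bl br.
have bP : bilinear_for *:%R *:%R b.
  by split=> [v k u u'|u k v v']; rewrite /applyr ?bl ?br.
pose m := bilinear_isBilinear.Build K A A V *:%R *:%R b bP.
by exists (HB.pack_for {bilinear A -> A -> V} b m).
Qed.

Lemma tliftE : exists B : {bilinear A -> A -> V},
  (forall u v, B u v = b u v) /\ forall x, tlift b x = tensor_eval B x.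
Proof.
have [B BE] := bilinear_of_fun; exists B; split=> // x.
by apply: eq_bigr => p _; rewrite BE.
Qed.

Lemma tliftD x y : tlift b (x + y) = tlift b x + tlift b y.
Proof. by have [B [_ BE]] := tliftE; rewrite !BE tensor_evalD. Qed.

Lemma tlift0 : tlift b 0 = 0.
Proof. by have [B [_ BE]] := tliftE; rewrite !BE tensor_eval0. Qed.

Lemma tlift_pure u v : tlift b (pure_tensor u v) = b u v.
Proof.
have [B [bE BE]] := tliftE.
by rewrite BE tensor_eval_of /bilinear_sum big_seq1 bE.
Qed.

End Lift.

End TensorLift.

Section AdditiveFun.
Variables (U V : zmodType) (F : U -> V).
Definition additive_fun : Prop := forall x y, F (x + y) = F x + F y.
Hypothesis FD : additive_fun.
Lemma additive_fun0 : F 0 = 0.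
Proof. by apply: (addrI (F 0)); rewrite -FD !addr0. Qed.
Lemma additive_funN x : F (- x) = - F x.
Proof. by apply: (addrI (F x)); rewrite -FD !subrr additive_fun0. Qed.
Lemma additive_funB x y : F (x - y) = F x - F y.
Proof. by rewrite FD additive_funN. Qed.
Lemma additive_fun_sum (J : Type) (s : seq J) (P : pred J) (G : J -> U) :
  F (\sum_(j <- s | P j) G j) = \sum_(j <- s | P j) F (G j).
Proof. exact: (big_morph F FD additive_fun0). Qed.
End AdditiveFun.

Section Bimodules.
Variables (K : fieldType) (A : algType K).
Implicit Types M N : bimod A.

Lemma scale_scalar (M : lmodType A) (k : K) (a : A) (x : M) :
  (k *: a) *: x = k%:A *: (a *: x).
Proof. by rewrite scalerA mulr_algl. Qed.

Lemma scale_scalar_comm (M : lmodType A) (k : K) (a : A) (x : M) :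
  a *: (k%:A *: x) = k%:A *: (a *: x).
Proof. by rewrite !scalerA mulr_algl mulr_algr. Qed.

Lemma ract_scale M (k : K) (x : M) (a : A) : ract x (k *: a) = k%:A *: ract x a.
Proof. by rewrite -mulr_algr -ractA ract_scalar. Qed.

Lemma tensor_map0 (f g : {linear A -> A}) : tensor_map f g 0 = 0.
Proof. exact: (additive_fun0 (@tensor_mapD _ _ f g)). Qed.

(** The bimodule map from [A (x) A], with the outer actions, that takes [1 (x) 1] to [e]. *)
Definition tact M (e : M) (x : tensor A) : M :=
  tlift (V := kmod M) (fun u v => u *: ract e v) x.

Section Action.
Variables (M : bimod A) (e : M).

Lemma tact_bilinear : bilinear_fun (V := kmod M) (fun u v => u *: ract e v).
Proof.
split=> [v k u u'|u k v v'] /=; first by rewrite scalerDl scale_scalar.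
by rewrite ractDr scalerDr ract_scale scale_scalar_comm.
Qed.

Lemma tactD : additive_fun (tact e).
Proof. by move=> x y; apply: (tliftD tact_bilinear). Qed.
Lemma tact0 : tact e 0 = 0. Proof. exact: additive_fun0 tactD. Qed.
Lemma tact_pure u v : tact e (pure_tensor u v) = u *: ract e v.
Proof. exact: (tlift_pure tact_bilinear). Qed.

Lemma tact_lact a x : tact e (outer_lact a x) = a *: tact e x.
Proof.
elim/tensor_ind: x => [|x y IHx IHy|u v].
- by rewrite /outer_lact tensor_map0 tact0 scaler0.
- by rewrite /outer_lact tensor_mapD !tactD scalerDr IHx IHy.
- by rewrite outer_lactE !tact_pure scalerA.
Qed.

Lemma tact_ract x a : tact e (outer_ract x a) = ract (tact e x) a.
Proof.
elim/tensor_ind: x => [|x y IHx IHy|u v].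
- by rewrite /outer_ract tensor_map0 tact0 ract0.
- by rewrite /outer_ract tensor_mapD !tactD ractDl IHx IHy.
- by rewrite outer_ractE !tact_pure ract_lact ractA.
Qed.

End Action.

Lemma bimod_hom_of_fun M N (f : M -> N) :
  linear f -> (forall x a, f (ract x a) = ract (f x) a) ->
  exists g : bimod_hom M N, g =1 f.
Proof.
move=> lf rf; have [g gE] := linear_of_fun lf.
have gR x a : g (ract x a) = ract (g x) a by rewrite !gE.
by exists (BimodHom gR).
Qed.

(** Such a family exhibits [M] as a bimodule retract of a power of [A (x) A]. *)
Definition dual_basis M (s : seq (M * dual M)) : Prop :=
  forall x, x = \sum_(p <- s) tact p.1 (p.2 x).

Section PowerBimodule.
Variables (n : nat).
Definition power_ract (f : {ffun 'I_n -> tensor_bimod A}) (a : A) :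
  {ffun 'I_n -> tensor_bimod A} := [ffun i => ract (f i) a].

#[local] Obligation Tactic := idtac.
Program Definition power_bimod : bimod A :=
  @Bimod _ _ {ffun 'I_n -> tensor_bimod A} power_ract _ _ _ _ _ _.
Next Obligation. by move=> x y a; apply/ffunP => i; rewrite !ffunE ractDl. Qed.
Next Obligation. by move=> x a b; apply/ffunP => i; rewrite !ffunE ractDr. Qed.
Next Obligation. by move=> x; apply/ffunP => i; rewrite !ffunE ract1. Qed.
Next Obligation. by move=> x a b; apply/ffunP => i; rewrite !ffunE ractA. Qed.
Next Obligation. by move=> a x b; apply/ffunP => i; rewrite !ffunE ract_lact. Qed.
Next Obligation. by move=> k x; apply/ffunP => i; rewrite !ffunE ract_scalar. Qed.
End PowerBimodule.

Lemma dual_basis_exists M : bimod_projective M -> bimod_finitely_generated M ->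
  exists s : seq (M * dual M), dual_basis s.
Proof.
move=> M_proj [n [e eP]].
have [g gE] : exists g : bimod_hom (power_bimod n) M,
    g =1 (fun f : {ffun 'I_n -> tensor_bimod A} => \sum_i tact (e i) (f i)).
  apply: bimod_hom_of_fun => [a x y|x a].
    rewrite scaler_sumr -big_split; apply: eq_bigr => i _ /=.
    by rewrite !ffunE [LHS]tactD tact_lact.
  rewrite (additive_fun_sum (F := fun y => ract y a)) => [|y z]; last exact: ractDl.
  by apply: eq_bigr => i _; rewrite ffunE [LHS]tact_ract.
have g_surj : surj g.
  move=> x; have [s ->] := eP x.
  exists ([ffun i => \sum_(t <- s | t.1.2 == i) pure_tensor t.1.1 t.2]
    : {ffun 'I_n -> tensor_bimod A}).
  rewrite gE.
  rewrite (eq_bigr (fun i => \sum_(t <- s | t.1.2 == i) t.1.1 *: ract (e i) t.2)).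
    rewrite (exchange_big_dep xpredT) //=; apply: eq_bigr => t _.
    by rewrite (big_pred1 t.1.2) // => i; rewrite eq_sym.
  move=> i _; rewrite ffunE (additive_fun_sum (@tactD _ _)).
  by apply: eq_bigr => t _; rewrite tact_pure.
have idR (x : M) a :
  (idfun : {linear M -> M}) (ract x a) = ract ((idfun : {linear M -> M}) x) a by [].
have [h hP] := M_proj _ _ g (BimodHom idR) g_surj.
have coord (i : 'I_n) : exists phi : dual M,
    forall x, phi x = (h x : {ffun 'I_n -> tensor_bimod A}) i.
  apply: bimod_hom_of_fun => [a x y|x a]; first by rewrite linearP !ffunE.
  by rewrite bimod_homR ffunE.
have [phi phiE] := choice coord.
exists [seq (e i, phi i) | i : 'I_n] => x.
rewrite big_map big_enum /= -[LHS](hP x) gE.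
by apply: eq_bigr => i _; rewrite phiE.
Qed.

End Bimodules.

(** * One-sided projectivity of bimodules and of their duals *)

Section Lifting.
Variables (K : fieldType) (A : algType K).
Implicit Types M N : bimod A.

(* Bimodules with a dual basis are projective as right modules: a right       *)
(* linear map on [A (x) A] is a [K]-linear map on the first factor.           *)
Lemma right_lift M N N' (s : seq (M * dual M)) (F : M -> N) (g : bimod_hom N' N) :
  dual_basis s -> additive_fun F -> (forall x a, F (ract x a) = ract (F x) a) ->
  (forall x, exists y, g y = F x) ->
  exists h : M -> N', [/\ additive_fun h,
    forall x a, h (ract x a) = ract (h x) a & forall x, g (h x) = F x].
Proof.
move=> sP FD FR Fg.
have Fk (k : K) x : F (k%:A *: x) = k%:A *: F x by rewrite -!ract_scalar FR.
have [gk gkE] : exists gk : {linear kmod N' -> kmod N}, gk =1 g.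
  by apply: linear_of_fun => k x y; rewrite linearD linearZ.
have lift_gen (e : M) : exists h : {linear A -> kmod N'}, forall u, g (h u) = F (u *: e).
  have [Fe FeE] : exists Fe : {linear A -> kmod N}, Fe =1 (fun u => F (u *: e)).
    by apply: linear_of_fun => k u v; rewrite scalerDl FD scale_scalar Fk.
  have [u|h hP] := @vector_space_lift K A (kmod N') (kmod N) Fe gk.
    by rewrite FeE; have [y yP] := Fg (u *: e); exists y; rewrite gkE.
  by exists h => u; rewrite -gkE hP FeE.
have [h hP] := choice lift_gen.
pose b e u v : kmod N' := ract (h e u : N') v.
have bP e : bilinear_fun (b e).
  split=> [v k u u'|u k v v']; rewrite /b.
    by rewrite linearP ractDl ract_lact.
  by rewrite ractDr ract_scale.
exists (fun x => \sum_(p <- s) tlift (b p.1) (p.2 x) : N'); split.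
- move=> x y; rewrite -big_split; apply: eq_bigr => p _ /=.
  by rewrite linearD; apply: (tliftD (bP _)).
- move=> x a; rewrite (additive_fun_sum (F := fun y : N' => ract y a)); last first.
    by move=> y z; apply: ractDl.
  apply: eq_bigr => p _; rewrite bimod_homR; elim/tensor_ind: (p.2 x) => [|y z IHy IHz|u v].
  + by rewrite [ract 0 a]tensor_map0 (tlift0 (bP _)) ract0.
  + by rewrite ractDl !(tliftD (bP _)) IHy IHz ractDl.
  + by rewrite [ract _ a]outer_ractE !(tlift_pure (bP _)) /b ractA.
- move=> x; rewrite linear_sum [in RHS](sP x) (additive_fun_sum FD).
  apply: eq_bigr => p _; elim/tensor_ind: (p.2 x) => [|y z IHy IHz|u v].
  + by rewrite (tlift0 (bP _)) linear0 tact0 additive_fun0.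
  + by rewrite (tliftD (bP _)) linearD IHy IHz tactD FD.
  + by rewrite (tlift_pure (bP _)) /b bimod_homR hP tact_pure -FR ract_lact.
Qed.

Section Dual.
Variables (M : bimod A) (s : seq (M * dual M)).
Hypothesis sP : dual_basis s.

(** [phi] followed by the outer bimodule endomorphism of [A (x) A] that takes [1 (x) 1] to [x], as
    [dact_eval] shows. *)
Definition dact (phi : dual_bimod M) (x : tensor A) : dual_bimod M :=
  tlift (V := kmod (dual_bimod M)) (fun u v => v *: ract phi u) x.

Lemma dact_bilinear (phi : dual_bimod M) :
  bilinear_fun (V := kmod (dual_bimod M)) (fun u v => v *: ract phi u).
Proof.
split=> [v k u u'|u k v v']; cbv beta; last by rewrite scalerDl scale_scalar.
by rewrite ractDr scalerDr ract_scale scale_scalar_comm.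
Qed.

Lemma dual_evalD (phi psi : dual_bimod M) x : (phi + psi) x = phi x + psi x.
Proof. by []. Qed.

Lemma dact_eval (phi : dual_bimod M) x t :
  (dact phi t) x = @tact K A (tensor_bimod A) t (phi x).
Proof.
have D1 : additive_fun (dact phi) by move=> t1 t2; apply: (tliftD (dact_bilinear phi)).
have [D2 D3] := (@tactD K A (tensor_bimod A), @tact_bilinear K A (tensor_bimod A)).
have D4 (y : tensor A) : additive_fun (fun t : tensor_bimod A => tact t y).
  move=> t1 t2; elim/tensor_ind: y => [|y z IHy IHz|u v].
  - by rewrite !tact0 addr0.
  - by rewrite !tactD IHy IHz addrACA.
  - by rewrite !tact_pure ractDl scalerDr.
elim/tensor_ind: t => [|t1 t2 IH1 IH2|u v].
- by rewrite (additive_fun0 D1) (additive_fun0 (D4 _)).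
- by rewrite D1 D4 -IH1 -IH2.
rewrite /dact (tlift_pure (dact_bilinear phi)).
change (inner_lact v (inner_ract (phi x) u) = tact (pure_tensor u v : tensor_bimod A) (phi x)).
elim/tensor_ind: (phi x) => [|y z IHy IHz|u' v'].
- by rewrite tact0 /inner_ract tensor_map0 /inner_lact tensor_map0.
- by rewrite tactD -IHy -IHz /inner_ract tensor_mapD /inner_lact tensor_mapD.
- by rewrite inner_ractE inner_lactE tact_pure [ract _ _]outer_ractE [RHS]outer_lactE.
Qed.

(** Applying [psi] to the expansion of [x] shows that the functionals of a dual basis generate the
    dual, with the values of [psi] as coefficients. *)
Lemma dual_expand (psi : dual_bimod M) :
  psi = \sum_(p <- s) dact (p.2 : dual_bimod M) (psi p.1).
Proof.
apply: bimod_hom_ext => x; rewrite [in LHS](sP x) linear_sum.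
rewrite (additive_fun_sum (F := fun phi : dual_bimod M => phi x)) //.
apply: eq_bigr => p _; rewrite dact_eval.
elim/tensor_ind: (p.2 x) => [|y z IHy IHz|u v].
- by rewrite !tact0 linear0.
- by rewrite !tactD linearD IHy IHz.
- by rewrite !tact_pure linearZ /= bimod_homR.
Qed.

(** The counterpart of [right_lift] for the dual: by [dual_expand] it is built from copies of
    [A (x) A] with left action on the second factor, so [K]-linear lifts in the first factor
    suffice. *)
Lemma dual_left_lift (N N' : lmodType A) (F : {linear dual_bimod M -> N})
    (g : {linear N' -> N}) :
  (forall x, exists y, g y = F x) ->
  exists h : {linear dual_bimod M -> N'}, forall x, g (h x) = F x.
Proof.
move=> Fg; have [gk gkE] : exists gk : {linear kmod N' -> kmod N}, gk =1 g.
  by apply: linear_of_fun => k x y; rewrite linearD linearZ.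
have lift_gen (phi : dual_bimod M) :
    exists h : {linear A -> kmod N'}, forall u, g (h u) = F (ract phi u).
  have [Fe FeE] : exists Fe : {linear A -> kmod N}, Fe =1 (fun u => F (ract phi u)).
    by apply: linear_of_fun => k u v; rewrite ractDr linearD ract_scale linearZ.
  have [u|h hP] := @vector_space_lift K A (kmod N') (kmod N) Fe gk.
    by rewrite FeE; have [y yP] := Fg (ract phi u); exists y; rewrite gkE.
  by exists h => u; rewrite -gkE hP FeE.
have [h hP] := choice lift_gen.
pose b phi u v : kmod N' := v *: (h phi u : N').
have bP phi : bilinear_fun (b phi).
  split=> [v k u u'|u k v v']; rewrite /b.
    by rewrite linearP scalerDr scale_scalar_comm.
  by rewrite scalerDl scale_scalar.
have [H HE] : exists H : {linear dual_bimod M -> N'},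
    forall psi, H psi = \sum_(p <- s) tlift (b p.2) (psi p.1).
  apply: linear_of_fun => a phi psi; rewrite scaler_sumr -big_split.
  apply: eq_bigr => p _ /=; rewrite [LHS](tliftD (bP _)); congr (_ + _).
  change (tlift (b p.2) (inner_lact a (phi p.1)) = a *: (tlift (b p.2) (phi p.1) : N')).
  elim/tensor_ind: (phi p.1) => [|y z IHy IHz|u v].
  - by rewrite /inner_lact tensor_map0 (tlift0 (bP _)) scaler0.
  - by rewrite /inner_lact tensor_mapD !(tliftD (bP _)) scalerDr -IHy -IHz.
  - by rewrite inner_lactE !(tlift_pure (bP _)) /b scalerA.
exists H => psi; rewrite HE linear_sum [in RHS](dual_expand psi) linear_sum.
apply: eq_bigr => p _; elim/tensor_ind: (psi p.1) => [|y z IHy IHz|u v].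
- by rewrite (tlift0 (bP _)) [dact _ _](tlift0 (dact_bilinear _)) !linear0.
- by rewrite (tliftD (bP _)) [dact _ _](tliftD (dact_bilinear _)) !linearD IHy IHz.
- rewrite (tlift_pure (bP _)) [dact _ _](tlift_pure (dact_bilinear _)) /b !linearZ.
  by rewrite hP.
Qed.

End Dual.

End Lifting.

(** * Functionals on A / I applied to the second tensor factor *)

Section Slices.
Variables (K : fieldType) (A : algType K).
Implicit Types M N : bimod A.

Definition slice (xi : {linear A -> K^o}) (x : tensor A) : A :=
  tlift (V := A) (fun u v => (xi v : K) *: u) x.

Section OneFunctional.
Variable xi : {linear A -> K^o}.

Lemma slice_bilinear : bilinear_fun (V := A) (fun u v => (xi v : K) *: u).
Proof.
split=> [v k u u'|u k v v'] /=.
  by rewrite scalerDr !scalerA mulrC.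
by rewrite linearP scalerDl -scalerA.
Qed.

Lemma sliceD : additive_fun (slice xi).
Proof. by move=> x y; apply: (tliftD slice_bilinear). Qed.
Lemma slice0 : slice xi 0 = 0. Proof. exact: additive_fun0 sliceD. Qed.
Lemma slice_pure u v : slice xi (pure_tensor u v) = (xi v : K) *: u.
Proof. exact: (tlift_pure slice_bilinear). Qed.

Lemma slice_lact a x : slice xi (outer_lact a x) = a * slice xi x.
Proof.
elim/tensor_ind: x => [|x y IHx IHy|u v].
- by rewrite /outer_lact tensor_map0 slice0 mulr0.
- by rewrite /outer_lact tensor_mapD !sliceD mulrDr IHx IHy.
- by rewrite outer_lactE !slice_pure scalerAr.
Qed.

Lemma slice_inner_ract x a : slice xi (inner_ract x a) = slice xi x * a.
Proof.
elim/tensor_ind: x => [|x y IHx IHy|u v].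
- by rewrite /inner_ract tensor_map0 slice0 mul0r.
- by rewrite /inner_ract tensor_mapD !sliceD mulrDl IHx IHy.
- by rewrite inner_ractE !slice_pure scalerAl.
Qed.

Lemma slice_inner_scalar (k : K) x : slice xi (inner_lact k%:A x) = k *: slice xi x.
Proof.
elim/tensor_ind: x => [|x y IHx IHy|u v].
- by rewrite /inner_lact tensor_map0 slice0 scaler0.
- by rewrite /inner_lact tensor_mapD !sliceD scalerDr IHx IHy.
- by rewrite inner_lactE !slice_pure mulr_algl linearZ scalerA.
Qed.

End OneFunctional.

Variable I : ideal A.
Variables (m : nat) (b : nat -> A) (xi : nat -> {linear A -> K^o}).
Hypothesis xiI : forall l u, u \in I -> xi l u = 0.
Hypothesis xiP : forall x, x - \sum_(i < m) (xi i x : K) *: b i \in I.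

(** Expanding [v] modulo the left ideal [I] gives the matrix of the right action of [y] on the dual
    of [A / I]. *)
Lemma xi_mull l y v : xi l (y * v) = \sum_(k < m) (xi k v : K) * (xi l (y * b k) : K).
Proof.
have := xiI l (idealMl y (xiP v)); rewrite mulrBr linearB mulr_sumr linear_sum.
move/eqP; rewrite subr_eq0 => /eqP ->; apply: eq_bigr => k _.
by rewrite -scalerAr linearZ.
Qed.

Lemma slice_ract_ideal l a x : a \in I -> slice (xi l) (outer_ract x a) = 0.
Proof.
move=> aI; elim/tensor_ind: x => [|x y IHx IHy|u v].
- by rewrite /outer_ract tensor_map0 slice0.
- by rewrite /outer_ract tensor_mapD !sliceD IHx IHy addr0.
- by rewrite outer_ractE slice_pure xiI ?scale0r //; apply: idealMl.
Qed.

Lemma slice_inner_ideal l a x : a \in I -> slice (xi l) (inner_lact a x) = 0.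
Proof.
move=> aI; elim/tensor_ind: x => [|x y IHx IHy|u v].
- by rewrite /inner_lact tensor_map0 slice0.
- by rewrite /inner_lact tensor_mapD !sliceD IHx IHy addr0.
- by rewrite inner_lactE slice_pure xiI ?scale0r //; apply: Defs.idealMr.
Qed.

Lemma slice_inner_lact l y x :
  slice (xi l) (inner_lact y x) = \sum_(k < m) (xi l (y * b k) : K) *: slice (xi k) x.
Proof.
elim/tensor_ind: x => [|x z IHx IHz|u v].
- rewrite /inner_lact tensor_map0 slice0 big1 // => k _.
  by rewrite slice0 scaler0.
- rewrite /inner_lact tensor_mapD sliceD IHx IHz -big_split.
  by apply: eq_bigr => k _; rewrite sliceD scalerDr.
- rewrite inner_lactE slice_pure xi_mull scaler_suml; apply: eq_bigr => k _.
  by rewrite slice_pure scalerA mulrC.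
Qed.

(** The map attached to the element [\sum_l xi l (x) psi l] of the dual of [A / I] tensored over [A]
    with the dual of [M]. *)
Definition slice_sum M (psi : nat -> dual M) (x : M) : A :=
  \sum_(l < m) slice (xi l) (psi l x).

Lemma slice_sum_linear M (psi : nat -> dual M) :
  exists f : {linear M -> A^o}, f =1 slice_sum psi.
Proof.
apply: linear_of_fun => a x y; rewrite /slice_sum scaler_sumr -big_split.
apply: eq_bigr => l _ /=; rewrite linearP sliceD; congr (_ + _).
exact: slice_lact.
Qed.

Lemma slice_sum_kill M (psi : nat -> dual M) x a : a \in I ->
  slice_sum psi (ract x a) = 0.
Proof.
move=> aI; apply: big1 => l _; rewrite bimod_homR.
exact: slice_ract_ideal.
Qed.

(* Left linear maps [M -> A] killing [M I] come from [D(A/I) (x) Hom(M, A (x) A)]. *)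
Lemma slice_expand M (s : seq (M * dual M)) (f : {linear M -> A^o}) :
  dual_basis s -> (forall x a, a \in I -> f (ract x a) = 0) ->
  exists psi : nat -> dual M, forall x, f x = slice_sum psi x.
Proof.
move=> sP fI; pose psi l : dual_bimod M :=
  \sum_(p <- s) ract (p.2 : dual_bimod M) (f (ract p.1 (b l)) : A).
exists psi => x; rewrite /slice_sum.
have psiE l : psi l x = \sum_(p <- s) inner_ract (p.2 x) (f (ract p.1 (b l)) : A).
  exact: (additive_fun_sum (F := fun phi : dual_bimod M => phi x)).
under eq_bigr => l _ do rewrite psiE (additive_fun_sum (@sliceD _)).
rewrite exchange_big [in LHS](sP x) linear_sum; apply: eq_bigr => p _ /=.
elim/tensor_ind: (p.2 x) => [|y z IHy IHz|u v].
- rewrite tact0 linear0 big1 // => l _.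
  by rewrite /inner_ract tensor_map0 slice0.
- rewrite tactD linearD IHy IHz -big_split; apply: eq_bigr => l _.
  by rewrite /inner_ract tensor_mapD sliceD.
have fv e : f (ract e v) = \sum_(l < m) (xi l v : K) *: (f (ract e (b l)) : A).
  rewrite -[v in LHS](subrK (\sum_(i < m) (xi i v : K) *: b i)) ractDr linearD fI // add0r.
  rewrite (additive_fun_sum (F := fun a => ract e a)); last exact: ractDr.
  rewrite linear_sum; apply: eq_bigr => l _.
  by rewrite ract_scale linearZ /= -[LHS]/(_ * _) mulr_algl.
rewrite tact_pure linearZ /= fv -[LHS]/(_ * _) mulr_sumr; apply: eq_bigr => l _.
by rewrite inner_ractE slice_pure scalerAr.
Qed.

(* A left linear map between duals acts on [D(A/I) (x) Hom(M, A (x) A)], hence *)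
(* respects the vanishing of the associated maps.                             *)
Lemma slice_transfer M M' (s : seq (M * dual M))
    (h : {linear dual_bimod M -> dual_bimod M'}) (psi : nat -> dual_bimod M) :
  dual_basis s -> (forall x, slice_sum psi x = 0) ->
  forall x', slice_sum (fun l => h (psi l)) x' = 0.
Proof.
move=> sP psi0 x'.
pose G k (phi : dual_bimod M) (u : A) := slice (xi k) (h (ract phi u) x').
have GD k phi : additive_fun (G k phi).
  by move=> u v; rewrite /G ractDr linearD dual_evalD sliceD.
have GZ k phi (c : K) u : G k phi (c *: u) = c *: G k phi u.
  rewrite /G ract_scale linearZ; exact: slice_inner_scalar.
(* Left linearity of [h] and [xi_mull] express the left side through slices of [t]. Summed over [l],
   with [t = psi l p.1], these become [slice_sum psi] at [ract p.1 (b k)], which is zero. *)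
have key l phi t : slice (xi l) (h (dact phi t) x') =
    \sum_(k < m) G k phi (slice (xi l) (outer_ract t (b k))).
  elim/tensor_ind: t => [|y z IHy IHz|u v].
  - rewrite [dact _ _](tlift0 (dact_bilinear _)) linear0.
    rewrite [LHS](slice0 (xi l)) big1 // => k _.
    by rewrite /outer_ract tensor_map0 slice0 (additive_fun0 (GD _ _)).
  - rewrite [dact _ _](tliftD (dact_bilinear _)) linearD dual_evalD sliceD IHy IHz.
    rewrite -big_split; apply: eq_bigr => k _.
    by rewrite /outer_ract tensor_mapD sliceD GD.
  - rewrite [dact _ _](tlift_pure (dact_bilinear _)) linearZ.
    rewrite [LHS](slice_inner_lact l v (h (ract phi u) x')); apply: eq_bigr => k _.
    by rewrite outer_ractE slice_pure GZ.
rewrite /slice_sum.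
transitivity (\sum_(l < m) \sum_(p <- s) slice (xi l) (h (dact p.2 (psi l p.1)) x')).
  apply: eq_bigr => l _; rewrite {1}(dual_expand sP (psi l)) linear_sum.
  rewrite (additive_fun_sum (F := fun phi : dual_bimod M' => phi x')) //.
  by rewrite (additive_fun_sum (@sliceD _)).
rewrite exchange_big big1 // => p _.
under eq_bigr => l _ do rewrite key.
rewrite exchange_big big1 // => k _ /=.
rewrite -(additive_fun_sum (GD _ _)) -[RHS](additive_fun0 (GD k p.2)); congr (G _ _ _).
rewrite -[RHS](psi0 (ract p.1 (b k))); apply: eq_bigr => l _.
by rewrite bimod_homR.
Qed.

(* The subgroup [M I], defined as the smallest one containing the products. *)
Definition ideal_sub M (x : M) : Prop := forall U : M -> Prop,
  U 0 -> (forall y z, U y -> U z -> U (y + z)) ->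
  (forall y a, a \in I -> U (ract y a)) -> U x.

Lemma ideal_sub0 M : ideal_sub (0 : M). Proof. by []. Qed.
Lemma ideal_subD M (x y : M) : ideal_sub x -> ideal_sub y -> ideal_sub (x + y).
Proof. by move=> xI yI U U0 UD UR; apply: (UD); [apply: xI | apply: yI]. Qed.
Lemma ideal_sub_ract M (x : M) a : a \in I -> ideal_sub (ract x a).
Proof. by move=> aI U U0 UD UR; apply: UR. Qed.
Lemma ideal_sub_sum M (J : Type) (r : seq J) (F : J -> M) :
  (forall j, ideal_sub (F j)) -> ideal_sub (\sum_(j <- r) F j).
Proof. by move=> FI; apply: big_ind => //; apply: ideal_subD. Qed.

(* [M / M I], realized as the image of [M] in a free module. *)
Lemma quotient_exists M (s : seq (M * dual M)) : dual_basis s ->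
  exists (Q : lmodType A) (al : {linear M -> Q}),
    [/\ surj al, forall x, al x = 0 <-> ideal_sub x & fgp Q].
Proof.
move=> sP; pose p0 : M * dual M := (0, 0).
pose J := ('I_(size s) * 'I_m)%type.
pose e (i : J) := ract (nth p0 s i.1).1 (b i.2).
pose c (i : J) (x : M) : A := slice (xi i.2) ((nth p0 s i.1).2 x).
have expand x : ideal_sub (x - \sum_(i : J) c i x *: e i).
  have -> : \sum_(i : J) c i x *: e i = \sum_(p <- s) \sum_(l < m)
      slice (xi l) (p.2 x) *: ract p.1 (b l).
    rewrite -(pair_bigA _ (fun i l => c (i, l) x *: e (i, l))) /=.
    by rewrite (big_nth p0) big_mkord.
  rewrite [X in X - _](sP x) -sumrB; apply: ideal_sub_sum => p.
  elim/tensor_ind: (p.2 x) => [|y z IHy IHz|u v].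
  - rewrite tact0 sub0r -sumrN big1 // => l _.
    by rewrite slice0 scale0r oppr0.
  - rewrite tactD; under eq_bigr => l _ do rewrite sliceD scalerDl.
    rewrite big_split opprD addrACA.
    exact: ideal_subD.
  rewrite tact_pure; under eq_bigr => l _.
    rewrite slice_pure scale_scalar -scale_scalar_comm -ract_scale; over.
  rewrite -scaler_sumr -(additive_fun_sum (F := fun a => ract p.1 a)); last exact: ractDr.
  rewrite -scalerBr -(additive_funB (F := fun a => ract p.1 a)); last exact: ractDr.
  by rewrite -ract_lact; apply: ideal_sub_ract.
have [al0 al0E] : exists al0 : {linear M -> {ffun J -> A^o}},
    forall x, al0 x = [ffun i => c i x].
  apply: linear_of_fun => a x y; apply/ffunP => i; rewrite !ffunE /c.
  by rewrite linearP sliceD; congr (_ + _); apply: slice_lact.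
have al0_ideal x : ideal_sub x -> al0 x = 0.
  move=> xI; apply: (xI (fun y => al0 y = 0)) => [|y z y0 z0|y a aI].
    exact: linear0.
    by rewrite linearD y0 z0 addr0.
  apply/ffunP => i; rewrite al0E !ffunE /c bimod_homR.
  exact: slice_ract_ideal.
have [Q [j [j_inj jP]]] := submodule_exists (is_submod_im al0).
have [al alP] : exists al : {linear M -> Q}, forall x y, j y = al0 x <-> al x = y.
  apply: linear_of_rel => [x|x y y' <- /j_inj //|a x y x' y' h h'].
    by apply/jP; exists x.
  by rewrite !linearP h h'.
have alE x : j (al x) = al0 x by apply/alP.
have al_surj : surj al.
  by move=> y; have /jP [x xP] : exists y', j y' = j y by [exists y]; exists x; apply/alP.
have al0P x : al x = 0 <-> ideal_sub x.
  split=> [ax|xI]; last by apply/alP; rewrite linear0 al0_ideal.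
  have cx i : c i x = 0.
    by have := al0E x; rewrite -alE ax linear0 => /ffunP /(_ i); rewrite !ffunE.
  have := expand x; rewrite big1 ?subr0 // => i _.
  by rewrite cx scale0r.
exists Q, al; split=> //.
have coord (i : J) : exists f : {linear Q -> A^o}, forall y, f y = j y i.
  by apply: linear_of_fun => a x y; rewrite linearP !ffunE.
have [f fE] := choice coord.
exists [seq (al (e i), f i) | i : J] => y.
have [x <-] := al_surj y; rewrite big_map big_enum /=.
have /al0P := expand x; rewrite linearB linear_sum => /eqP.
rewrite subr_eq0 => /eqP alx; rewrite [LHS]alx; apply: eq_bigr => i _.
by rewrite linearZ fE alE al0E ffunE.
Qed.

End Slices.

(** * Calabi-Yau algebras *)

Section CYData.
Variables (K : fieldType) (A : algType K).

Definition codiff (P : bimod_resolution (regular_bimod A)) (n : nat) :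
    bimod_hom (dual_bimod (P n)) (dual_bimod (P n.+1)) :=
  dual_map (br_diff P n).

(** The 2-Calabi-Yau property on cochains: cohomology lives in degree 2, where the class of [om] is
    a free generator commuting with [A], so that it is [A] as a bimodule. *)
Definition cy2_data (P : bimod_resolution (regular_bimod A)) : Prop :=
  [/\ forall n, exists s : seq (P n * dual (P n)), dual_basis s,
      exists N, forall n, (N <= n)%N -> forall x : P n, x = 0,
      forall psi, codiff P 0 psi = 0 -> psi = 0,
      forall n, n != 1%N -> forall psi, codiff P n.+1 psi = 0 ->
        exists th, psi = codiff P n th
    & exists om, [/\ codiff P 2 om = 0,
        forall psi, codiff P 2 psi = 0 -> exists a th, psi = a *: om + codiff P 1 th,
        forall a, exists th, a *: om - ract om a = codiff P 1 th
      & forall a th, a *: om = codiff P 1 th -> a = 0]].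

Lemma bimod_homZ (M N : bimod A) (f : bimod_hom M N) a x : f (a *: x) = a *: f x.
Proof. exact: linearZ. Qed.

Lemma shift_term0 (M : bimod A) d i (x : shift_term M d i) : i != d%:Z -> x = 0.
Proof.
by move: x; rewrite /shift_term; case: eqP => // _ x _; apply: thinmx0.
Qed.

(** Cohomology is transported through the roof [Z]; [om] is the image of a cocycle of [Z] whose
    other image is 1. *)
Lemma calabi_yau_data : calabi_yau A 2 -> exists P, cy2_data P.
Proof.
case=> P [[P_fgp [N NP]] [Z [f [g [qf qg]]]]]; exists P.
have codiffE n psi : codiff P n psi = cpx_diff (dual_complex P) (Posz n) psi by [].
split.
- by move=> n; case: (P_fgp n); apply: dual_basis_exists.
- by exists N.
(* [Negz 0] is -1, so [1 + i] is degree 0; the differential of the dual complex leaving degree -1 is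
   zero. *)
- move=> psi dpsi; have [_ /(_ psi dpsi) [z [dz [th e]]]] := qf (Negz 0).
  have [/(_ z dz) gi _] := qg (Negz 0).
  have [|z' zz'] := gi.
    by exists 0; rewrite [LHS](shift_term0 _ _) // [RHS](shift_term0 _ _).
  rewrite e zz' (cochain_mapE f) [X in _ + X](_ : _ = 0) // addr0.
  by [].
- move=> n n1 psi dpsi.
  have n2 : 1 + Posz n != 2%:Z by rewrite -[1 + Posz n]/(Posz n.+1) eqz_nat eqSS.
  have [_ /(_ psi dpsi) [z [dz [th e]]]] := qf (Posz n).
  have [/(_ z dz) gi _] := qg (Posz n).
  have [|z' zz'] := gi.
    by exists 0; rewrite [LHS](shift_term0 _ n2) [RHS](shift_term0 _ n2).
  exists (f (Posz n) z' + th); rewrite linearD codiffE [LHS]e zz'.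
  by rewrite (cochain_mapE f).
have [fi fs] := qf (Posz 1); have [gi gs] := qg (Posz 1).
have one : exists z1 : Z (1 + Posz 1), cpx_diff Z _ z1 = 0 /\ g _ z1 = (1 : regular_bimod A).
  have [|z1 [dz1 [y' e]]] := gs (1 : regular_bimod A); first by [].
  by exists z1; split=> //; rewrite e addr0.
have [z1 [dz1 gz1]] := one.
have gaz a : g _ (a *: z1) = (a : regular_bimod A).
  rewrite bimod_homZ gz1; exact: mulr1.
have gza a : g _ (ract z1 a) = (a : regular_bimod A).
  rewrite bimod_homR gz1; exact: mul1r.
exists (f (1 + Posz 1) z1); split.
- by have := cochain_mapE f z1; rewrite dz1 linear0 => /esym.
- move=> psi dpsi; have [z [dz [th e]]] := fs psi dpsi.
  pose a : A := (g (1 + Posz 1) z : regular_bimod A).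
  have [||z' zz'] := gi (z - a *: z1).
  + by rewrite linearB bimod_homZ dz dz1 scaler0 subr0.
  + by exists 0; rewrite linearB gaz subrr.
  exists a, (f (Posz 1) z' + th); rewrite linearD codiffE [LHS]e.
  rewrite -[z in LHS](subrK (a *: z1)) zz' linearD (cochain_mapE f) bimod_homZ.
  by rewrite addrA; congr (_ + _); rewrite addrC.
- move=> a; have [||z' zz'] := gi (a *: z1 - ract z1 a).
  + by rewrite linearB bimod_homZ bimod_homR dz1 scaler0 ract0 subr0.
  + by exists 0; rewrite linearB gaz gza subrr.
  exists (f (Posz 1) z'); rewrite codiffE -(cochain_mapE f) -zz'.
  by rewrite linearB bimod_homZ bimod_homR.
- move=> a th e; have [||z' zz'] := fi (a *: z1).
  + by rewrite bimod_homZ dz1 scaler0.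
  + by exists th; rewrite bimod_homZ.
  have := gaz a; rewrite zz' (cochain_mapE g).
  by [].
Qed.

End CYData.

(** * Reduction modulo an ideal of finite codimension *)

(* What is used of the projective resolution of [R / I] as a left module; the *)
(* augmentation sends [rc_gen] to 1.                                          *)
Record reduced_complex (R : nzRingType) (I : ideal R) := ReducedComplex {
  rc_term :> nat -> lmodType R;
  rc_diff : forall n, {linear rc_term n.+1 -> rc_term n};
  rc_gen : rc_term 0;
  rc_fgp : forall n, fgp (rc_term n);
  rc_bounded : exists N, forall n, (N <= n)%N -> forall x : rc_term n, x = 0;
  rc_exact : forall n, exact_at (rc_diff n.+1) (rc_diff n);
  rc_genI : forall a : R, a \in I <-> exists x, rc_diff 0 x = a *: rc_gen;
  rc_gen_span : forall y, exists a x, y = a *: rc_gen + rc_diff 0 x;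
  rc_Hom : forall f : {linear rc_term 0 -> R^o},
    (forall x, f (rc_diff 0 x) = 0) -> forall y, f y = 0;
  rc_Ext : forall n (f : {linear rc_term n.+1 -> R^o}), n != 1%N ->
    (forall x, f (rc_diff n.+1 x) = 0) ->
    exists g : {linear rc_term n -> R^o}, forall x, f x = g (rc_diff n x);
  rc_Ext2 : forall (f : {linear rc_term 2 -> R^o}) (a : R), a \in I ->
    (forall x, f (rc_diff 2 x) = 0) ->
    exists g : {linear rc_term 1 -> R^o}, forall x, (f x : R) * a = g (rc_diff 1 x)
}.

Section Reduction.
Variables (K : fieldType) (A : algType K) (P : bimod_resolution (regular_bimod A)).
Hypothesis P_data : cy2_data P.

Let d n : bimod_hom (P n.+1) (P n) := br_diff P n.

Lemma br_diff0P x : br_aug P x = 0 <-> exists y, d 0 y = x.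
Proof. exact: br_exact0. Qed.
Lemma br_diffSP n x : d n x = 0 <-> exists y, d n.+1 y = x.
Proof. exact: br_exactS. Qed.

Lemma br_aug_regular : exists e : {linear P 0 -> A^o}, e =1 br_aug P /\
  forall x a, e (ract x a) = (e x : A) * a.
Proof.
have [e eE] : exists e : {linear P 0 -> A^o}, e =1 br_aug P.
  by apply: linear_of_fun => a x y; rewrite linearP.
by exists e; split=> // x a; rewrite !eE bimod_homR.
Qed.

(** The augmented resolution is exact with right projective terms, so it splits over right [A]; this
    is what keeps it exact modulo [P I]. *)
Lemma right_contraction n : exists s : P n -> P n.+1, [/\ additive_fun s,
  forall x a, s (ract x a) = ract (s x) a & forall y, d n (s (d n y)) = d n y].
Proof.
have [basis _ _ _ _] := P_data.
have lift k (F : P k -> P k) : additive_fun F ->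
    (forall x a, F (ract x a) = ract (F x) a) ->
    (forall x, exists y, d k y = F x) -> (forall y, F (d k y) = d k y) ->
    exists s : P k -> P k.+1, [/\ additive_fun s,
      forall x a, s (ract x a) = ract (s x) a & forall y, d k (s (d k y)) = d k y].
  move=> FD FR Fim Fd; have [b bP] := basis k.
  have [s [sD sR sP]] := right_lift bP FD FR Fim.
  by exists s; split=> // y; rewrite sP Fd.
elim: n => [|n [s [sD sR sP]]]; last first.
  apply: (lift _ (fun x => x - s (d n x))) => [x y|x a|x|y].
  - by rewrite linearD sD opprD addrACA.
  - by rewrite bimod_homR sR ractDl ractN.
  - by apply/br_diffSP; rewrite linearB sP subrr.
  - have -> : d n (d n.+1 y) = 0 by apply/br_diffSP; exists y.
    by rewrite (additive_fun0 sD) subr0.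
(* The splitting starts from the right linear section [a => ract p0 a] of the augmentation. *)
have [e [eE eR]] := br_aug_regular; have [p0 p0E] := br_aug_surj P (1 : A).
have e1 : e p0 = 1 by rewrite eE p0E.
apply: (lift _ (fun x => x - ract p0 (e x : A))) => [x y|x a|x|y].
- by rewrite linearD ractDr opprD addrACA.
- by rewrite eR ractDl ractN ractA.
- apply/br_diff0P; rewrite -eE linearB eR e1.
  by rewrite -[X in _ - X]/(1 * _) mul1r subrr.
- have -> : e (d 0 y) = 0 by rewrite eE; apply/br_diff0P; exists y.
  by rewrite [ract p0 0](additive_fun0 (F := fun a => ract p0 a)) ?subr0 //; apply: ractDr.
Qed.

Let D n : bimod A := dual_bimod (P n).
Let dd n : bimod_hom (D n) (D n.+1) := codiff P n.

Lemma codiff2 n th : dd n.+1 (dd n th) = 0.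
Proof.
apply: bimod_hom_ext => x.
have dd0 : d n (d n.+1 x) = 0 by apply/br_diffSP; exists x.
by rewrite -[LHS]/(th (d n (d n.+1 x))) dd0 linear0.
Qed.

(** The dual complex splits over left [A], by descending induction from the degrees where [P]
    vanishes: its terms are left projective and its only cohomology is free. *)
Lemma left_contraction n : exists s : {linear D n.+1 -> D n},
  forall th, dd n (s (dd n th)) = dd n th.
Proof.
have [basis [N NP] _ exD [om [om_cocycle omP _ om_free]]] := P_data.
suff [k Nk] : exists k, (N <= n + k)%N.
  elim: k n Nk => [|k IHk] n Nk.
    exists (\0 : {linear D n.+1 -> D n}) => th; rewrite linear0; apply/esym.
    apply: bimod_hom_ext => x; rewrite addn0 in Nk.
    by rewrite (NP _ (leqW Nk) x) !linear0.
  have [|s sP] := IHk n.+1; first by rewrite addSnnS.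
  have [b bP] := basis n.+1.
  have s0 psi : dd n.+1 (psi - s (dd n.+1 psi)) = 0 by rewrite linearB sP subrr.
  suff [F [Fim Fd]] : exists F : {linear D n.+1 -> D n.+1},
      (forall psi, exists th, dd n th = F psi) /\ (forall th, F (dd n th) = dd n th).
    have [h hP] := dual_left_lift bP (F := F) (g := dd n) Fim.
    by exists h => th; rewrite hP Fd.
  have [n1|n_neq1] := eqVneq n 1%N; last first.
    have [F FE] : exists F : {linear D n.+1 -> D n.+1},
        F =1 (fun psi => psi - s (dd n.+1 psi)).
      apply: linear_of_fun => a x y.
      by rewrite (linear_comb (dd n.+1)) (linear_comb s) scalerBr opprD addrACA.
    exists F; split=> [psi|th]; rewrite FE; last by rewrite codiff2 linear0 subr0.
    by have [th ->] := exD _ n_neq1 _ (s0 psi); exists th.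
  move: s sP b bP s0 {IHk}; rewrite {}n1 => s sP b bP s0.
  (* In degree 2 a cocycle is a multiple of [om] plus a coboundary; [pr] is the coefficient, unique
     by freeness, and removing that multiple leaves a coboundary. *)
  have [pr prP] : exists pr : {linear D 2 -> A^o}, forall psi a,
      (exists th, psi - s (dd 2 psi) = (a : A) *: om + dd 1 th) <-> pr psi = a.
    apply: linear_of_rel => [psi|psi a a' [th e] [th' e']|c x a y a' [th e] [th' e']].
    - by have [a [th e]] := omP _ (s0 psi); exists a, th.
    - apply/eqP; rewrite -subr_eq0; apply/eqP; apply: (om_free _ (th' - th)).
      rewrite scalerBl linearB /=; apply/eqP; rewrite subr_eq addrAC eq_sym subr_eq.
      by rewrite addrC -e' e addrC.
    - exists (c *: th + th').
      rewrite (linear_comb (dd 2)) (linear_comb s) opprD addrACA -scalerBr e e'.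
      rewrite (linear_comb (dd 1)).
      by rewrite scalerDr scalerDl scalerA addrACA.
  have [F FE] : exists F : {linear D 2 -> D 2},
      F =1 (fun psi => psi - s (dd 2 psi) - (pr psi : A) *: om).
    apply: linear_of_fun => a x y.
    rewrite (linear_comb (dd 2)) (linear_comb s) (linear_comb pr)
      scalerDl -scalerA !opprD [a *: x + y + _]addrACA.
    by rewrite (addrACA (a *: x - _)) -!scalerBr.
  exists F; split=> [psi|th]; rewrite FE.
    have /prP [th e] : pr psi = pr psi by [].
    by exists th; rewrite e addrC addKr.
  have -> : pr (dd 1 th) = 0.
    by apply/prP; exists th; rewrite codiff2 linear0 subr0 scale0r add0r.
  by rewrite codiff2 linear0 scale0r !subr0.
by exists N; apply: leq_addl.
Qed.

Variable I : ideal A.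
Variables (m : nat) (b : nat -> A) (xi : nat -> {linear A -> K^o}).
Hypothesis xiI : forall l u, u \in I -> xi l u = 0.
Hypothesis xiP : forall x, x - \sum_(i < m) (xi i x : K) *: b i \in I.

Lemma ideal_sub_map (M N : bimod A) (s : M -> N) x :
  additive_fun s -> (forall x a, s (ract x a) = ract (s x) a) ->
  ideal_sub I x -> ideal_sub I (s x).
Proof.
move=> sD sR xI; apply: (xI (fun x => ideal_sub I (s x))) => [|y z yI zI|y a aI].
- by rewrite (additive_fun0 sD); apply: ideal_sub0.
- by rewrite sD; apply: ideal_subD.
- by rewrite sR; apply: ideal_sub_ract.
Qed.

(** Subtracting [h (dd n (psi l))] turns each [psi l] into a cocycle. As [f] kills boundaries,
    [dd n (psi l)] has zero slice sum, and by [slice_transfer] so has the correction. *)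
Lemma cochain_split n (f : {linear P n -> A^o}) :
  (forall x a, a \in I -> f (ract x a) = 0) -> (forall x, f (d n x) = 0) ->
  exists z : nat -> D n, (forall l, dd n (z l) = 0) /\
    forall x, f x = slice_sum m xi z x.
Proof.
move=> fI fd; have [basis _ _ _ _] := P_data.
have [[s sP] [s' s'P]] := (basis n, basis n.+1).
have [psi psiE] := slice_expand xiP sP fI.
have [h hP] := left_contraction n.
exists (fun l => (psi l : D n) - h (dd n (psi l))); split=> [l|x].
  by rewrite linearB hP subrr.
have h0 : slice_sum m xi (fun l => h (dd n (psi l))) x = 0.
  apply: (slice_transfer xiI xiP h (psi := fun l => dd n (psi l)) s'P) => y.
  by rewrite -[LHS]/(slice_sum m xi psi (d n y)) -psiE fd.
rewrite psiE -[LHS]subr0 -h0 /slice_sum -sumrB; apply: eq_bigr => l _.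
by rewrite -(additive_funB (@sliceD _ _ _)).
Qed.

(** The terms are [P n / P n I]. Exactness comes from [right_contraction], and the Ext statements
    from [cochain_split] and the cohomology of the dual complex. *)
Lemma reduced_complex_exists : inhabited (reduced_complex I).
Proof.
have [basis [N NP] ex0 exD [om [om_cocycle omP om_comm _]]] := P_data.
have quot n : exists (Q : lmodType A) (al : {linear P n -> Q}),
    [/\ surj al, forall x, al x = 0 <-> ideal_sub I x & fgp Q].
  by have [s sP] := basis n; apply: (quotient_exists xiI xiP sP).
have [Q quotQ] := choice quot.
pose al n : {linear P n -> Q n} := sval (cid (quotQ n)).
have [al_surj al0 Q_fgp] : [/\ forall n, surj (al n),
    forall n x, al n x = 0 <-> ideal_sub I x & forall n, fgp (Q n)].
  by split=> n; rewrite /al; case: (cid (quotQ n)) => ? [].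
have dI n x : ideal_sub I x -> ideal_sub I (d n x).
  apply: ideal_sub_map => [y z|y a]; [exact: linearD | exact: bimod_homR].
have diff n : exists dq : {linear Q n.+1 -> Q n}, forall x, dq (al n.+1 x) = al n (d n x).
  have [dq dqP] : exists dq : {linear Q n.+1 -> Q n}, forall y z,
      (exists2 x, al n.+1 x = y & al n (d n x) = z) <-> dq y = z.
    apply: linear_of_rel => [y|_ _ _ [x <- <-] [x' e <-]|a _ _ _ _ [x <- <-] [x' <- <-]].
    - by have [x <-] := al_surj _ y; exists (al n (d n x)), x.
    - have /al0/dI/al0 : al n.+1 (x - x') = 0 by rewrite (linearB (al n.+1)) e subrr.
      by rewrite (linearB (d n)) (linearB (al n)) => /eqP; rewrite subr_eq0 => /eqP.
    - by exists (a *: x + x'); rewrite !linear_comb.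
  by exists dq => x; apply/dqP; exists x.
pose dq n : {linear Q n.+1 -> Q n} := sval (cid (diff n)).
have dqE n x : dq n (al n.+1 x) = al n (d n x) by rewrite /dq; case: (cid (diff n)).
have factor n (f : {linear P n -> A^o}) : (forall x a, a \in I -> f (ract x a) = 0) ->
    exists g : {linear Q n -> A^o}, forall x, g (al n x) = f x.
  move=> fI; have fI' x : ideal_sub I x -> f x = 0.
    move=> xI; apply: (xI (fun x => f x = 0)) => [|y z y0 z0|//].
      exact: linear0.
    by rewrite linearD y0 z0 addr0.
  have [g gP] : exists g : {linear Q n -> A^o}, forall y z,
      (exists2 x, al n x = y & f x = z) <-> g y = z.
    apply: linear_of_rel => [y|_ _ _ [x <- <-] [x' e <-]|a _ _ _ _ [x <- <-] [x' <- <-]].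
    - by have [x <-] := al_surj _ y; exists (f x), x.
    - have /al0/fI' : al n (x - x') = 0 by rewrite (linearB (al n)) e subrr.
      by rewrite (linearB f) => /eqP; rewrite subr_eq0 => /eqP.
    - by exists (a *: x + x'); rewrite !linear_comb.
  by exists g => x; apply/gP; exists x.
have pull n (f : {linear Q n -> A^o}) : exists g : {linear P n -> A^o},
    (forall x, g x = f (al n x)) /\ forall x a, a \in I -> g (ract x a) = 0.
  have [g gE] : exists g : {linear P n -> A^o}, forall x, g x = f (al n x).
    by apply: linear_of_fun => a x y; rewrite !linear_comb.
  exists g; split=> // x a aI; rewrite gE.
  have -> : al n (ract x a) = 0 by apply/al0; apply: ideal_sub_ract.
  exact: linear0.
have [e [eE eR]] := br_aug_regular; have [p0 p0E] := br_aug_surj P (1 : A).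
have e1 : e p0 = 1 by rewrite eE p0E.
have e_ideal x : ideal_sub I x -> (e x : A) \in I.
  move=> xI; apply: (xI (fun x => (e x : A) \in I)) => [|y z yI zI|y a aI].
  - by rewrite linear0; apply: (ideal0 I).
  - by rewrite linearD; apply: (idealD yI zI).
  - by rewrite eR; apply: idealMl.
have ker_e x : e x = 0 -> exists w, d 0 w = x.
  by move=> ex; apply/br_diff0P; rewrite -eE.
have ed w : e (d 0 w) = 0 by rewrite eE; apply/br_diff0P; exists w.
constructor; apply: (@ReducedComplex _ _ Q dq (al 0 p0)) => //.
- exists N => n Nn y; have [x <-] := al_surj n y.
  by rewrite (NP n Nn x) linear0.
- move=> n y; split=> [|[z <-]]; last first.
    have [x <-] := al_surj _ z; rewrite !dqE.
    have -> : d n (d n.+1 x) = 0 by apply/br_diffSP; exists x.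
    exact: linear0.
  have [x <-] := al_surj _ y; rewrite dqE => /al0 dx.
  have [s [sD sR sP]] := right_contraction n.
  have /br_diffSP [w wP] : d n (x - s (d n x)) = 0 by rewrite linearB sP subrr.
  exists (al n.+2 w); rewrite dqE [d _ _]wP linearB.
  have -> : al n.+1 (s (d n x)) = 0 by apply/al0; apply: ideal_sub_map dx.
  by rewrite subr0.
- move=> a; split=> [aI|[y]].
    (* Both terms augment to [a], and [ract p0 a] vanishes modulo [P I]. *)
    have [|w wP] := ker_e (a *: p0 - ract p0 a).
      by rewrite linearB eR linearZ /= e1 mul1r /GRing.scale /= mulr1 subrr.
    exists (al 1 w); rewrite dqE wP linearB linearZ /=.
    have -> : al 0 (ract p0 a) = 0 by apply/al0; apply: ideal_sub_ract.
    by rewrite subr0.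
  have [w <-] := al_surj 1 y; rewrite dqE => wa.
  have /al0/e_ideal : al 0 (d 0 w - a *: p0) = 0.
    by rewrite linearB [al 0 (a *: _)]linearZ wa subrr.
  rewrite linearB ed linearZ /= e1 sub0r /GRing.scale /= mulr1 => aI.
  by rewrite -[a]opprK -mulN1r; apply: Defs.idealMl.
- move=> y; have [x <-] := al_surj 0 y.
  have [|w wP] := ker_e (x - e x *: p0).
    by rewrite linearB linearZ /= e1 /GRing.scale /= mulr1 subrr.
  exists (e x), (al 1 w).
  by rewrite dqE wP linearB linearZ /= addrC subrK.
- move=> f fd y; have [x <-] := al_surj 0 y; have [g [gE gI]] := pull 0 f.
  have [|z [z0 gz]] := cochain_split gI.
    by move=> w; rewrite gE -dqE fd.
  rewrite -gE gz; apply: big1 => l _.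
  by rewrite (ex0 _ (z0 l)) [LHS](slice0 (xi l)).
- move=> n f n1 fd; have [g [gE gI]] := pull n.+1 f.
  have [|z [z0 gz]] := cochain_split gI.
    by move=> w; rewrite gE -dqE fd.
  have [th thE] := choice (fun l => exD n n1 _ (z0 l)).
  have [h hE] := slice_sum_linear m xi th.
  have [|k kE] := factor n h.
    by move=> x a aI; rewrite hE; apply: (slice_sum_kill m xiI).
  exists k => y; have [x <-] := al_surj _ y.
  rewrite dqE kE hE -gE gz; apply: eq_bigr => l _; by rewrite thE.
- move=> f a aI fd; have [g [gE gI]] := pull 2 f.
  have [|z [z0 gz]] := cochain_split gI.
    by move=> w; rewrite gE -dqE fd.
  have [ta taE] := om_comm a.
  (* Modulo coboundaries [om] commutes with [a], so the coefficient of [om] gets multiplied by [a]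
     and falls into [I]; [slice_inner_ideal] then removes that term. *)
  have za l : exists c th, c \in I /\ ract (z l) a = c *: om + dd 1 th.
    have [c [th zl]] := omP _ (z0 l).
    exists (c * a), (ract th a - c *: ta); split; first exact: idealMl.
    have -> : dd 1 (ract th a - c *: ta) = ract (dd 1 th) a - c *: dd 1 ta.
      by rewrite linearB bimod_homR [dd 1 (c *: _)]bimod_homZ.
    rewrite zl ractDl ract_lact.
    have -> : ract om a = a *: om - dd 1 ta by rewrite -taE opprB addrC subrK.
    by rewrite scalerBr scalerA addrAC -addrA.
  have [c cP] := choice za; have [th thP] := choice cP.
  have [h hE] := slice_sum_linear m xi th.
  have [|k kE] := factor 1 h.
    by move=> x a' a'I; rewrite hE; apply: (slice_sum_kill m xiI).
  exists k => y; have [x <-] := al_surj _ y.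
  rewrite dqE kE hE -gE gz /slice_sum mulr_suml; apply: eq_bigr => l _.
  have [cI zl] := thP l.
  rewrite -slice_inner_ract -[inner_ract _ _]/((ract (z l) a) x) zl dual_evalD sliceD.
  rewrite [X in X + _](_ : _ = 0) ?add0r //.
  exact: (slice_inner_ideal xiI l (om x) cI).
Qed.

End Reduction.

(** * Projective dimension one *)

Section ReducedComplex.
Variables (R : nzRingType) (I : ideal R) (Q : reduced_complex I).
Let d n : {linear Q n.+1 -> Q n} := rc_diff Q n.
Let p0 : Q 0 := rc_gen Q.

Lemma rc_diff2 n x : d n (d n.+1 x) = 0.
Proof. by apply/rc_exact; exists x. Qed.

(* Vanishing of [Ext^n(R/I, R)] for [n >= 3] splits the complex from degree 2 on. *)
Lemma rc_retraction n : (2 <= n)%N ->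
  exists t : {linear Q n -> Q n.+1}, forall x, d n (t (d n x)) = d n x.
Proof.
have [N NP] := rc_bounded Q.
suff [k Nk] : exists k, (N <= n + k)%N.
  elim: k n Nk => [|k IHk] n Nk n2.
    exists (\0 : {linear Q n -> Q n.+1}) => x.
    by rewrite (NP n.+1 _ x) ?linear0 //; rewrite addn0 in Nk; apply: leqW.
  have [||t tP] := IHk n.+1; [by rewrite addSnnS | exact: leqW|].
  have [s sP] := rc_fgp Q n.+1.
  have coord (p : Q n.+1 * {linear Q n.+1 -> R^o}) :
      exists g : {linear Q n -> R^o}, forall x, p.2 (x - d n.+1 (t x)) = g (d n x).
    have [f fE] : exists f : {linear Q n.+1 -> R^o}, forall x, f x = p.2 (x - d n.+1 (t x)).
      apply: linear_of_fun => a x y.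
      by rewrite (linear_comb t) (linear_comb (d n.+1)) opprD addrACA -scalerBr linear_comb.
    have [||g gP] := rc_Ext (f := f).
    - by apply: contraTneq n2 => ->.
    - by move=> x; rewrite fE tP subrr linear0.
    by exists g => x; rewrite -fE gP.
  have [g gP] := choice coord.
  have [h hE] : exists h : {linear Q n -> Q n.+1},
      forall y, h y = \sum_(p <- s) g p y *: p.1.
    apply: linear_of_fun => a x y; rewrite scaler_sumr -big_split /=.
    by apply: eq_bigr => p _; rewrite linear_comb scalerDl scalerA.
  exists h => x; have -> : h (d n x) = x - d n.+1 (t x).
    by rewrite hE [RHS]sP; apply: eq_bigr => p _; rewrite gP.
  by rewrite linearB rc_diff2 subr0.
by exists N; apply: leq_addl.
Qed.

(** [Q 0] is projective, so its projection onto [R / I] lifts to [R]. *)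
Lemma rc_lift : exists lam : {linear Q 0 -> R^o},
  forall y, exists x, y = lam y *: p0 + d 0 x.
Proof.
have [s sP] := rc_fgp Q 0; have [a aP] := choice (@rc_gen_span _ _ Q).
have [x xP] := choice aP.
have [lam lamE] : exists lam : {linear Q 0 -> R^o},
    forall y, lam y = \sum_(p <- s) p.2 y *: (a p.1 : R^o).
  apply: linear_of_fun => c y z; rewrite scaler_sumr -big_split /=.
  by apply: eq_bigr => p _; rewrite linear_comb scalerDl scalerA.
exists lam => y; exists (\sum_(p <- s) p.2 y *: x p.1).
rewrite [LHS]sP lamE scaler_suml linear_sum -big_split; apply: eq_bigr => p _ /=.
by rewrite [in LHS](xP p.1) scalerDr scalerA linearZ.
Qed.

(** If [I a = 0], sending [b *: p0] plus a boundary to [b * a] defines a map on [Q 0] that kills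
    boundaries. It is zero because Hom(R/I, R) = 0, and its value at [p0] is [a]. *)
Lemma rc_faithful (a : R) : (forall x, x \in I -> x * a = 0) -> a = 0.
Proof.
move=> Ia; have [f fP] : exists f : {linear Q 0 -> R^o}, forall y c,
    (exists b x, y = b *: p0 + d 0 x /\ c = b * a) <-> f y = c.
  apply: linear_of_rel => [y|y _ _ [b [x [e ->]]] [b' [x' [e' ->]]]|].
  - by have [b [x e]] := rc_gen_span y; exists (b * a), b, x.
  - apply/eqP; rewrite -subr_eq0 -mulrBl; apply/eqP/Ia/(rc_genI Q).
    exists (x' - x); rewrite linearB scalerBl; apply/eqP.
    by rewrite subr_eq addrAC eq_sym subr_eq -e e' addrC.
  - move=> c _ _ _ _ [b [x [-> ->]]] [b' [x' [-> ->]]].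
    exists (c * b + b'), (c *: x + x'); split.
      by rewrite (linear_comb (d 0)) scalerDl scalerDr -scalerA addrACA.
    by rewrite mulrDl -mulrA.
have <- : f p0 = a.
  by apply/fP; exists 1, 0; rewrite scale1r linear0 addr0 mul1r.
apply: rc_Hom => x; apply/fP; exists 0, x.
by rewrite scale0r add0r mul0r.
Qed.

Variables (T : lmodType R) (j : {linear T -> R^o}).
Hypotheses (j_inj : injective j) (jP : forall a : R, a \in I <-> exists t, j t = a).

(** [tau] maps [Q 1] to the ideal, and [h \o tau] is a coboundary because Ext^1(R/I, R) = 0. The
    term [h k] corrects for [lam p0], which is 1 only modulo [I]. *)
Lemma rc_hom (h : {linear T -> R^o}) : exists a : R, forall t, h t = (j t : R) * a.
Proof.
have [lam lamP] := rc_lift.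
have lamI y b : (exists x, y = b *: p0 + d 0 x) -> (lam y - b : R) \in I.
  move=> [x e]; have [x' e'] := lamP y; apply/(rc_genI Q); exists (x - x').
  by rewrite linearB scalerBl; apply/eqP; rewrite subr_eq addrAC eq_sym subr_eq -e' e addrC.
have [tau tauP] : exists tau : {linear Q 1 -> T}, forall x t,
    j t = lam (d 0 x) <-> tau x = t.
  apply: linear_of_rel => [x|x t t' <- /j_inj //|a x t x' t' e e'].
    apply/jP; rewrite -[lam _]subr0; apply: lamI; exists x.
    by rewrite scale0r add0r.
  by rewrite !linear_comb e e'.
have tauE x : j (tau x) = lam (d 0 x) by apply/tauP.
have [||g gP] := rc_Ext (f := [the {linear Q 1 -> R^o} of h \o tau]) => //.
  move=> x /=; suff -> : tau (rc_diff Q 1 x) = 0 by apply: linear0.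
  by apply: j_inj; rewrite tauE rc_diff2 !linear0.
have /jP [k kE] : (lam p0 - 1 : R) \in I.
  by apply: lamI; exists 0; rewrite scale1r linear0 addr0.
exists (g p0 - h k) => t.
have /(rc_genI Q) [w wE] : (j t : R) \in I by apply/jP; exists t.
have tw : tau w = t + j t *: k.
  apply/tauP; rewrite linearD linearZ /= kE [d 0 w]wE linearZ /=.
  by rewrite /GRing.scale /= mulrBr mulr1 addrC subrK.
have := gP w; rewrite /= tw wE linearD !linearZ /= => e.
by rewrite mulrBr; apply/eqP; rewrite eq_sym subr_eq; apply/eqP/esym/e.
Qed.

(** [Z] is the image of [d 1], a retract of [Q 2] by [rc_retraction]. [P] is the kernel of the
    surjection from the sum of [Q 1] and [R] onto [Q 0], and its second coordinate covers the ideal.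
    Maps on [Z] induce 2-cocycles through [pi], so [rc_Ext2] gives the last clause. *)
Lemma rc_resolution : exists (Z P : lmodType R) (i : {linear Z -> P}) (g : {linear P -> T}),
  [/\ fgp Z, fgp P, short_exact i g
    & forall (f : {linear Z -> R^o}) (a : R), a \in I ->
        exists h : {linear P -> R^o}, forall z, h (i z) = (f z : R) * a].
Proof.
have [Z [jz [jz_inj jzP]]] := submodule_exists (is_submod_im (d 1)).
have [pi piP] : exists pi : {linear Q 2 -> Z}, forall y z, jz z = d 1 y <-> pi y = z.
  apply: linear_of_rel => [y|y z z' <- /jz_inj //|a y z y' z' e e'].
    by apply/jzP; exists y.
  by rewrite !linear_comb e e'.
have piE y : jz (pi y) = d 1 y by apply/piP.
have Z_fgp : fgp Z.
  have [//|t tP] := @rc_retraction 2.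
  have [e eP] : exists e : {linear Z -> Q 2}, forall z y,
      (exists2 x, d 1 x = jz z & x - d 2 (t x) = y) <-> e z = y.
    apply: linear_of_rel => [z|z _ _ [x ex <-] [x' ex' <-]|a z _ z' _ [x ex <-] [x' ex' <-]].
    - have /jzP [x xP] : exists y, jz y = jz z by exists z.
      by exists (x - d 2 (t x)), x.
    - have /rc_exact [w wE] : d 1 (x - x') = 0 by rewrite linearB ex ex' subrr.
      have := tP w; rewrite [d 2 w]wE linearB linearB => /eqP.
      rewrite subr_eq addrAC eq_sym subr_eq => /eqP exx.
      apply/eqP; rewrite subr_eq addrAC eq_sym subr_eq; apply/eqP.
      by rewrite addrC -exx addrC.
    - exists (a *: x + x'); first by rewrite !linear_comb ex ex'.
      by rewrite (linear_comb t) (linear_comb (d 2)) opprD addrACA -scalerBr.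
  apply: (fgp_retract (e := e) (r := pi)) (rc_fgp Q 2).
  move=> z; apply/piP; have /eP [x ex <-] : e z = e z by [].
  by rewrite linearB rc_diff2 subr0 ex.
have [u uE] : exists u : {linear (Q 1 * R^o)%type -> Q 0},
    forall p, u p = d 0 p.1 + (p.2 : R) *: p0.
  apply: linear_of_fun => a x y.
  by rewrite (linear_comb (d 0)) scalerDl scalerDr addrACA scalerA.
have [P [jp [jp_inj jpP]]] := submodule_exists (is_submod_ker u).
have P_fgp : fgp P.
  have dom_fgp : fgp (Q 1 * R^o)%type.
    exact: fgp_prod (rc_fgp Q 1) (fgp_regular R).
  apply: (fgp_ker (g := u) dom_fgp (rc_fgp Q 0) jp_inj) => [x|y].
    by rewrite -jpP.
  by have [a [x ->]] := rc_gen_span y; exists (x, a); rewrite uE addrC.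
have [g gP] : exists g : {linear P -> T}, forall p t, j t = (jp p).2 <-> g p = t.
  apply: linear_of_rel => [p|p t t' <- /j_inj //|a p t p' t' e e'].
    apply/jP/(rc_genI Q); exists (- (jp p).1).
    have : u (jp p) = 0 by apply/jpP; exists p.
    by rewrite uE linearN => /eqP; rewrite addrC addr_eq0 => /eqP.
  by rewrite !linear_comb e e'.
have gE p : j (g p) = (jp p).2 by apply/gP.
have [i iP] : exists i : {linear Z -> P}, forall z p, jp p = (jz z, 0) <-> i z = p.
  apply: linear_of_rel => [z|z p p' <- /jp_inj //|a z p z' p' e e'].
    apply/jpP; rewrite uE scale0r addr0.
    have /jzP [x <-] : exists y, jz y = jz z by exists z.
    exact: rc_diff2.
  rewrite linear_comb e e' linear_comb; congr (_, _).
  by rewrite /= scaler0 addr0.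
have iE z : jp (i z) = (jz z, 0) by apply/iP.
exists Z, P, i, g; split=> //.
  split.
  - by move=> z z' /(congr1 jp); rewrite !iE => -[/jz_inj].
  - move=> p; split=> [gp|[z <-]]; last by apply/gP; rewrite linear0 iE.
    have p2 : (jp p).2 = 0 by rewrite -gE gp linear0.
    have /jzP [z zE] : exists x, d 1 x = (jp p).1.
      apply/rc_exact; have : u (jp p) = 0 by apply/jpP; exists p.
      by rewrite uE p2 scale0r addr0.
    by exists z; apply/iP; rewrite zE -p2 -surjective_pairing.
  - move=> t; have /(rc_genI Q) [x xE] : (j t : R) \in I by apply/jP; exists t.
    have /jpP [p pE] : u (- x, j t) = 0 by rewrite uE linearN xE addNr.
    by exists p; apply/gP; rewrite pE.
move=> f a aI.
have [|k kP] := rc_Ext2 (f := [the {linear Q 2 -> R^o} of f \o pi]) aI.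
  move=> x /=; suff -> : pi (rc_diff Q 2 x) = 0 by apply: linear0.
  by apply/piP; rewrite linear0 rc_diff2.
have [h hE] : exists h : {linear P -> R^o}, forall p, h p = k (jp p).1.
  by apply: linear_of_fun => c x y; rewrite !linear_comb.
exists h => z; rewrite hE iE.
have /jzP [x xE] : exists y, jz y = jz z by exists z.
rewrite -xE -kP /=; congr (f _ * a).
exact/piP.
Qed.

End ReducedComplex.

(** * The converse algebra *)

Section ConverseAlgebra.
Variables (K : fieldType) (A : algType K).
Let conv_scale (k : K) (x : A^c) : A^c := k *: (x : A).
Lemma conv_scaleA k l x : conv_scale k (conv_scale l x) = conv_scale (k * l) x.
Proof. exact: scalerA. Qed.
Lemma conv_scale1 : left_id 1 conv_scale. Proof. exact: scale1r. Qed.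
Lemma conv_scaleDr : right_distributive conv_scale +%R. Proof. exact: scalerDr. Qed.
Lemma conv_scaleDl x : {morph conv_scale^~ x : k l / k + l}.
Proof. by move=> k l; apply: scalerDl. Qed.
HB.instance Definition _ := GRing.Zmodule_isLmodule.Build K A^c
  conv_scaleA conv_scale1 conv_scaleDr conv_scaleDl.
Lemma conv_scaleAl (k : K) (x y : A^c) : k *: (x * y) = k *: x * y.
Proof. exact: (scalerAr k (y : A) (x : A)). Qed.
HB.instance Definition _ := GRing.LSemiModule_isLSemiAlgebra.Build K A^c conv_scaleAl.
Lemma conv_scaleAr (k : K) (x y : A^c) : k *: (x * y) = x * (k *: y).
Proof. exact: (scalerAl k (y : A) (x : A)). Qed.
HB.instance Definition _ := GRing.LSemiAlgebra_isSemiAlgebra.Build K A^c conv_scaleAr.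
End ConverseAlgebra.

Section PureTensor.
Variables (K : fieldType) (A : algType K).

Lemma tensor_eval_add (V : lmodType K) (b : {bilinear A -> A -> V}) (x y : tensor A) :
  tensor_eval b (x + y) = tensor_eval b x + tensor_eval b y.
Proof. exact: tensor_evalD. Qed.

Lemma tensor_eval_pure (V : lmodType K) (b : {bilinear A -> A -> V}) u v :
  tensor_eval b (pure_tensor u v) = b u v.
Proof. by rewrite tensor_eval_of /bilinear_sum big_seq1. Qed.

Lemma pure_tensorDl (u u' v : A) :
  pure_tensor (u + u') v = pure_tensor u v + pure_tensor u' v.
Proof.
by apply: tensor_ext => V b; rewrite tensor_eval_add !tensor_eval_pure linearDl.
Qed.

Lemma pure_tensorDr (u v v' : A) :
  pure_tensor u (v + v') = pure_tensor u v + pure_tensor u v'.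
Proof.
by apply: tensor_ext => V b; rewrite tensor_eval_add !tensor_eval_pure linearDr.
Qed.

Lemma pure_tensorZl (k : K) (u v : A) :
  pure_tensor (k *: u) v = k%:A *: pure_tensor u v.
Proof. by rewrite [RHS]outer_lactE mulr_algl. Qed.

Lemma pure_tensorZr (k : K) (u v : A) :
  pure_tensor u (k *: v) = k%:A *: pure_tensor u v.
Proof.
rewrite -pure_tensorZl; apply: tensor_ext => V b.
by rewrite !tensor_eval_pure linearZr linearZl_LR.
Qed.

End PureTensor.

Section Swap.
Variables (K : fieldType) (A B : algType K) (i : {linear A -> B}).
Hypothesis iM : forall x y, i (x * y) = i y * i x.

(** Exchanging the factors along an antimultiplicative [i] exchanges left and right in the outer and
    in the inner actions; a general [i] serves [to_conv] and [of_conv] alike. *)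
Definition swap (x : tensor A) : tensor B :=
  tlift (V := kmod (tensor_bimod B)) (fun u v => pure_tensor (i v) (i u)) x.

Lemma swap_bilinear :
  bilinear_fun (V := kmod (tensor_bimod B)) (fun u v => pure_tensor (i v) (i u)).
Proof.
split=> [v k u u'|u k v v']; cbv beta; rewrite linearP.
  by rewrite pure_tensorDr pure_tensorZr.
by rewrite pure_tensorDl pure_tensorZl.
Qed.

Lemma swapD : additive_fun swap.
Proof. by move=> x y; apply: (tliftD swap_bilinear). Qed.
Lemma swap0 : swap 0 = 0. Proof. exact: additive_fun0 swapD. Qed.
Lemma swap_pure u v : swap (pure_tensor u v) = pure_tensor (i v) (i u).
Proof. exact: (tlift_pure swap_bilinear). Qed.

Lemma swap_outer_lact a x : swap (outer_lact a x) = outer_ract (swap x) (i a).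
Proof.
elim/tensor_ind: x => [|x y IHx IHy|u v].
- by rewrite /outer_lact /outer_ract tensor_map0 swap0 tensor_map0.
- by rewrite /outer_lact tensor_mapD !swapD IHx IHy /outer_ract tensor_mapD.
- by rewrite outer_lactE !swap_pure outer_ractE iM.
Qed.

Lemma swap_outer_ract a x : swap (outer_ract x a) = outer_lact (i a) (swap x).
Proof.
elim/tensor_ind: x => [|x y IHx IHy|u v].
- by rewrite /outer_lact /outer_ract tensor_map0 swap0 tensor_map0.
- by rewrite /outer_ract tensor_mapD !swapD IHx IHy /outer_lact tensor_mapD.
- by rewrite outer_ractE !swap_pure outer_lactE iM.
Qed.

Lemma swap_inner_lact a x : swap (inner_lact a x) = inner_ract (swap x) (i a).
Proof.
elim/tensor_ind: x => [|x y IHx IHy|u v].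
- by rewrite /inner_lact /inner_ract tensor_map0 swap0 tensor_map0.
- by rewrite /inner_lact tensor_mapD !swapD IHx IHy /inner_ract tensor_mapD.
- by rewrite inner_lactE !swap_pure inner_ractE iM.
Qed.

Lemma swap_inner_ract a x : swap (inner_ract x a) = inner_lact (i a) (swap x).
Proof.
elim/tensor_ind: x => [|x y IHx IHy|u v].
- by rewrite /inner_lact /inner_ract tensor_map0 swap0 tensor_map0.
- by rewrite /inner_ract tensor_mapD !swapD IHx IHy /inner_lact tensor_mapD.
- by rewrite inner_ractE !swap_pure inner_lactE iM.
Qed.
End Swap.

Lemma swapK (K : fieldType) (A B : algType K) (i : {linear A -> B}) (j : {linear B -> A}) :
  cancel i j -> cancel (swap i) (swap j).
Proof.
move=> iK; elim/tensor_ind=> [|x y IHx IHy|u v]; first by rewrite !swap0.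
  by rewrite !swapD IHx IHy.
by rewrite !swap_pure !iK.
Qed.

Section Flip.
Variables (K : fieldType) (A : algType K).

Definition to_conv : {linear A -> A^c} := (idfun : A -> A^c).
Definition of_conv : {linear A^c -> A} := (idfun : A^c -> A).

Lemma to_convM x y : to_conv (x * y) = to_conv y * to_conv x. Proof. by []. Qed.
Lemma of_convM x y : of_conv (x * y) = of_conv y * of_conv x. Proof. by []. Qed.
Lemma to_convK : cancel to_conv of_conv. Proof. by []. Qed.
Lemma of_convK : cancel of_conv to_conv. Proof. by []. Qed.

Section FlipBimodule.
Variable M : bimod A.

Definition flip_sort : Type := M.
HB.instance Definition _ := GRing.Zmodule.on flip_sort.
Definition flip_scale (a : A^c) (x : flip_sort) : flip_sort := ract (x : M) a.
Lemma flip_scaleA a b x : flip_scale a (flip_scale b x) = flip_scale (a * b) x.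
Proof. exact: ractA. Qed.
Lemma flip_scale1 : left_id 1 flip_scale.
Proof. by move=> x; apply: ract1. Qed.
Lemma flip_scaleDr : right_distributive flip_scale +%R.
Proof. by move=> a x y; apply: ractDl. Qed.
Lemma flip_scaleDl x : {morph flip_scale^~ x : a b / a + b}.
Proof. by move=> a b; apply: ractDr. Qed.
HB.instance Definition _ := GRing.Zmodule_isLmodule.Build A^c flip_sort
  flip_scaleA flip_scale1 flip_scaleDr flip_scaleDl.

Definition flip_ract (x : flip_sort) (a : A^c) : flip_sort := (a : A) *: (x : M).

#[local] Obligation Tactic := idtac.
Program Definition flip : bimod A^c := @Bimod _ _ flip_sort flip_ract _ _ _ _ _ _.
Next Obligation. by move=> x y a; apply: (scalerDr (a : A) (x : M) (y : M)). Qed.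
Next Obligation. by move=> x a b; apply: (scalerDl (x : M) (a : A) (b : A)). Qed.
Next Obligation. by move=> x; apply: (scale1r (x : M)). Qed.
Next Obligation. by move=> x a b; apply: (scalerA (b : A) (a : A) (x : M)). Qed.
Next Obligation. by move=> a x b; apply/esym/ract_lact. Qed.
Next Obligation. by move=> k x; apply/esym/ract_scalar. Qed.
End FlipBimodule.

Section FlipHom.
Variables (M N : bimod A) (f : bimod_hom M N).
Definition flip_fun (x : flip M) : flip N := f x.
Lemma flip_fun_linear : linear flip_fun.
Proof.
move=> a x y; rewrite /flip_fun -[a *: x]/(ract (x : M) a) linearD.
by congr (_ + _); apply: (bimod_homR f (x : M) (a : A)).
Qed.
HB.instance Definition _ := GRing.isLinear.Build A^c (flip M) (flip N) *:%R
  flip_fun flip_fun_linear.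
Lemma flip_funR (x : flip M) (a : A^c) :
  (flip_fun : {linear _ -> _}) (ract x a) = ract (flip_fun x) a.
Proof. exact: (bimod_homZ f (a : A) (x : M)). Qed.
Definition flip_hom : bimod_hom (flip M) (flip N) := BimodHom flip_funR.
End FlipHom.

Section FlipResolution.
Variable P : bimod_resolution (regular_bimod A).

Lemma flip_aug_exists : exists e : bimod_hom (flip (P 0)) (regular_bimod A^c),
  e =1 (br_aug P : P 0 -> A).
Proof.
apply: bimod_hom_of_fun => [a x y|x a].
  rewrite -[a *: x]/(ract (x : P 0) a) [LHS]linearD.
  by congr (_ + _); apply: (bimod_homR (br_aug P) (x : P 0) (a : A)).
exact: (bimod_homZ (br_aug P) (a : A) (x : P 0)).
Qed.

Definition flip_aug := sval (cid flip_aug_exists).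
Lemma flip_augE x : flip_aug x = (br_aug P : P 0 -> A) x.
Proof. exact: (svalP (cid flip_aug_exists)). Qed.

Lemma flip_aug_surj : surj flip_aug.
Proof. by move=> a; have [x xP] := br_aug_surj P a; exists x; rewrite flip_augE. Qed.
Lemma flip_exact0 : exact_at (flip_hom (br_diff P 0)) flip_aug.
Proof. by move=> x; rewrite flip_augE; apply: (@br_exact0 _ _ _ P x). Qed.
Lemma flip_exactS n : exact_at (flip_hom (br_diff P n.+1)) (flip_hom (br_diff P n)).
Proof. by move=> x; apply: (@br_exactS _ _ _ P n x). Qed.

Definition flip_resolution : bimod_resolution (regular_bimod A^c) :=
  BimodResolution flip_aug_surj flip_exact0 flip_exactS.
End FlipResolution.

Section FlipDual.
Variable M : bimod A.

Lemma flip_dual_exists (phi : dual_bimod M) :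
  exists psi : dual_bimod (flip M), forall x, psi x = swap to_conv (phi x).
Proof.
apply: bimod_hom_of_fun => [a x y|x a].
  rewrite linearD swapD; congr (_ + _).
  rewrite -[a *: x]/(ract (x : M) a) bimod_homR.
  exact: (swap_outer_ract to_convM).
rewrite -[ract x a]/((a : A) *: (x : M)) bimod_homZ.
exact: (swap_outer_lact to_convM).
Qed.

Lemma unflip_dual_exists (psi : dual_bimod (flip M)) :
  exists phi : dual_bimod M, forall x, phi x = swap of_conv (psi x).
Proof.
apply: bimod_hom_of_fun => [a x y|x a].
  rewrite [psi _](linearD psi (a *: x) y) swapD; congr (_ + _).
  rewrite -[a *: x]/(ract (x : flip M) a) bimod_homR.
  exact: (swap_outer_ract of_convM).
rewrite -[ract x a]/((a : A^c) *: (x : flip M)) bimod_homZ.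
exact: (swap_outer_lact of_convM).
Qed.

Definition flip_dual phi := sval (cid (flip_dual_exists phi)).
Definition unflip_dual psi := sval (cid (unflip_dual_exists psi)).
Lemma flip_dualE phi x : flip_dual phi x = swap to_conv (phi x).
Proof. exact: (svalP (cid (flip_dual_exists phi))). Qed.
Lemma unflip_dualE psi x : unflip_dual psi x = swap of_conv (psi x).
Proof. exact: (svalP (cid (unflip_dual_exists psi))). Qed.

Lemma flip_dualK : cancel flip_dual unflip_dual.
Proof.
move=> phi; apply: bimod_hom_ext => x; rewrite unflip_dualE flip_dualE.
exact/swapK/to_convK.
Qed.
Lemma unflip_dualK : cancel unflip_dual flip_dual.
Proof.
move=> phi; apply: bimod_hom_ext => x; rewrite flip_dualE unflip_dualE.
exact/swapK/of_convK.
Qed.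

Lemma flip_dualD : additive_fun flip_dual.
Proof.
move=> phi psi; apply: bimod_hom_ext => x.
by rewrite [RHS]dual_evalD !flip_dualE -swapD.
Qed.

Lemma flip_dualZ a phi : flip_dual (a *: phi) = ract (flip_dual phi) (to_conv a).
Proof.
apply: bimod_hom_ext => x; rewrite flip_dualE.
by rewrite -[RHS]/(inner_ract (flip_dual phi x) (to_conv a)) flip_dualE -(swap_inner_lact to_convM).
Qed.

Lemma flip_dualR a phi : flip_dual (ract phi a) = to_conv a *: flip_dual phi.
Proof.
apply: bimod_hom_ext => x; rewrite flip_dualE.
by rewrite -[RHS]/(inner_lact (to_conv a) (flip_dual phi x)) flip_dualE -(swap_inner_ract to_convM).
Qed.

Lemma tact_flip (e : M) x : tact (e : flip M) (swap to_conv x) = tact e x.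
Proof.
elim/tensor_ind: x => [|x y IHx IHy|u v]; first by rewrite swap0 !tact0.
  by rewrite swapD !tactD IHx IHy.
rewrite swap_pure !tact_pure; exact: (ract_lact (u : A) (e : M) (v : A)).
Qed.

Lemma flip_dual_basis (s : seq (M * dual M)) : dual_basis s ->
  dual_basis [seq ((p.1 : flip M), (flip_dual p.2 : dual (flip M))) | p <- s].
Proof.
move=> sP x; rewrite [LHS]sP big_map; apply: eq_bigr => p _.
by rewrite -tact_flip /= flip_dualE.
Qed.
End FlipDual.

Lemma flip_dual_comp (M N : bimod A) (f : bimod_hom M N) (phi : dual_bimod N) :
  dual_map (flip_hom f) (flip_dual phi) = flip_dual (dual_map f phi).
Proof.
apply: bimod_hom_ext => x; rewrite flip_dualE.
exact: flip_dualE.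
Qed.

(** Since [om] commutes with [A] modulo coboundaries, left multiples of [om] can be traded for right
    ones, so its flip is again a free generator. *)
Lemma cy2_data_flip (P : bimod_resolution (regular_bimod A)) :
  cy2_data P -> cy2_data (flip_resolution P).
Proof.
case=> basis [N NP] ex0 exS [om [om_cocycle omP om_comm om_free]].
have codiffE n (phi : dual_bimod (P n)) :
    codiff (flip_resolution P) n (flip_dual phi) = flip_dual (codiff P n phi).
  exact: flip_dual_comp.
have flip0 n : flip_dual (0 : dual_bimod (P n)) = 0.
  exact: (additive_fun0 (@flip_dualD _)).
have cocycle n (psi : dual_bimod (flip (P n))) :
    codiff (flip_resolution P) n psi = 0 -> codiff P n (unflip_dual psi) = 0.
  move=> dpsi; rewrite -[LHS]flip_dualK -codiffE unflip_dualK dpsi -flip0.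
  exact: flip_dualK.
split.
- move=> n; have [s sP] := basis n; exists [seq ((p.1 : flip (P n)),
    (flip_dual p.2 : dual (flip (P n)))) | p <- s].
  exact: flip_dual_basis.
- by exists N.
- move=> psi /cocycle/ex0 psi0; rewrite -[psi]unflip_dualK psi0; exact: flip0.
- move=> n n1 psi /cocycle /(exS n n1) [th e].
  by exists (flip_dual th); rewrite -[psi]unflip_dualK e codiffE.
exists (flip_dual om); split.
- by rewrite codiffE om_cocycle flip0.
- move=> psi /cocycle/omP [a [th e]]; have [ta taE] := om_comm a.
  exists (to_conv a), (flip_dual (ta + th)).
  rewrite -[psi in LHS]unflip_dualK e codiffE linearD -taE -flip_dualR -flip_dualD.
  by rewrite addrA [ract om a + _]addrC subrK.
- move=> a; have [ta taE] := om_comm a; exists (flip_dual (- ta)).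
  rewrite codiffE linearN -taE -[a *: _]/(to_conv a *: _) -[ract _ a]/(ract _ (to_conv a)).
  rewrite -flip_dualR -flip_dualZ -(additive_funB (@flip_dualD _)).
  by rewrite opprB.
- move=> a th; rewrite -[a *: _]/(to_conv a *: _) -flip_dualR -[th]unflip_dualK codiffE.
  move=> /(can_inj (@flip_dualK _)) e; have [ta taE] := om_comm a.
  apply: (om_free _ (ta + unflip_dual th)).
  by rewrite linearD -e -taE subrK.
Qed.

End Flip.

(** * The annihilator of a rigid simple module *)

Section IdealSides.
Variables (R : nzRingType) (I : ideal R).

Definition conv_ideal : ideal R^c :=
  @Ideal R^c (ideal_mem I) (ideal0 I) (@idealD _ I)
    (fun a x => @Defs.idealMr R I a x) (fun a x => @Defs.idealMl R I a x).

Lemma left_ideal_mem_val (t : left_ideal I) : (val t : R) \in I.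
Proof. exact: valP t. Qed.
Lemma right_ideal_mem_val (t : right_ideal I) : (val t : R) \in I.
Proof. exact: valP t. Qed.

Definition to_right (t : left_ideal I) : right_ideal I :=
  @RightIdeal R I (val t) (left_ideal_mem_val t).
Definition to_left (t : right_ideal I) : left_ideal I :=
  @LeftIdeal R I (val t) (right_ideal_mem_val t).

Lemma to_rightK : cancel to_right to_left.
Proof. by move=> t; apply: val_inj. Qed.
Lemma to_leftK : cancel to_left to_right.
Proof. by move=> t; apply: val_inj. Qed.
Lemma to_rightD : {morph to_right : x y / x + y}.
Proof. by move=> x y; apply: val_inj. Qed.
Lemma to_leftD : {morph to_left : x y / x + y}.
Proof. by move=> x y; apply: val_inj. Qed.
Lemma to_leftC a (c : R^c) t :
  to_left (c *: to_right (a *: t)) = a *: to_left (c *: to_right t).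
Proof. by apply: val_inj; apply: (esym (mulrA (a : R) (val t : R) (c : R))). Qed.
Lemma to_rightC (a : R^c) c t :
  to_right (c *: to_left (a *: t)) = a *: to_right (c *: to_left t).
Proof. by apply: val_inj; apply: (mulrA (c : R) (val t : R) (a : R)). Qed.

Lemma left_idealP a : a \in I <-> exists t : left_ideal I, val t = a.
Proof.
split=> [aI|[t <-]]; last exact: left_ideal_mem_val.
by exists (@LeftIdeal R I a aI).
Qed.
Lemma right_idealP (a : R^c) : a \in conv_ideal <-> exists t : right_ideal I, val t = a.
Proof.
split=> [aI|[t <-]]; last exact: right_ideal_mem_val.
by exists (@RightIdeal R I a aI).
Qed.
End IdealSides.

Lemma cofinite_sub (K : fieldType) (V : lmodType K) (U U' : V -> Prop) :
  (forall x, U x -> U' x) -> cofinite U -> cofinite U'.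
Proof. by move=> UU' [m [b bP]]; exists m, b => x; have [c /UU'] := bP x; exists c. Qed.

(** [idempotent_ideal_extend] applies to the sequence of [rc_resolution]: the values of [j] lie in
    [I], which kills Ext^2(R/I, R). *)
Lemma Ext1_ideal_self (R : nzRingType) (I : ideal R) (Q : reduced_complex I)
    (T : lmodType R) (j : {linear T -> R^o}) :
  injective j -> (forall a : R, a \in I <-> exists t, j t = a) ->
  (forall t, exists s : seq (T * T), t = \sum_(p <- s) j p.1 *: p.2) ->
  exists (Z P : lmodType R) (i : {linear Z -> P}) (g : {linear P -> T}),
    [/\ fgp Z, fgp P, short_exact i g
      & forall f : {linear Z -> T}, exists h : {linear P -> T}, forall z, f z = h (i z)].
Proof.
move=> j_inj jP T_idem; have [Z [P [i [g [fZ fP ig kill]]]]] := rc_resolution Q j_inj jP.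
exists Z, P, i, g; split=> // f.
apply: (idempotent_ideal_extend (j := j) j_inj fZ ig) => // [t a|f' t].
  by apply/jP/Defs.idealMr/jP; exists t.
by apply: kill; apply/jP; exists t.
Qed.

Section Proposition.
Variables (K : fieldType) (A : algType K) (S : lmodType A).
Hypotheses (A_CY : calabi_yau A 2) (S_fin : finite_dimensional S).
Hypotheses (S_rigid : rigid S) (S_simple : simple_module S).
Let I : ideal A := annihilator S.

(** [kills es] is cut out by finitely many functionals [a => eta l (a *: x)], with [x] in a spanning
    family and [eta] coordinates on [S]. *)
Lemma spanning_kills : exists es : seq S,
  (forall a : A, kills es a -> forall x : S, a *: x = 0) /\
  cofinite (V := A) (fun a => kills es a).
Proof.
have [n [e eP]] := S_fin; exists (codom e); split.
  move=> a ka x; have [c ->] := eP x; rewrite scaler_sumr big1 // => i _.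
  by rewrite scale_scalar_comm ka ?scaler0 ?codom_f.
pose V := kmod S; have V0 : is_submod (fun x : V => x = 0).
  by split=> // a x y -> ->; rewrite scaler0 addr0.
have [|m [b [eta [_ etaP]]]] := cofinite_dual V0.
  exists n, (fun i => if insub i is Some k then e k else 0) => x.
  have [c ->] := eP x.
  exists (fun i => if insub i is Some k then c k else 0).
  rewrite -sumrB big1 // => i _; rewrite valK; exact: subrr.
elim: (codom e) => [|x s IHs].
  by exists 0%N, (fun=> 0) => x; exists (fun=> 0).
have [f fE] : exists f : nat -> {linear A -> K^o}, forall l (a : A), f l a = eta l (a *: x : V).
  have ex l : exists f : {linear A -> K^o}, forall a : A, f a = eta l (a *: x : V).
    apply: linear_of_fun => k a c; rewrite scalerDl scale_scalar.
    exact: (linear_comb (eta l) k (a *: x : V) (c *: x : V)).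
  by have [f fE] := choice ex; exists f.
have sub : is_submod (M := A) (fun a : A => kills s a).
  split=> [|k a c ka kc]; first exact: is_submod0 (kills_submod s).
  by move=> y ys; rewrite scalerDl scale_scalar ka // kc // scaler0 addr0.
apply: cofinite_sub (cofinite_kers f m sub IHs) => a [ka fa].
apply/kills_cons; split=> //.
have := etaP (a *: x : V); rewrite big1 ?subr0 // => i _.
by rewrite -fE fa ?scale0r.
Qed.

Lemma annihilator_cofinite : cofinite (V := A) (fun a => a \in I).
Proof.
have [es [esP]] := spanning_kills; apply: cofinite_sub => a ka.
by apply/ann_memP; apply: esP.
Qed.

(** One set of coordinates modulo the two-sided ideal serves both sides, the right one through the
    flipped resolution. *)
Lemma reduced_complexes : inhabited (reduced_complex I) /\
  inhabited (reduced_complex (conv_ideal I)).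
Proof.
have [P P_data] := calabi_yau_data A_CY.
have I_sub : is_submod (M := A) (fun a : A => a \in I).
  split=> [|k a b aI bI]; first exact: ideal0.
  by rewrite -mulr_algl; apply: idealD => //; apply: Defs.idealMl.
have [m [b [xi [xiI xiP]]]] := cofinite_dual I_sub annihilator_cofinite.
split; first exact: (reduced_complex_exists P_data xiI xiP).
have [xi' xi'E] : exists xi' : nat -> {linear A^c -> K^o}, forall l a, xi' l a = xi l a.
  have ex l : exists f : {linear A^c -> K^o}, forall a, f a = xi l a.
    by apply: linear_of_fun => k x y; apply: (linear_comb (xi l)).
  by have [f fE] := choice ex; exists f.
apply: (@reduced_complex_exists K A^c _ (cy2_data_flip P_data) (conv_ideal I) m b xi').
  by move=> l u uI; rewrite xi'E; apply: xiI.
move=> x; under eq_bigr => l _ do rewrite xi'E.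
exact: xiP.
Qed.

Let jl : {linear left_ideal I -> A^o} := \val.
Let jr : {linear right_ideal I -> (A^c)^o} := \val.

(** Finite generation of the ideal is read off its resolution: [P] is finitely generated and maps
    onto it. *)
Lemma left_ideal_idempotent (t : left_ideal I) :
  exists s : seq (left_ideal I * left_ideal I), t = \sum_(p <- s) jl p.1 *: p.2.
Proof.
have [[Q] _] := reduced_complexes; have [es [esP _]] := spanning_kills.
have [Z [P [i [g [_ [s sP] [_ _ g_surj] _]]]]] :=
  rc_resolution Q (j := jl) val_inj (left_idealP I).
apply: (ann_idempotent S_simple S_rigid (j := jl) (es := es) val_inj _ esP
  (F := fun p => g p.1) (ks := s)) => [a|u].
  by rewrite -left_idealP; split=> [h|/ann_memP //]; apply/ann_memP.
have [p <-] := g_surj u; exists (fun q : P * {linear P -> A^o} => q.2 p).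
by rewrite {1}(sP p) linear_sum; apply: eq_bigr => q _; rewrite linearZ.
Qed.

(** The same products, with the roles of the two factors exchanged. *)
Lemma right_ideal_idempotent (t : right_ideal I) :
  exists s : seq (right_ideal I * right_ideal I), t = \sum_(p <- s) (jr p.1 : A^c) *: p.2.
Proof.
have [s sP] := left_ideal_idempotent (to_left t).
exists [seq (to_right p.2, to_right p.1) | p <- s]; apply: val_inj.
have := congr1 val sP; rewrite big_map !linear_sum /= => ->.
by apply: eq_bigr => p _.
Qed.

(** On each side the first two conditions come from the resolution there, and the third from
    applying Hom(-, I) to the resolution on the opposite side. *)
Lemma annihilator_tilting : tilting_ideal I.
Proof.
have [[Ql] [Qr]] := reduced_complexes.
have [Zl [Pl [il [gl [Zl_fgp Pl_fgp l_exact l_ext]]]]] :=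
  Ext1_ideal_self Ql (j := jl) val_inj (left_idealP I) left_ideal_idempotent.
have [Zr [Pr [ir [gr [Zr_fgp Pr_fgp r_exact r_ext]]]]] :=
  Ext1_ideal_self Qr (j := jr) val_inj (right_idealP I) right_ideal_idempotent.
split; split.
- by exists Zl, Pl, il, gl; split=> //; apply: fgp_in_add.
- by move=> n n_gt0; apply: (pd1_Ext_vanishes (i := il) (g := gl)).
- apply: (@tilting_coresolution A^c A (right_ideal I) (left_ideal I) (@to_left _ I) (@to_right _ I)
    (@to_leftK _ I) (@to_rightK _ I) (@to_leftD _ I)
    (@to_rightC _ I) Zr Pr ir gr Zr_fgp Pr_fgp r_exact r_ext) => [f|c c0].
    have [a aP] := rc_hom Qr (j := jr) val_inj (right_idealP I)
      [the {linear right_ideal I -> (A^c)^o} of jr \o f].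
    by exists a => t; apply: val_inj; apply: aP.
  apply: (rc_faithful Qr) => x /right_idealP [t <-].
  by have /(congr1 val) := c0 t.
- by exists Zr, Pr, ir, gr; split=> //; apply: fgp_in_add.
- by move=> n n_gt0; apply: (pd1_Ext_vanishes (i := ir) (g := gr)).
- apply: (@tilting_coresolution A A^c (left_ideal I) (right_ideal I) (@to_right _ I) (@to_left _ I)
    (@to_rightK _ I) (@to_leftK _ I) (@to_rightD _ I)
    (@to_leftC _ I) Zl Pl il gl Zl_fgp Pl_fgp l_exact l_ext) => [f|c c0].
    have [a aP] := rc_hom Ql (j := jl) val_inj (left_idealP I)
      [the {linear left_ideal I -> A^o} of jl \o f].
    by exists a => t; apply: val_inj; apply: aP.
  apply: (rc_faithful Ql) => x /left_idealP [t <-].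
  by have /(congr1 val) := c0 t.
Qed.

Lemma annihilator_finite_codimension : finite_codimension I.
Proof.
have [m [b bP]] := annihilator_cofinite.
exists m, (fun i : 'I_m => b i) => x; have [c cI] := bP x.
by exists (fun i : 'I_m => c i).
Qed.

Lemma right_homothety (a : A^c) : exists f : endo (left_ideal I),
  forall x, \val (f x) = (\val x : A) * a.
Proof.
have [f fE] : exists f : {linear left_ideal I -> left_ideal I},
    forall x, f x = to_left (a *: to_right x).
  apply: linear_of_fun => b x y.
  by rewrite to_rightD scalerDr to_leftD to_leftC.
by exists (Endo f) => x; rewrite /= fE.
Qed.

(** Injectivity is [rc_faithful]; surjectivity is [rc_hom] applied to an endomorphism followed by
    the inclusion into [A]. *)
Lemma annihilator_endo :
  exists phi : {rmorphism A^c -> endo (left_ideal I)},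
    [/\ bijective phi,
        forall (k : K) (a : A), phi (k *: a) = k *: phi a
      & forall (a : A) (x : left_ideal I), \val (phi a x) = (\val x : A) * a].
Proof.
have [[Q] _] := reduced_complexes; have [f fE] := choice right_homothety.
have f_eq a (h : endo (left_ideal I)) : (forall x, \val (h x) = (\val x : A) * a) -> f a = h.
  by move=> hE; apply: endo_ext => x; apply: val_inj; rewrite fE hE.
have fB : zmod_morphism f.
  by move=> a b; apply: f_eq => x /=; rewrite !fE -mulrBr.
have fM : monoid_morphism f.
  split=> [|a b]; apply: f_eq => x /=; first by rewrite mulr1.
  by rewrite !fE -mulrA.
pose mB := GRing.isZmodMorphism.Build A^c (endo (left_ideal I)) f fB.
pose mM := GRing.isMonoidMorphism.Build A^c (endo (left_ideal I)) f fM.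
exists (HB.pack_for {rmorphism A^c -> endo (left_ideal I)} f mB mM); split=> /=.
- apply: inj_surj_bij => [a b fab|h].
    apply/eqP; rewrite -subr_eq0; apply/eqP; apply: (rc_faithful Q) => x.
    move=> /left_idealP [t <-]; rewrite mulrBr; apply/eqP; rewrite subr_eq0.
    by rewrite -!fE fab.
  have [a aP] := rc_hom Q (j := jl) val_inj (left_idealP I)
    [the {linear left_ideal I -> A^o} of jl \o h].
  by exists a; apply: f_eq => x; apply: aP.
- move=> k a; apply: f_eq => x.
  change (k%:A * \val (f a x) = \val x * (k *: a)).
  by rewrite fE mulr_algl scalerAr.
- exact: fE.
Qed.

End Proposition.

Theorem proposition1p4 (K : fieldType) (A : algType K) (S : lmodType A)
    (A_CY : calabi_yau A 2) (S_fin : finite_dimensional S)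
    (S_rigid : rigid S) (S_simple : simple_module S) :
  [/\ tilting_ideal (annihilator S),
      finite_codimension (annihilator S)
    & exists phi : {rmorphism A^c -> endo (left_ideal (annihilator S))},
        [/\ bijective phi,
            forall (k : K) (a : A), phi (k *: a) = k *: phi a
          & forall (a : A) (x : left_ideal (annihilator S)),
              \val (phi a x) = (\val x : A) * a]].
Proof.
split; first exact: annihilator_tilting.
  exact: annihilator_finite_codimension.
exact: annihilator_endo.
Qed.
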